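(* Let $A$ be either $\mathbb{H}$ or $\mathbb{O}$ and let $\Omega\subset A$ be a non-empty open circular set. The set $\mathcal{SEN}_A(\Omega)$ of all semiregular slice-Nash functions on $\Omega$ is an alternative $*$-subalgebra of the alternative $*$-algebra $\mathcal{SEM}_A(\Omega)$ of semiregular slice functions on $\Omega$ endowed with $+$, $\cdot$, $\cdot^c$. If $A=\mathbb{H}$, then $\mathcal{SEN}_{\mathbb{H}}(\Omega)$ is associative. Moreover: (i) if $\Omega$ is a symmetric slice domain, then $\mathcal{SEN}_A(\Omega)$ is a division algebra; (ii) if $\Omega$ is a product domain, then $\mathcal{SEN}_A(\Omega)$ includes some element $f\not\equiv 0$ with $N(f)\equiv 0$; however, every element $f$ with $N(f)\not\equiv 0$ admits a multiplicative inverse within the algebra.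
   Context: $\mathbb{H}$ (quaternions) and $\mathbb{O}$ (octonions) carry the standard conjugation $x\mapsto x^c$; $t(x)=x+x^c$, $n(x)=xx^c$, $\mathbb{S}_A=\{I\in A: I^2=-1\}$. Put $u_A=1$ if $A=\mathbb{H}$ and $u_A=3$ if $A=\mathbb{O}$. The complex field is $\mathbb{C}=\{\alpha+\iota\beta\}$ with $\iota\notin\mathbb{S}_A$. For $I\in\mathbb{S}_A$, $\mathbb{C}_I=\mathbb{R}+\mathbb{R}I$. Circular sets: for $D\subset\mathbb{C}$, $\Omega_D=\{\alpha+\beta I:\alpha+\iota\beta\in D,\ I\in\mathbb{S}_A\}$; $\Omega\subset A$ is circular if $\Omega=\Omega_D$ for some $D$, where $D$ is always taken invariant under complex conjugation (then it is determined by $\Omega$). A circular domain is an open connected circular set. A circular domain $\Omega$ is a symmetric slice domain if $\Omega\cap\mathbb{C}_I$ is connected for every $I\in\mathbb{S}_A$ (equivalently $\Omega\cap\mathbb{R}\neq\varnothing$), and a product domain if $\Omega\cap\mathbb{C}_I$ has two connected components, exchanged by conjugation, for every $I$ (equivalently $\Omega\cap\mathbb{R}=\varnothing$). Stem and slice functions: elements of $A\otimes_{\mathbb{R}}\mathbb{C}$ are $x+\iota y$ ($x,y\in A$), with product $(x+\iota y)(x'+\iota y')=xx'-yy'+\iota(xy'+yx')$, $\overline{x+\iota y}=x-\iota y$ and $(x+\iota y)^c=x^c+\iota y^c$. A stem function on an open conjugation-invariant $D\subset\mathbb{C}$ is $F=F_1+\iota F_2:D\to A\otimes_{\mathbb{R}}\mathbb{C}$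 with $F(\overline z)=\overline{F(z)}$. It induces the slice function $f=\mathcal{I}(F):\Omega_D\to A$, $f(\alpha+\beta I)=F_1(\alpha+\iota\beta)+I\,F_2(\alpha+\iota\beta)$; every slice function comes from a unique stem function. $f$ is slice regular if $F$ is holomorphic, i.e. $C^1$ with $\frac{\partial F}{\partial\alpha}+\iota\frac{\partial F}{\partial\beta}=0$; $\mathcal{SR}_A(\Omega)$ is the set of slice regular functions on $\Omega$. Operations: $+$ is pointwise addition; for $f=\mathcal{I}(F)$, $g=\mathcal{I}(G)$ the slice product is $f\cdot g=\mathcal{I}(FG)$, $f^c=\mathcal{I}(F^c)$ with $F^c(z)=F(z)^c$, and the normal function is $N(f)=f\cdot f^c$. An algebra is alternative if the associator $(x,y,z)=(xy)z-x(yz)$ vanishes whenever two of its arguments coincide. Slice-Nash functions: a function $g:D\to\mathbb{C}$ on an open $D\subset\mathbb{C}$ is complex Nash if every point of $D$ has an open neighbourhood $U\subset D$ on which $g$ is holomorphic and satisfies $P(z,g(z))=0$ for some non-zero $P\in\mathbb{C}[z,t]$. For $I\in\mathbb{S}_A$, $A$ is a $\mathbb{C}_I$-vector space by left multiplication; if $\{1,I_1,\ldots,I_{u_A}\}$ is a base over $\mathbb{C}_I$, then $\{I_0:=1,I,I_1,II_1,\ldots,I_{u_A},II_{u_A}\}$ is called a splitting base of $A$ associated to $I$. Write uniquely $F_s=\sum_{k=0}^{u_A}(F_{s,1}^{I,I_k}+F_{s,2}^{I,I_k}I)I_k$ ($s=1,2$) with real-valued coefficients, and $F^{\ell}_{I,I_k}=F_{1,\ell}^{I,I_k}+\iota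 F_{2,\ell}^{I,I_k}:D\to\mathbb{C}$ ($\ell=1,2$). $F$ is stem-Nash on $D$ if for some $I$ and some splitting base associated to $I$ all $F^{\ell}_{I,I_k}$ are complex Nash on $D$. $f=\mathcal{I}(F)$ is slice-Nash on $\Omega_D$ if it is slice regular and $F$ is stem-Nash on $D$; $\mathcal{SN}_A(\Omega)$ is the set of slice-Nash functions on $\Omega$. Semiregular functions: for $y=\alpha+\beta I\in A$ let $\mathbb{S}_y=\{\alpha+\beta J:J\in\mathbb{S}_A\}$ and $\Delta_y(x)=x^2-x\,t(y)+n(y)$. A discrete set of singularities in $\Omega$ is a subset $\Omega_0\subset\Omega$, closed in $\Omega$, which is a union of isolated points of the real axis and isolated spheres $\mathbb{S}_y$, $y\in\Omega\setminus\mathbb{R}$. Let $f$ be slice regular on $\Omega\setminus\Omega_0$. A real point $y\in\Omega_0$ is a removable singularity of $f$ if $f$ extends to a slice regular function near $y$, and a pole if for some integer $k\ge1$ the function $(x-y)^kf(x)$ extends to a slice regular function near $y$ (and $y$ is not removable); a sphere $\mathbb{S}_y\subset\Omega_0$ is a spherical removable singularity, respectively a spherical pole, if the same holds near $\mathbb{S}_y$ with $(x-y)^k$ replaced by $\Delta_y(x)^k$. $f$ is a semiregular slice function on $\Omega$ ($f\in\mathcal{SEM}_A(\Omega)$) if there is a discrete set of singularities $\Omega_0$ with $f\in\mathcal{SR}_A(\Omega\setminus\Omega_0)$ all of whose points/spheres are (spherical) poles or (spherical) removable singularities of $f$. As for meromorphic functions, sums, slice products and conjugates are formed off the union of the discrete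 sets of singularities and functions agreeing off a discrete set of singularities are identified. $f$ is a semiregular slice-Nash function on $\Omega$ ($f\in\mathcal{SEN}_A(\Omega)$) if $f\in\mathcal{SEM}_A(\Omega)$ and $f\in\mathcal{SN}_A(\Omega\setminus\Omega_0)$ for some discrete set of singularities $\Omega_0\subset\Omega$. *)

(* Defs.v *)
From HB Require Import structures.
From mathcomp Require Import all_boot all_order all_algebra.
From mathcomp Require Import complex.
From mathcomp Require Import all_classical all_reals all_analysis.
Set Implicit Arguments.
Unset Strict Implicit.
Unset Printing Implicit Defensive.
Import Order.TTheory GRing.Theory Num.Theory.
Import numFieldNormedType.Exports.
Local Open Scope classical_set_scope.
Local Open Scope ring_scope.

(** * Quaternions and octonions *)

Section CayleyDickson.
Variable R : realType.

(* Levels 0, 1, 2, 3 are R, C, H, O.  The product norm is the sup norm, so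
   the topology is the Euclidean one; only the topology is used below. *)
Fixpoint CD (n : nat) : normedModType R :=
  if n is m.+1 then ((CD m * CD m)%type : normedModType R) else R^o.

Fixpoint cdconj (n : nat) : CD n -> CD n :=
  match n return CD n -> CD n with
  | 0 => fun x => x
  | m.+1 => fun x : (CD m * CD m)%type => (cdconj x.1, - x.2)
  end.

Fixpoint cdone (n : nat) : CD n :=
  match n return CD n with
  | 0 => (1 : R)
  | m.+1 => ((cdone m, 0) : (CD m * CD m)%type)
  end.

(* (a, b)(c, d) = (a c - d^c b, d a + b c^c) *)
Fixpoint cdmul (n : nat) : CD n -> CD n -> CD n :=
  match n return CD n -> CD n -> CD n with
  | 0 => fun x y : R => x * y
  | m.+1 => fun x y : (CD m * CD m)%type =>
      (cdmul x.1 y.1 - cdmul (cdconj y.2) x.2,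
       cdmul y.2 x.1 + cdmul x.2 (cdconj y.1))
  end.

End CayleyDickson.

Inductive algebra_kind := quaternions | octonions.

Definition cdlevel (K : algebra_kind) : nat :=
  match K with quaternions => 2%N | octonions => 3%N end.

Definition alg_u (K : algebra_kind) : nat :=
  match K with quaternions => 1%N | octonions => 3%N end.

Definition alg (R : realType) (K : algebra_kind) : normedModType R :=
  CD R (cdlevel K).

Definition alg_one (R : realType) (K : algebra_kind) : alg R K :=
  cdone R (cdlevel K).

Definition alg_mul (R : realType) (K : algebra_kind) (x y : alg R K) : alg R K :=
  cdmul x y.

Definition alg_conj (R : realType) (K : algebra_kind) (x : alg R K) : alg R K :=
  cdconj x.

(* The complex plane as a real normed space: (alpha, beta) is
   alpha + iota beta. *)
Definition plane (R : realType) : normedModType R :=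
  ((R^o * R^o)%type : normedModType R).

Section Slice.
Variables (R : realType) (K : algebra_kind).
Notation A := (alg R K).
Notation "1A" := (alg_one R K).
Notation C := (plane R).
Infix "**" := (@alg_mul R K) (at level 40, left associativity).

Definition alg_pow (x : A) (k : nat) : A := iter k (alg_mul x) 1A.

Definition alg_tr (x : A) : A := x + alg_conj x.
Definition alg_norm (x : A) : A := x ** alg_conj x.

(* the set S_A of imaginary units *)
Definition imunit : set A := [set I | I ** I = - 1A].

Definition realA : set A := [set x | exists a : R, x = a *: 1A].

Definition slice_point (a b : R) (I : A) : A := a *: 1A + b *: I.

(* the complex line C_I *)
Definition slice_line (I : A) : set A :=
  [set x | exists a b : R, x = slice_point a b I].

(* the sphere S_y; it is {y} when y is real *)
Definition sphere (y : A) : set A :=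
  [set x | exists (a b : R) (I J : A),
     [/\ imunit I, imunit J, y = slice_point a b I & x = slice_point a b J]].

(** * Circular sets *)

Definition planeconj (z : C) : C := (z.1, - z.2).

Definition conj_invariant (D : set C) : Prop := forall z, D z -> D (planeconj z).

Definition circularization (D : set C) : set A :=
  [set x | exists (z : C) (I : A),
     [/\ D z, imunit I & x = slice_point z.1 z.2 I]].

Definition circular (W : set A) : Prop :=
  exists2 D : set C, conj_invariant D & W = circularization D.

(* for W circular, the only conjugation-invariant D with
   W = circularization D *)
Definition planar (W : set A) : set C :=
  [set z | exists2 I : A, imunit I & W (slice_point z.1 z.2 I)].

Definition circular_domain (W : set A) : Prop :=
  [/\ open W, connected W & circular W].

Definition symmetric_slice_domain (W : set A) : Prop :=
  circular_domain W /\
  forall I, imunit I -> connected (W `&` slice_line I).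

Definition product_domain (W : set A) : Prop :=
  circular_domain W /\
  forall I, imunit I ->
    exists x y : A,
      let L := W `&` slice_line I in
      let U := connected_component L x in
      let V := connected_component L y in
      [/\ L x, L y, U <> V, L = U `|` V & (@alg_conj R K) @` U = V].

(** * Stem functions and slice functions *)

(* the real derivatives below are along the vectors 1 and iota of C *)
Definition holomorphic (V : normedModType R) (D : set C)
    (F : C -> (V * V)%type) : Prop :=
  let e1 : C := (1, 0) in
  let e2 : C := (0, 1) in
  forall z, D z ->
    [/\ derivable F z e1, derivable F z e2,
        {for z, continuous (fun w => 'D_e1 F w)},
        {for z, continuous (fun w => 'D_e2 F w)} &
        'D_e1 F z + (- ('D_e2 F z).2, ('D_e2 F z).1) = 0].

(* an element x + iota y of the tensor product of A with C is the pair (x, y) *)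
Definition stem_mul (F G : C -> (A * A)%type) : C -> (A * A)%type :=
  fun z => ((F z).1 ** (G z).1 - (F z).2 ** (G z).2,
            (F z).1 ** (G z).2 + (F z).2 ** (G z).1).

Definition stem_conj (F : C -> (A * A)%type) : C -> (A * A)%type :=
  fun z => (alg_conj (F z).1, alg_conj (F z).2).

Definition stem_function (D : set C) (F : C -> (A * A)%type) : Prop :=
  [/\ open D, conj_invariant D &
      forall z, D z -> F (planeconj z) = ((F z).1, - (F z).2)].

(* f = I(F) on the circularization of D *)
Definition induces (D : set C) (F : C -> (A * A)%type) (f : A -> A) : Prop :=
  forall z I, D z -> imunit I ->
    f (slice_point z.1 z.2 I) = (F z).1 + I ** (F z).2.

(* the slice function induced by F, and the stem function inducing f;
   functions on subsets are represented by total functions, so these are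
   meaningful only on circularization D and on D respectively *)
Definition slice_of (D : set C) (F : C -> (A * A)%type) : A -> A :=
  xget (fun=> 0) [set f : A -> A | induces D F f].

Definition stem_of (D : set C) (f : A -> A) : C -> (A * A)%type :=
  xget (fun=> 0)
    [set F : C -> (A * A)%type | stem_function D F /\ induces D F f].

Definition slice_mul (W : set A) (f g : A -> A) : A -> A :=
  slice_of (planar W)
    (stem_mul (stem_of (planar W) f) (stem_of (planar W) g)).

Definition slice_conj (W : set A) (f : A -> A) : A -> A :=
  slice_of (planar W) (stem_conj (stem_of (planar W) f)).

Definition slice_regular (W : set A) (f : A -> A) : Prop :=
  exists F : C -> (A * A)%type,
    [/\ stem_function (planar W) F, induces (planar W) F f &
        holomorphic (planar W) F].

(** * Slice-Nash functions *)

Definition toC (z : C) : R[i]%C := Complex z.1 z.2.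

(* P is a polynomial in t whose coefficients are polynomials in z *)
Definition complex_nash (D : set C) (g : C -> C) : Prop :=
  forall z, D z -> exists U : set C,
    [/\ open U, U z, U `<=` D, holomorphic (V := R^o) U g &
        exists2 P : {poly {poly R[i]%C}}, P != 0 &
          forall w, U w -> P.[(toC (g w))%:P].[toC w] = 0].

(* the C_I-linear combination of the family J with coefficients c *)
Definition lincomb (I : A) (J : 'I_(alg_u K).+1 -> A) (c : 'I_(alg_u K).+1 -> C) : A :=
  \sum_k slice_point (c k).1 (c k).2 I ** J k.

(* the splitting base is {J k, I J k}, with J 0 = 1 *)
Definition splitting_base (I : A) (J : 'I_(alg_u K).+1 -> A) : Prop :=
  J ord0 = 1A /\
  forall x : A, exists! c : 'I_(alg_u K).+1 -> C, x = lincomb I J c.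

Definition splitting_coord (I : A) (J : 'I_(alg_u K).+1 -> A) (x : A) :
    'I_(alg_u K).+1 -> C :=
  xget (fun=> 0) [set c : 'I_(alg_u K).+1 -> C | x = lincomb I J c].

Definition stem_nash (D : set C) (F : C -> (A * A)%type) : Prop :=
  exists (I : A) (J : 'I_(alg_u K).+1 -> A),
    [/\ imunit I, splitting_base I J &
        forall k,
          complex_nash D (fun z => ((splitting_coord I J (F z).1 k).1,
                                    (splitting_coord I J (F z).2 k).1)) /\
          complex_nash D (fun z => ((splitting_coord I J (F z).1 k).2,
                                    (splitting_coord I J (F z).2 k).2))].

Definition slice_nash (W : set A) (f : A -> A) : Prop :=
  exists F : C -> (A * A)%type,
    [/\ stem_function (planar W) F, induces (planar W) F f,
        holomorphic (planar W) F & stem_nash (planar W) F].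

(** * Semiregular functions *)

Definition Delta (y x : A) : A := x ** x - x ** alg_tr y + alg_norm y.

Definition discrete_singularities (W W0 : set A) : Prop :=
  [/\ W0 `<=` W,
      exists2 Z, closed Z & W0 = W `&` Z,
      forall y, W0 y -> sphere y `<=` W0 &
      forall y, W0 y -> exists2 U, open U & U `&` W0 = sphere y].

(* the intersection condition makes U a neighbourhood of the point or
   sphere of y that meets no other singularity *)
Definition extends_near (W W0 : set A) (h : A -> A) (y : A) : Prop :=
  exists (U : set A) (g : A -> A),
    [/\ open U, circular U, U `<=` W & U `&` W0 = sphere y] /\
    slice_regular U g /\ (forall x, (U `\` W0) x -> g x = h x).

Definition removable (W W0 : set A) (f : A -> A) (y : A) : Prop :=
  extends_near W W0 f y.

Definition real_pole (W W0 : set A) (f : A -> A) (y : A) : Prop :=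
  ~ removable W W0 f y /\
  exists2 k : nat, (1 <= k)%N &
    extends_near W W0 (fun x => alg_pow (x - y) k ** f x) y.

Definition spherical_pole (W W0 : set A) (f : A -> A) (y : A) : Prop :=
  ~ removable W W0 f y /\
  exists2 k : nat, (1 <= k)%N &
    extends_near W W0 (fun x => alg_pow (Delta y x) k ** f x) y.

(* A function defined off the set [sing]: the values of [fn] on [sing] are
   irrelevant. *)
Record pslice := PSlice { sing : set A; fn : A -> A }.

Definition SEM (W : set A) (f : pslice) : Prop :=
  [/\ discrete_singularities W (sing f),
      slice_regular (W `\` sing f) (fn f),
      forall y, sing f y -> realA y ->
        removable W (sing f) (fn f) y \/ real_pole W (sing f) (fn f) y &
      forall y, sing f y -> ~ realA y ->
        removable W (sing f) (fn f) y \/ spherical_pole W (sing f) (fn f) y].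

Definition SEN (W : set A) (f : pslice) : Prop :=
  SEM W f /\
  exists2 W0, discrete_singularities W W0 & slice_nash (W `\` W0) (fn f).

Definition sem_eq (W : set A) (f g : pslice) : Prop :=
  exists2 W0, discrete_singularities W W0 &
    forall x, (W `\` W0) x -> fn f x = fn g x.

Definition sem_add (f g : pslice) : pslice :=
  PSlice (sing f `|` sing g) (fun x => fn f x + fn g x).

Definition sem_scale (a : R) (f : pslice) : pslice :=
  PSlice (sing f) (fun x => a *: fn f x).

Definition sem_mul (W : set A) (f g : pslice) : pslice :=
  PSlice (sing f `|` sing g)
    (slice_mul (W `\` (sing f `|` sing g)) (fn f) (fn g)).

Definition sem_conj (W : set A) (f : pslice) : pslice :=
  PSlice (sing f) (slice_conj (W `\` sing f) (fn f)).

Definition sem_normal (W : set A) (f : pslice) : pslice :=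
  sem_mul W f (sem_conj W f).

End Slice.

(** * Alternative *-algebras, up to an equivalence *)

Record star_ops (R : realType) := StarOps {
  sa_carrier :> Type;
  sa_eqv : sa_carrier -> sa_carrier -> Prop;
  sa_zero : sa_carrier;
  sa_one : sa_carrier;
  sa_add : sa_carrier -> sa_carrier -> sa_carrier;
  sa_scale : R -> sa_carrier -> sa_carrier;
  sa_mul : sa_carrier -> sa_carrier -> sa_carrier;
  sa_star : sa_carrier -> sa_carrier
}.

Declare Scope star_scope.

Section StarAlgebra.
Variables (R : realType) (X : star_ops R).
Notation "x == y" := (@sa_eqv R X x y) : star_scope.
Notation "0" := (@sa_zero R X) : star_scope.
Notation "1" := (@sa_one R X) : star_scope.
Notation "x + y" := (@sa_add R X x y) : star_scope.
Notation "x * y" := (@sa_mul R X x y) : star_scope.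
Notation "a *: x" := (@sa_scale R X a x) : star_scope.
Notation "x ^*" := (@sa_star R X x) : star_scope.
Local Open Scope star_scope.

(* The quotient of S by sa_eqv is a real, unital, alternative *-algebra. *)
Record alternative_star_algebra (S : X -> Prop) : Prop := {
  eqv_refl : forall x, S x -> x == x;
  eqv_sym : forall x y, S x -> S y -> x == y -> y == x;
  eqv_trans : forall x y z, S x -> S y -> S z -> x == y -> y == z -> x == z;
  zero_in : S 0;
  one_in : S 1;
  add_in : forall x y, S x -> S y -> S (x + y);
  scale_in : forall a x, S x -> S (a *: x);
  mul_in : forall x y, S x -> S y -> S (x * y);
  star_in : forall x, S x -> S x^*;
  add_eqv : forall x x' y y', S x -> S x' -> S y -> S y' ->
    x == x' -> y == y' -> x + y == x' + y';
  scale_eqv : forall a x x', S x -> S x' -> x == x' -> a *: x == a *: x';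
  mul_eqv : forall x x' y y', S x -> S x' -> S y -> S y' ->
    x == x' -> y == y' -> x * y == x' * y';
  star_eqv : forall x x', S x -> S x' -> x == x' -> x^* == x'^*;
  add_assoc : forall x y z, S x -> S y -> S z -> x + (y + z) == (x + y) + z;
  add_comm : forall x y, S x -> S y -> x + y == y + x;
  add_zero : forall x, S x -> 0 + x == x;
  add_opp : forall x, S x -> (-1)%R *: x + x == 0;
  scale_assoc : forall a b x, S x -> a *: (b *: x) == (a * b)%R *: x;
  scale_one : forall x, S x -> 1%R *: x == x;
  scale_addr : forall a x y, S x -> S y -> a *: (x + y) == a *: x + a *: y;
  scale_addl : forall a b x, S x -> (a + b)%R *: x == a *: x + b *: x;
  mul_addl : forall x y z, S x -> S y -> S z -> (x + y) * z == x * z + y * z;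
  mul_addr : forall x y z, S x -> S y -> S z -> x * (y + z) == x * y + x * z;
  mul_scalel : forall a x y, S x -> S y -> (a *: x) * y == a *: (x * y);
  mul_scaler : forall a x y, S x -> S y -> x * (a *: y) == a *: (x * y);
  mul_onel : forall x, S x -> 1 * x == x;
  mul_oner : forall x, S x -> x * 1 == x;
  alternative_left : forall x y, S x -> S y -> (x * x) * y == x * (x * y);
  alternative_right : forall x y, S x -> S y -> (y * x) * x == y * (x * x);
  alternative_flex : forall x y, S x -> S y -> (x * y) * x == x * (y * x);
  star_one : 1^* == 1;
  star_add : forall x y, S x -> S y -> (x + y)^* == x^* + y^*;
  star_scale : forall a x, S x -> (a *: x)^* == a *: x^*;
  star_mul : forall x y, S x -> S y -> (x * y)^* == y^* * x^*;
  star_involutive : forall x, S x -> x^*^* == x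
}.

Record star_subalgebra (S S' : X -> Prop) : Prop := {
  sub_incl : forall x, S' x -> S x;
  sub_eqv : forall x y, S' x -> S y -> x == y -> S' y;
  sub_zero : S' 0;
  sub_one : S' 1;
  sub_add : forall x y, S' x -> S' y -> S' (x + y);
  sub_scale : forall a x, S' x -> S' (a *: x);
  sub_mul : forall x y, S' x -> S' y -> S' (x * y);
  sub_star : forall x, S' x -> S' x^*
}.

Definition associative_algebra (S : X -> Prop) : Prop :=
  forall x y z, S x -> S y -> S z -> (x * y) * z == x * (y * z).

Definition has_inverse (S : X -> Prop) (x : X) : Prop :=
  exists y, [/\ S y, x * y == 1 & y * x == 1].

(* Both usual definitions for alternative algebras: existence of inverses,
   and unique solvability of a x = b and y a = b. *)
Definition division_algebra (S : X -> Prop) : Prop :=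
  ~ (1 == 0) /\
  forall a, S a -> ~ (a == 0) ->
    has_inverse S a /\
    forall b, S b ->
      (exists x, [/\ S x, a * x == b &
         forall x', S x' -> a * x' == b -> x' == x]) /\
      (exists y, [/\ S y, y * a == b &
         forall y', S y' -> y' * a == b -> y' == y]).

End StarAlgebra.

Definition sem_ops (R : realType) (K : algebra_kind) (W : set (alg R K)) :
    star_ops R :=
  {| sa_carrier := pslice R K;
     sa_eqv := sem_eq W;
     sa_zero := PSlice set0 (fun=> 0);
     sa_one := PSlice set0 (fun=> alg_one R K);
     sa_add := @sem_add R K;
     sa_scale := @sem_scale R K;
     sa_mul := sem_mul W;
     sa_star := sem_conj W |}.

(* Main.v *)
(** A slice function is determined by its stem F, with values in the
    complexified algebra, and all operations become pointwise operations of the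
    Cayley-Dickson algebra over C.  A pole at z is removed by a power of
    delta_z(w) = (w - z)(w - z^c), so semiregularity is preserved by sums and
    products, and the algebra laws follow from those of H and O over C.
    For inverses one divides F^c by the complex function N(F).  No complex
    analysis is needed for this: if P(z, g) = 0 near a point, with P = t^j Q and
    q = Q(z, 0) <> 0, then g = 0 or Q(z, g) = 0 at each point, and since q does
    not vanish on a small punctured disc, which is connected, g vanishes
    identically there or satisfies |g| >= c |w - z|^m.  In the second case a
    large power of delta_z kills the singularity of 1/g together with its first
    derivative.  The dichotomy is constant along connected sets; on a symmetric
    slice domain the first case is excluded at a real point, where N(F) is the
    squared norm of F.  On a product domain 1 + iota sgn(beta) J is a zero
    divisor for every J with J^2 = -1. *)
Require Import Defs.
From HB Require Import structures.
From mathcomp Require Import all_boot all_order all_algebra.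
From mathcomp Require Import complex polyXY ring lra.
From mathcomp Require Import all_classical all_reals all_analysis.
Set Implicit Arguments.
Unset Strict Implicit.
Unset Printing Implicit Defensive.
Import Order.TTheory GRing.Theory Num.Theory.
Import numFieldNormedType.Exports.
Local Open Scope classical_set_scope.
Local Open Scope ring_scope.

(** * Complex derivatives in the real plane *)

(** Stems are studied through germs at punctured points [z^']: values on singular sets then carry no
    information, and a union of two singular sets becomes an intersection of two filter conditions.
    The stem is kept in coordinates over [R[i]]; [coordwise] lifts to vectors any property of scalar
    germs, and if that property is stable under constants, sums and products so is its lift.
    Holomorphic and Nash germs thus share their closure lemmas. Over C the norm form is isotropic,
    which is where zero divisors come from; on the real axis a stem is real valued and the form is a
    sum of squares, hence anisotropic. The delicate point is that a multiple of the reciprocal of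
    the norm must be C^1 across a zero. The lower bound makes a power of [delta z] over the norm
    continuous and zero at z; a second copy of that power supplies a differentiable factor vanishing
    at z, and such a product has derivative 0 there. Hence the exponent is doubled. As a polynomial
    in w, [delta z] has real coefficients and vanishes on the whole pair z, z^c, so multiplying by
    its powers preserves stems and treats real and spherical poles alike. *)

Section ComplexCalculus.
Variable R : realType.
Notation C := (R[i]%C).
Notation plane := (plane R).
Implicit Types (z w : plane) (f g : plane -> C).

Definition dir_re : plane := (1, 0).
Definition dir_im : plane := (0, 1).

(* the four real partial derivatives, tied together by the Cauchy-Riemann equations *)
Definition has_cderiv z g (p : C) : Prop :=
  [/\ is_derive z dir_re (fun w => complex.Re (g w) : R^o) (complex.Re p),
      is_derive z dir_re (fun w => complex.Im (g w) : R^o) (complex.Im p),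
      is_derive z dir_im (fun w => complex.Re (g w) : R^o) (- complex.Im p) &
      is_derive z dir_im (fun w => complex.Im (g w) : R^o) (complex.Re p)].

(** Continuity is tested on the two real parts, so only the topology of R enters. *)
Definition ccont z g : Prop :=
  (fun w => complex.Re (g w) : R^o) @ z --> (complex.Re (g z) : R^o) /\
  (fun w => complex.Im (g w) : R^o) @ z --> (complex.Im (g z) : R^o).

Lemma cReM (x y : C) : complex.Re (x * y) =
  complex.Re x * complex.Re y - complex.Im x * complex.Im y.
Proof. by case: x; case: y. Qed.
Lemma cImM (x y : C) : complex.Im (x * y) =
  complex.Re x * complex.Im y + complex.Im x * complex.Re y.
Proof. by case: x; case: y. Qed.
Lemma cReD (x y : C) : complex.Re (x + y) = complex.Re x + complex.Re y.
Proof. by case: x; case: y. Qed.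
Lemma cImD (x y : C) : complex.Im (x + y) = complex.Im x + complex.Im y.
Proof. by case: x; case: y. Qed.

Lemma ccontC z c : ccont z (fun=> c).
Proof. by split; apply: cvg_cst. Qed.

Lemma ccont_toC z : ccont z (@toC R).
Proof. by split; [apply: cvg_fst|apply: cvg_snd]. Qed.

Lemma ccontD z f g : ccont z f -> ccont z g -> ccont z (fun w => f w + g w).
Proof.
move=> [f1 f2] [g1 g2]; split.
- under eq_fun do rewrite cReD.
  by rewrite cReD; apply: cvgD.
- under eq_fun do rewrite cImD.
  by rewrite cImD; apply: cvgD.
Qed.

Lemma ccontM z f g : ccont z f -> ccont z g -> ccont z (fun w => f w * g w).
Proof.
move=> [f1 f2] [g1 g2]; split.
- under eq_fun do rewrite cReM.
  by rewrite cReM; apply: cvgB; apply: cvgM.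
- under eq_fun do rewrite cImM.
  by rewrite cImM; apply: cvgD; apply: cvgM.
Qed.

Lemma has_cderivC z c : has_cderiv z (fun=> c) 0.
Proof. by rewrite /has_cderiv /= oppr0; split; apply: is_derive_cst. Qed.

Lemma has_cderivD z f g (p q : C) : has_cderiv z f p -> has_cderiv z g q ->
  has_cderiv z (fun w => f w + g w) (p + q).
Proof.
move=> [f1 f2 f3 f4] [g1 g2 g3 g4]; rewrite /has_cderiv !cReD !cImD opprD.
have -> : (fun w => complex.Re (f w + g w) : R^o) =
  (fun w => complex.Re (f w) : R^o) + (fun w => complex.Re (g w) : R^o).
  by apply/funext => w; rewrite cReD.
have -> : (fun w => complex.Im (f w + g w) : R^o) =
  (fun w => complex.Im (f w) : R^o) + (fun w => complex.Im (g w) : R^o).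
  by apply/funext => w; rewrite cImD.
by split; apply: is_deriveD.
Qed.

Lemma has_cderivM z f g (p q : C) : has_cderiv z f p -> has_cderiv z g q ->
  has_cderiv z (fun w => f w * g w) (p * g z + f z * q).
Proof.
move=> [f1 f2 f3 f4] [g1 g2 g3 g4]; rewrite /has_cderiv !cReD !cImD !cReM !cImM.
have -> : (fun w => complex.Re (f w * g w) : R^o) =
  (fun w => complex.Re (f w) : R^o) * (fun w => complex.Re (g w) : R^o) -
  (fun w => complex.Im (f w) : R^o) * (fun w => complex.Im (g w) : R^o).
  by apply/funext => w; rewrite cReM.
have -> : (fun w => complex.Im (f w * g w) : R^o) =
  (fun w => complex.Re (f w) : R^o) * (fun w => complex.Im (g w) : R^o) +
  (fun w => complex.Im (f w) : R^o) * (fun w => complex.Re (g w) : R^o).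
  by apply/funext => w; rewrite cImM.
split.
- apply: is_derive_eq (is_deriveB (is_deriveM f1 g1) (is_deriveM f2 g2)) _.
  by rewrite /GRing.scale/=; ring.
- apply: is_derive_eq (is_deriveD (is_deriveM f1 g2) (is_deriveM f2 g1)) _.
  by rewrite /GRing.scale/=; ring.
- apply: is_derive_eq (is_deriveB (is_deriveM f3 g3) (is_deriveM f4 g4)) _.
  by rewrite /GRing.scale/=; ring.
- apply: is_derive_eq (is_deriveD (is_deriveM f3 g4) (is_deriveM f4 g3)) _.
  by rewrite /GRing.scale/=; ring.
Qed.

Lemma is_derive_cvg (V W : normedModType R) (f : V -> W) (x v : V) (l : W) :
  h^-1 *: (f (h *: v + x) - f x) @[h --> 0^'] --> l -> is_derive x v f l.
Proof.
by move=> fl; apply: DeriveDef; [apply/cvg_ex; exists l|apply: cvg_lim].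
Qed.

Lemma is_derive_linear (V W : normedModType R) (f : V -> W) (x v : V) :
  linear f -> is_derive x v f (f v).
Proof.
move=> fl; apply: is_derive_cvg.
apply: (@cvg_trans _ ((fun=> f v) @ 0^')); last exact: cvg_cst.
apply: near_eq_cvg; near=> h.
have h0 : h != 0 by near: h; exact: nbhs_dnbhs_neq.
by rewrite fl addrK scalerA mulVf ?scale1r.
Unshelve. all: by end_near. Qed.

Lemma has_cderiv_toC z : has_cderiv z (@toC R) 1.
Proof.
rewrite /has_cderiv /=; split.
- exact: (@is_derive_linear _ _ (fun w : plane => w.1 : R^o) z dir_re).
- exact: (@is_derive_linear _ _ (fun w : plane => w.2 : R^o) z dir_re).
- rewrite oppr0.
  exact: (@is_derive_linear _ _ (fun w : plane => w.1 : R^o) z dir_im).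
- exact: (@is_derive_linear _ _ (fun w : plane => w.2 : R^o) z dir_im).
Qed.

Lemma ccont_near z f g : (\forall w \near z, f w = g w) ->
  ccont z f -> ccont z g.
Proof.
move=> fg [f1 f2]; have fgz := nbhs_singleton fg; split; rewrite -fgz.
- by apply: cvg_trans f1; apply: near_eq_cvg; apply: filterS fg => w ->.
- by apply: cvg_trans f2; apply: near_eq_cvg; apply: filterS fg => w ->.
Qed.

Lemma has_cderiv_near z f g (p : C) : (\forall w \near z, f w = g w) ->
  has_cderiv z f p -> has_cderiv z g p.
Proof.
by move=> fg [f1 f2 f3 f4]; split; [move: f1|move: f2|move: f3|move: f4];
  apply: near_eq_is_derive; apply: filterS fg => w ->.
Qed.

(** The squared modulus as an element of R: it is multiplicative and polynomial in the coordinates,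
    so all estimates below are made with it. *)
Definition nsq (x : C) : R := complex.Re x ^+ 2 + complex.Im x ^+ 2.

Lemma nsq_eq0 x : (nsq x == 0) = (x == 0).
Proof.
by case: x => a b; rewrite eq_complex /nsq /= paddr_eq0 ?sqr_ge0 // !sqrf_eq0.
Qed.

Lemma cReV (x : C) : complex.Re x^-1 = complex.Re x * (nsq x)^-1.
Proof. by case: x. Qed.
Lemma cImV (x : C) : complex.Im x^-1 = - complex.Im x * (nsq x)^-1.
Proof. by case: x => a b; rewrite mulNr. Qed.

Lemma cvg_nsq z f : ccont z f ->
  (fun w => nsq (f w) : R^o) @ z --> (nsq (f z) : R^o).
Proof.
by move=> [f1 f2]; rewrite /nsq; under eq_fun do rewrite !expr2;
  rewrite !expr2; apply: cvgD; apply: cvgM.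
Qed.

Lemma ccontV z f : f z != 0 -> ccont z f -> ccont z (fun w => (f w)^-1).
Proof.
move=> fz0 fc; have := cvg_nsq fc; have [f1 f2] := fc => f3.
split.
- under eq_fun do rewrite cReV.
  by rewrite cReV; apply: cvgM => //; apply: cvgV => //; rewrite nsq_eq0.
- under eq_fun do rewrite cImV.
  rewrite cImV; apply: cvgM; last by apply: cvgV => //; rewrite nsq_eq0.
  exact: cvgN.
Qed.

Lemma ccont_neq0 z f : f z != 0 -> ccont z f -> \forall w \near z, f w != 0.
Proof.
move=> fz0 /cvg_nsq fc.
have : nsq (f z) != 0 by rewrite nsq_eq0.
move=> /(cvgr_neq0 _ fc); apply: filterS => w.
by rewrite nsq_eq0.
Qed.

(** The reciprocal is the conjugate divided by [nsq]; the real product and quotient rules, applied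
    in both directions, then give the four partial derivatives. *)
Lemma has_cderivV z f (p : C) : f z != 0 -> has_cderiv z f p ->
  has_cderiv z (fun w => (f w)^-1) (- p * (f z)^-1 * (f z)^-1).
Proof.
move=> fz0 [f1 f2 f3 f4].
have n0 : nsq (f z) != 0 by rewrite nsq_eq0.
rewrite /has_cderiv.
have E : (fun w => nsq (f w) : R^o) =
  (fun w => complex.Re (f w) : R^o) * (fun w => complex.Re (f w) : R^o) +
  (fun w => complex.Im (f w) : R^o) * (fun w => complex.Im (f w) : R^o).
  by apply/funext => w; rewrite /nsq !expr2.
have dn (v : plane) a b :
    is_derive z v (fun w => complex.Re (f w) : R^o) a ->
    is_derive z v (fun w => complex.Im (f w) : R^o) b ->
    is_derive z v (fun w => (nsq (f w))^-1 : R^o)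
      (- (nsq (f z)) ^- 2 * ((complex.Re (f z) * a + complex.Im (f z) * b) *+ 2)).
  move=> fa fb.
  have fn : is_derive z v (fun w => nsq (f w) : R^o)
      ((complex.Re (f z) * a + complex.Im (f z) * b) *+ 2).
    rewrite E; apply: is_derive_eq
      (is_deriveD (is_deriveM fa fa) (is_deriveM fb fb)) _.
    by rewrite /GRing.scale/= mulr2n addrACA.
  apply: DeriveDef; first by apply: derivableV => //; apply: ex_derive.
  by rewrite deriveV // derive_val.
have -> : (fun w => complex.Re (f w)^-1 : R^o) =
  (fun w => complex.Re (f w) : R^o) * (fun w => (nsq (f w))^-1 : R^o).
  by apply/funext => w; rewrite cReV.
have -> : (fun w => complex.Im (f w)^-1 : R^o) =
  - (fun w => complex.Im (f w) : R^o) * (fun w => (nsq (f w))^-1 : R^o).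
  by apply/funext => w; rewrite cImV.
have d1 := dn _ _ _ f1 f2; have d2 := dn _ _ _ f3 f4.
have ReN (x : C) : complex.Re (- x) = - complex.Re x by case: x.
have ImN (x : C) : complex.Im (- x) = - complex.Im x by case: x.
split.
- apply: is_derive_eq (is_deriveM f1 d1) _.
  rewrite /GRing.scale/= !(cReM,cImM,ReN,ImN,cReV,cImV).
  by move: n0; rewrite /nsq; case: (f z) => a b /= n0; field.
- apply: is_derive_eq (is_deriveM (is_deriveN f2) d1) _.
  rewrite /GRing.scale/= fctE !(cReM,cImM,ReN,ImN,cReV,cImV).
  by move: n0; rewrite /nsq; case: (f z) => a b /= n0; field.
- apply: is_derive_eq (is_deriveM f3 d2) _.
  rewrite /GRing.scale/= !(cReM,cImM,ReN,ImN,cReV,cImV).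
  by move: n0; rewrite /nsq; case: (f z) => a b /= n0; field.
- apply: is_derive_eq (is_deriveM (is_deriveN f4) d2) _.
  rewrite /GRing.scale/= fctE !(cReM,cImM,ReN,ImN,cReV,cImV).
  by move: n0; rewrite /nsq; case: (f z) => a b /= n0; field.
Qed.

End ComplexCalculus.

(** * Holomorphic germs *)

Section Germs.
Variable R : realType.
Notation C := (R[i]%C).
Notation plane := (plane R).
Implicit Types (z w : plane) (f g : plane -> C).

Lemma plane_nearW z (P : plane -> Prop) : (forall w, P w) -> \forall w \near z, P w.
Proof. by move=> H; apply: (@nearW _ (nbhs z)). Qed.

(** The hypothesis is put on the interval symmetric about x, which covers both relative positions of
    x and y. *)
Lemma mvt_le (f df : R -> R) (M x y : R) :
  (forall t, `|t - x| <= `|y - x| -> is_derive t 1 f (df t) /\ `|df t| <= M) ->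
  `|f y - f x| <= M * `|y - x|.
Proof.
have main (a b : R) : a <= b ->
    (forall t, a <= t <= b -> is_derive t 1 f (df t) /\ `|df t| <= M) ->
    `|f b - f a| <= M * `|b - a|.
  move=> ab H.
  have H1 t : t \in `]a, b[%R -> is_derive t 1 f (df t).
    by rewrite in_itv /= => /andP[h1 h2]; apply: (H _ _).1; rewrite !ltW.
  have H2 : {within `[a, b], continuous f}.
    apply: derivable_within_continuous => t; rewrite in_itv /= => abt.
    by have [[]] := H _ abt.
  have [c cab ->] := MVT_segment ab H1 H2.
  rewrite normrM; apply: ler_wpM2r => //.
  by apply: (H _ _).2; move: cab; rewrite in_itv.
move=> H; case: (leP x y) => xy.
- apply: main => // t /andP[xt ty]; apply: H.
  by rewrite !ger0_norm ?subr_ge0 // ?lerD2r.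
- rewrite distrC [`|y - x|]distrC; apply: main; first exact: ltW.
  move=> t /andP[xt ty]; apply: H.
  by rewrite [`|t - _|]distrC [`|y - _|]distrC !ger0_norm ?subr_ge0 ?lerD2l ?lerN2 // ltW.
Qed.

Lemma is_derive_slice1 (u : plane -> R^o) (t s l : R) :
  is_derive ((t, s) : plane) (dir_re R) u l ->
  is_derive t 1 (fun t => u (t, s) : R) l.
Proof.
move=> [d <-]; apply: is_derive_cvg.
suff -> : (fun h : R => h^-1 *: (u (h *: (1 : R) + t, s) - u (t, s))) =
  (fun h : R => h^-1 *: ((u \o shift ((t, s) : plane)) (h *: dir_re R) - u (t, s))) by exact: d.
apply/funext => h /=; congr (_ *: (u _ - _)).
by apply/pair_equal_spec; split=> //=; rewrite scaler0 add0r.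
Qed.

Lemma is_derive_slice2 (u : plane -> R^o) (t s l : R) :
  is_derive ((t, s) : plane) (dir_im R) u l ->
  is_derive s 1 (fun s => u (t, s) : R) l.
Proof.
move=> [d <-]; apply: is_derive_cvg.
suff -> : (fun h : R => h^-1 *: (u (t, h *: (1 : R) + s) - u (t, s))) =
  (fun h : R => h^-1 *: ((u \o shift ((t, s) : plane)) (h *: dir_im R) - u (t, s))) by exact: d.
apply/funext => h /=; congr (_ *: (u _ - _)).
by apply/pair_equal_spec; split=> //=; rewrite scaler0 add0r.
Qed.

(* mean value theorem along a horizontal and a vertical segment *)
Lemma partial_continuous z (u a b : plane -> R^o) :
  (\forall w \near z, is_derive w (dir_re R) u (a w) /\
                      is_derive w (dir_im R) u (b w)) ->
  a @ z --> a z -> b @ z --> b z -> u @ z --> u z.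
Proof.
move=> du ca cb.
(* One bound for both partial derivatives near z; the summand 1 absorbs their oscillation. *)
pose M : R := 1 + `|a z| + `|b z|.
have Ma : \forall w \near z, `|a w| <= M.
  have : \forall w \near z, `|a z - a w| < 1.
    by move/cvgrPdist_lt: ca; apply.
  apply: filterS => w h; rewrite /M.
  have := ler_normB (a z) (a z - a w); rewrite opprB addrC subrK.
  by move=> /le_trans; apply; move: (normr_ge0 (b z)); lra.
have Mb : \forall w \near z, `|b w| <= M.
  have : \forall w \near z, `|b z - b w| < 1.
    by move/cvgrPdist_lt: cb; apply.
  apply: filterS => w h; rewrite /M.
  have := ler_normB (b z) (b z - b w); rewrite opprB addrC subrK.
  by move=> /le_trans; apply; move: (normr_ge0 (a z)); lra.
have : \forall w \near z, [/\ is_derive w (dir_re R) u (a w),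
   is_derive w (dir_im R) u (b w), `|a w| <= M & `|b w| <= M].
  by apply: filterS3 du Ma Mb => w [].
move=> /nbhs_ballP[e /= e0 H].
have key w : ball z e w ->
    `|u w - u z| <= M * `|w.1 - z.1| + M * `|w.2 - z.2|.
  clearbody M; case: z H {ca cb du Ma Mb} => z1 z2 H; case: w => w1 w2 [/= b1 b2].
  rewrite -(subrKA (u (z1, w2))); apply: le_trans (ler_normD _ _) _.
  apply: lerD.
  - apply: (@mvt_le (fun t => u (t, w2)) (fun t => a (t, w2))) => t ht.
    have [|d _ m _] := H (t, w2).
      split=> //=; rewrite /ball /= distrC; apply: le_lt_trans ht _.
      by rewrite distrC.
    by split=> //; apply: is_derive_slice1.
  - apply: (@mvt_le (fun t => u (z1, t)) (fun t => b (z1, t))) => t ht.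
    have [|_ d _ m] := H (z1, t).
      split=> //=; first exact: ballxx.
      rewrite /ball /= distrC; apply: le_lt_trans ht _.
      by rewrite distrC.
    by split=> //; apply: is_derive_slice2.
have M0 : 0 < M by rewrite /M; move: (normr_ge0 (b z)) (normr_ge0 (a z)); lra.
apply/cvgrPdist_lt => eps eps0; have c0 : 0 < eps / M / 2 by rewrite !divr_gt0.
near=> w.
rewrite distrC; apply: le_lt_trans (key w _) _.
  by near: w; apply: (nbhsx_ballx z e e0).
have h1 : `|w.1 - z.1| < eps / M / 2.
  rewrite distrC; near: w; move/cvgrPdist_lt: (ccont_toC z).1 => /(_ _ c0).
  by apply: filterS.
have h2 : `|w.2 - z.2| < eps / M / 2.
  rewrite distrC; near: w; move/cvgrPdist_lt: (ccont_toC z).2 => /(_ _ c0).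
  by apply: filterS.
rewrite -mulrDr -ltr_pdivlMl // mulrC; lra.
Unshelve. all: by end_near. Qed.

(** The derivative is a witness continuous on a whole neighbourhood, as in the C^1 condition on
    stems. This makes the property open ([holg_join]), and continuity of g follows from it
    ([holg_ccont]). *)
Definition holg z g : Prop := exists p : plane -> C,
  \forall w \near z, has_cderiv w g (p w) /\ ccont w p.

Lemma holg_ccont z g : holg z g -> ccont z g.
Proof.
move=> [p H]; have [_ [c1 c2]] := nbhs_singleton H; split.
- apply: (partial_continuous (a := fun w => complex.Re (p w))
    (b := fun w => - complex.Im (p w))) => //; last exact: cvgN.
  by apply: filterS H => w [[]].
- apply: (partial_continuous (a := fun w => complex.Im (p w))
    (b := fun w => complex.Re (p w))) => //.
  by apply: filterS H => w [[]].
Qed.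

Lemma holg_join z g : holg z g -> \forall w \near z, holg w g.
Proof.
by move=> [p /near_join H]; apply: filterS H => w H; exists p.
Qed.

Lemma holg_near z f g : (\forall w \near z, f w = g w) -> holg z f -> holg z g.
Proof.
move=> /near_join fg [p H]; exists p; apply: filterS2 fg H => w fg [H1 H2].
by split=> //; apply: has_cderiv_near H1.
Qed.

Lemma holgC z c : holg z (fun=> c).
Proof.
exists (fun=> 0); near=> w.
split; [exact: has_cderivC|exact: ccontC].
Unshelve. all: by end_near. Qed.

Lemma holg_toC z : holg z (@toC R).
Proof.
exists (fun=> 1); near=> w.
split; [exact: has_cderiv_toC|exact: ccontC].
Unshelve. all: by end_near. Qed.

Lemma holgD z f g : holg z f -> holg z g -> holg z (fun w => f w + g w).
Proof.
move=> [p P] [q Q]; exists (fun w => p w + q w).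
by apply: filterS2 P Q => w [? ?] [? ?]; split; [apply: has_cderivD|apply: ccontD].
Qed.

Lemma holgM z f g : holg z f -> holg z g -> holg z (fun w => f w * g w).
Proof.
move=> hf hg; have := holg_join hf; have := holg_join hg => hg' hf'.
case: hf hg => p P [q Q].
exists (fun w => p w * g w + f w * q w).
near=> w; have [p1 p2] : has_cderiv w f (p w) /\ ccont w p by near: w.
have [q1 q2] : has_cderiv w g (q w) /\ ccont w q by near: w.
have cf : ccont w f by apply: holg_ccont; near: w.
have cg : ccont w g by apply: holg_ccont; near: w.
by split; [apply: has_cderivM|apply: ccontD; apply: ccontM].
Unshelve. all: by end_near. Qed.

Lemma holgN z f : holg z f -> holg z (fun w => - f w).
Proof.
move=> hf; apply: holg_near (holgM (holgC z (-1)) hf).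
by apply: plane_nearW => w; rewrite mulN1r.
Qed.

Lemma ccontN z f : ccont z f -> ccont z (fun w => - f w).
Proof.
move=> hf; apply: ccont_near (ccontM (ccontC z (-1)) hf).
by apply: plane_nearW => w; rewrite mulN1r.
Qed.

Lemma holgV z f : f z != 0 -> holg z f -> holg z (fun w => (f w)^-1).
Proof.
move=> fz0 hf; have := ccont_neq0 fz0 (holg_ccont hf).
have := holg_join hf; case: hf => p P.
exists (fun w => - p w * (f w)^-1 * (f w)^-1).
near=> w; have [p1 p2] : has_cderiv w f (p w) /\ ccont w p by near: w.
have fw0 : f w != 0 by near: w.
have cf : ccont w f by apply: holg_ccont; near: w.
split; first exact: has_cderivV.
by apply: ccontM; [apply: ccontM; first exact: ccontN|]; apply: ccontV.
Unshelve. all: by end_near. Qed.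

Lemma holgX z f n : holg z f -> holg z (fun w => f w ^+ n).
Proof.
move=> hf; elim: n => [|n IH].
  by apply: holg_near (holgC z 1); apply: plane_nearW => w; rewrite expr0.
by apply: holg_near (holgM hf IH); apply: plane_nearW => w; rewrite exprS.
Qed.

Definition eval2 (P : {poly {poly C}}) (x y : C) : C := P.[y%:P].[x].

(** Induction through both polynomial layers. It is applied to continuity and to the Nash
    property. *)
Lemma eval2_closed (Phi : (plane -> C) -> Prop) (g : plane -> C)
    (P : {poly {poly C}}) :
  (forall c, Phi (fun=> c)) ->
  (forall u v, Phi u -> Phi v -> Phi (fun w => u w + v w)) ->
  (forall u v, Phi u -> Phi v -> Phi (fun w => u w * v w)) ->
  Phi (@toC R) -> Phi g -> Phi (fun w => eval2 P (toC w) (g w)).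
Proof.
move=> PC PD PM Pz Pg; rewrite /eval2.
have Pp (p : {poly C}) : Phi (fun w => p.[toC w]).
  elim/poly_ind: p => [|p c IH].
    by under eq_fun do rewrite horner0; exact: PC.
  by under eq_fun do rewrite hornerMXaddC; apply: PD => //; apply: PM.
elim/poly_ind: P => [|P p IH].
  by under eq_fun do rewrite horner0 horner0; exact: PC.
under eq_fun do rewrite hornerMXaddC hornerD hornerM hornerC.
by apply: PD => //; apply: PM.
Qed.

Lemma eval2_ccont z g P : ccont z g -> ccont z (fun w => eval2 P (toC w) (g w)).
Proof.
move=> cg; apply: (eval2_closed (Phi := ccont z)) => //.
- exact: ccontC.
- by move=> u v; apply: ccontD.
- by move=> u v; apply: ccontM.
- exact: ccont_toC.
Qed.

Lemma nsqM (x y : C) : nsq (x * y) = nsq x * nsq y.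
Proof. by case: x => a b; case: y => c d; rewrite /nsq /=; ring. Qed.

Lemma nsqX (x : C) n : nsq (x ^+ n) = nsq x ^+ n.
Proof.
elim: n => [|n IH]; first by rewrite !expr0 /nsq /= expr0n /= addr0 expr1n.
by rewrite !exprS nsqM IH.
Qed.

Lemma nsqV (x : C) : nsq x^-1 = (nsq x)^-1.
Proof.
have [->|x0] := eqVneq x 0.
  by rewrite invr0 /nsq /= expr0n /= addr0 invr0.
have n0 : nsq x != 0 by rewrite nsq_eq0.
apply: (mulfI n0); rewrite -nsqM divff // mulfV //.
by rewrite /nsq /= expr0n /= addr0 expr1n.
Qed.

Lemma nsq_ge0 (x : C) : 0 <= nsq x.
Proof. by rewrite addr_ge0 // sqr_ge0. Qed.

(** Parallelogram law: the two sides differ by [nsq (x - y)]. *)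
Lemma nsqD (x y : C) : nsq (x + y) <= (nsq x + nsq y) *+ 2.
Proof.
case: x => a b; case: y => c d; rewrite /nsq /=.
rewrite -subr_ge0; have -> : (a ^+ 2 + b ^+ 2 + (c ^+ 2 + d ^+ 2)) *+ 2 -
  ((a + c) ^+ 2 + (b + d) ^+ 2) = (a - c) ^+ 2 + (b - d) ^+ 2 by ring.
by rewrite addr_ge0 // sqr_ge0.
Qed.

Lemma eval2_bound (P : {poly {poly C}}) (r s : R) : exists2 M : R, 0 < M &
  forall x y, nsq x <= r -> nsq y <= s -> nsq (eval2 P x y) <= M.
Proof.
have Pp (p : {poly C}) : exists2 M : R, 0 < M &
    forall x, nsq x <= r -> nsq p.[x] <= M.
  elim/poly_ind: p => [|p c [M M0 IH]].
    exists 1 => // x _; rewrite horner0 /nsq /= expr0n /=; lra.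
  exists ((M * `|r| + nsq c) *+ 2 + 1).
    have := nsq_ge0 c; have : 0 <= M * `|r| by rewrite mulr_ge0 // ltW.
    by rewrite mulr2n; lra.
  move=> x xr; rewrite hornerMXaddC; apply: le_trans (nsqD _ _) _.
  rewrite nsqM ler_wpDr // lerMn2r /= lerD2r.
  by apply: ler_pM => //; [exact: nsq_ge0|exact: nsq_ge0|exact: IH|
    exact: le_trans (ler_norm _)].
elim/poly_ind: P => [|P p [M M0 IH]].
  exists 1 => // x y _ _; rewrite /eval2 horner0 horner0 /nsq /= expr0n /=; lra.
have [N N0 HN] := Pp p.
exists ((M * `|s| + N) *+ 2 + 1).
  have : 0 <= M * `|s| by rewrite mulr_ge0 // ltW.
  by rewrite mulr2n; lra.
move=> x y xr ys; rewrite /eval2 hornerMXaddC hornerD hornerM hornerC.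
apply: le_trans (nsqD _ _) _.
rewrite nsqM ler_wpDr // lerMn2r /=; apply: lerD; last exact: HN.
by apply: ler_pM => //; [exact: nsq_ge0|exact: nsq_ge0|exact: IH|
    exact: le_trans (ler_norm _)].
Qed.

End Germs.

(** * Complex Nash germs *)

Section Nash.
Variable R : realType.
Notation C := (R[i]%C).
Notation plane := (plane R).
Implicit Types (z w : plane) (f g : plane -> C).

Section AlgebraicClosure.
Variable F : fieldType.
Implicit Types (P Q S : {poly {poly F}}) (x u v : F).

(** The annihilator is a resultant. Multiplication by ['X] makes both polynomials non-constant in t,
    as [sub_annihilant_in_ideal] demands, and keeps the roots u and v. *)
Lemma algebraic_sub P Q : P != 0 -> Q != 0 -> exists2 S, S != 0 &
  forall x u v, P.[u%:P].[x] = 0 -> Q.[v%:P].[x] = 0 -> S.[(u - v)%:P].[x] = 0.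
Proof.
move=> P0 Q0; pose p := P * 'X; pose q := Q * 'X.
have X0 : 'X != 0 :> {poly {poly F}} by rewrite polyX_eq0.
have p0 : p != 0 by rewrite mulf_neq0.
have q0 : q != 0 by rewrite mulf_neq0.
have p1 : (1 < size p)%N by rewrite size_mulX // ltnS lt0n size_poly_eq0.
have q1 : (1 < size q)%N by rewrite size_mulX // ltnS lt0n size_poly_eq0.
exists (sub_annihilant p q); first exact: sub_annihilant_neq0.
move=> x u v Pu Qv.
have [uv _ /(_ v%:P (u - v)%:P) ->] := sub_annihilant_in_ideal p1 q1.
rewrite -polyCD (addrC v) subrK hornerD !hornerM ?hornerX ?hornerM.
by rewrite Pu Qv !(mul0r, mulr0) addr0.
Qed.

(** The reciprocal polynomial t^n P(1/t), with n the degree of P. *)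
Definition poly_rev P := \poly_(i < size P) P`_((size P).-1 - i).

Lemma poly_rev_coef0 P : (poly_rev P).[0] = lead_coef P.
Proof.
rewrite horner_coef0 coef_poly; case: posnP => [/eqP|_]; last by rewrite subn0.
by rewrite size_poly_eq0 => /eqP ->; rewrite lead_coef0.
Qed.

Lemma poly_rev_horner P x v : v != 0 -> P.[v%:P].[x] = 0 ->
  (poly_rev P).[(v^-1)%:P].[x] = 0.
Proof.
move=> v0 Pv; set n := (size P).-1.
have vn0 : v ^+ n != 0 by rewrite expf_neq0.
apply: (mulfI vn0); rewrite mulr0 -[RHS]Pv.
rewrite -[v ^+ n in LHS](hornerC (v ^+ n) x) -hornerM; congr (_.[x]).
rewrite polyC_exp /poly_rev horner_poly horner_coef mulr_sumr.
rewrite (reindex_inj rev_ord_inj) /=; apply: eq_bigr => i _.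
have vP0 : v%:P != 0 :> {poly F} by rewrite polyC_eq0.
have lin : (i <= n)%N by rewrite /n -ltnS (ltn_predK (ltn_ord i)).
have -> : (size P - i.+1)%N = (n - i)%N by rewrite subnS /n -!subn1 subnAC.
rewrite subKn // mulrCA; congr (_ * _).
rewrite -{1}(subnKC lin) exprD -mulrA -exprMn -polyCM.
by rewrite mulfV // expr1n mulr1.
Qed.

(* [u * v = u / v^-1], and the reversed polynomial annihilates [v^-1];
   the factor ['X] takes care of [v = 0] *)
Lemma algebraic_mul P Q : P != 0 -> Q != 0 -> exists2 S, S != 0 &
  forall x u v, P.[u%:P].[x] = 0 -> Q.[v%:P].[x] = 0 -> S.[(u * v)%:P].[x] = 0.
Proof.
(* Both factors are there to make the polynomials non-constant. For q the factor must not vanish at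
   0, because [div_annihilant_neq0] asks for [q.[0] != 0]; hence ['X - 1] instead of ['X]. *)
move=> P0 Q0; pose p := P * 'X; pose q := poly_rev Q * ('X - 1%:P).
have X0 : 'X != 0 :> {poly {poly F}} by rewrite polyX_eq0.
have p0 : p != 0 by rewrite mulf_neq0.
have q00 : q.[0] != 0.
  rewrite hornerM poly_rev_coef0 hornerXsubC sub0r mulrN1 oppr_eq0.
  by rewrite lead_coef_eq0.
have r0 : poly_rev Q != 0.
  by apply: contraNneq q00 => r0; rewrite /q r0 mul0r horner0.
have p1 : (1 < size p)%N by rewrite size_mulX // ltnS lt0n size_poly_eq0.
have q1 : (1 < size q)%N.
  by rewrite size_Mmonic ?monicXsubC // size_XsubC addn2 /= ltnS lt0n size_poly_eq0.
exists (div_annihilant p q * 'X).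
  by rewrite mulf_neq0 // div_annihilant_neq0.
move=> x u v Pu Qv; rewrite hornerMX hornerM hornerC.
have [->|v0] := eqVneq v 0; first by rewrite !mulr0.
have [uv _ /(_ (v^-1)%:P (u * v)%:P) ->] := div_annihilant_in_ideal p1 q1.
rewrite -polyCM (mulrC v^-1) mulfK // hornerD !hornerM ?hornerX ?hornerM.
by rewrite Pu poly_rev_horner // !(mul0r, mulr0) addr0 mul0r.
Qed.

End AlgebraicClosure.

Definition nashg z g : Prop := holg z g /\
  exists2 P : {poly {poly C}}, P != 0 &
    \forall w \near z, eval2 P (toC w) (g w) = 0.

Lemma nashg_near z f g : (\forall w \near z, f w = g w) -> nashg z f -> nashg z g.
Proof.
move=> fg [hf [P P0 HP]]; split; first exact: holg_near hf.
by exists P => //; apply: filterS2 fg HP => w ->.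
Qed.

Lemma nashgC z c : nashg z (fun=> c).
Proof.
split; first exact: holgC.
exists ('X - (c%:P)%:P); first by rewrite polyXsubC_eq0.
by apply: plane_nearW => w; rewrite /eval2 hornerXsubC subrr horner0.
Qed.

Lemma nashg_toC z : nashg z (@toC R).
Proof.
split; first exact: holg_toC.
exists ('X - 'X%:P); first by rewrite polyXsubC_eq0.
by apply: plane_nearW => w; rewrite /eval2 !hornerXsubC hornerD hornerN hornerC hornerX subrr.
Qed.

Lemma nashgM z f g : nashg z f -> nashg z g -> nashg z (fun w => f w * g w).
Proof.
move=> [hf [P P0 HP]] [hg [Q Q0 HQ]]; split; first exact: holgM.
have [S S0 HS] := algebraic_mul P0 Q0; exists S => //.
by apply: filterS2 HP HQ => w; exact: HS.
Qed.

Lemma nashgB z f g : nashg z f -> nashg z g -> nashg z (fun w => f w - g w).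
Proof.
move=> [hf [P P0 HP]] [hg [Q Q0 HQ]]; split.
  by apply: holgD => //; exact: holgN.
have [S S0 HS] := algebraic_sub P0 Q0; exists S => //.
by apply: filterS2 HP HQ => w; exact: HS.
Qed.

Lemma nashgN z f : nashg z f -> nashg z (fun w => - f w).
Proof.
move=> hf; apply: nashg_near (nashgM (nashgC z (-1)) hf).
by apply: plane_nearW => w; rewrite mulN1r.
Qed.

Lemma nashgD z f g : nashg z f -> nashg z g -> nashg z (fun w => f w + g w).
Proof.
move=> hf hg; apply: nashg_near (nashgB hf (nashgN hg)).
by apply: plane_nearW => w; rewrite opprK.
Qed.

Lemma nashgV z f : f z != 0 -> nashg z f -> nashg z (fun w => (f w)^-1).
Proof.
move=> fz0 [hf [P P0 HP]]; split; first exact: holgV.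
exists (poly_rev P).
  apply: contra_neq P0 => r0; apply/eqP.
  by rewrite -lead_coef_eq0 -poly_rev_coef0 r0 horner0.
apply: filterS2 HP (ccont_neq0 fz0 (holg_ccont hf)) => w.
by move=> ? ?; exact: poly_rev_horner.
Qed.

End Nash.

(** * Zeros of Nash functions *)

Section Dichotomy.
Variable R : realType.
Notation C := (R[i]%C).
Notation plane := (plane R).
Implicit Types (z w : plane) (f g : plane -> C).

(** The part of E in S is relatively clopen: it is cut out of E by the interior of the set where E
    implies S, and also by the complement of the interior of the set where E excludes S. *)
Lemma connected_locally_constant (T : topologicalType) (E S : set T) :
  connected E ->
  (forall a, E a -> \forall u \near a, E u -> (S u <-> S a)) ->
  forall x y, E x -> E y -> S x -> S y.
Proof.
move=> cE lc x y Ex Ey Sx.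
suff EB : E `&` S = E by move: Ey; rewrite -EB => -[].
apply: cE; first by exists x.
- exists [set u | \forall v \near u, E v -> S v].
    by rewrite openE => u /= /near_join; apply: filterS.
  apply/seteqP; split=> u [Eu /=].
    by move=> Su; split=> //; apply: filterS (lc u Eu) => v h /h /iffRL; exact.
  by move=> /nbhs_singleton Su; split=> //; exact: Su.
- exists (~` [set u | \forall v \near u, E v -> ~ S v]).
    by apply: open_closedC; rewrite openE => u /= /near_join; apply: filterS.
  apply/seteqP; split=> u [Eu /=].
    by move=> Su; split=> // /nbhs_singleton; exact.
  move=> nSu; split=> //; apply: contrapT => Su; apply: nSu.
  by apply: filterS (lc u Eu) => v h /h /iffLR Sv /Sv.
Qed.

(** Pulled back to the unit interval along the segment from x to y. *)
Lemma convex_locally_constant (V : normedModType R) (E S : set V) :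
  (forall x y (t : R), 0 <= t <= 1 -> E x -> E y -> E (x + t *: (y - x))) ->
  (forall a, E a -> \forall u \near a, E u -> (S u <-> S a)) ->
  forall x y, E x -> E y -> S x <-> S y.
Proof.
move=> cE lc.
suff H x y : E x -> E y -> S x -> S y by move=> x y Ex Ey; split; apply: H.
move=> Ex Ey Sx.
pose phi (t : R) := x + t *: (y - x).
have cphi : continuous phi.
  by move=> t; apply: cvgD; [exact: cvg_cst|apply: cvgZr_tmp; exact: cvg_id].
have c01 : connected [set t : R | 0 <= t <= 1].
  apply/connected_intervalP => a b /= /andP[a0 a1] /andP[b0 b1] c /andP[ac cb].
  by rewrite (le_trans a0) // (le_trans cb).
have := @connected_locally_constant _ _ (S \o phi) c01 _ 0 1.
rewrite /= /phi scale0r addr0 scale1r [x + (y - x)]addrC subrK !lexx ler01 /=.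
apply=> // t ht; have Et : E (phi t) by exact: cE.
have H : \forall u \near t, E (phi u) -> (S (phi u) <-> S (phi t)).
  exact: cphi t _ (lc _ Et).
by apply: filterS H => u h hu; apply: h; exact: cE.
Qed.

Lemma dnbhs_ballP z (P : plane -> Prop) :
  (\forall w \near z^', P w) <->
  exists2 e : R, 0 < e & forall w, ball z e w -> w != z -> P w.
Proof.
rewrite /dnbhs /within /=; split.
  by move=> /nbhs_ballP[e /= e0 H]; exists e => // w /H.
by move=> [e e0 H]; apply/nbhs_ballP; exists e.
Qed.

Lemma ball_planeE z (e : R) w :
  ball z e w <-> `|z.1 - w.1| < e /\ `|z.2 - w.2| < e.
Proof. by split. Qed.

Lemma dnbhs_neq0 z (P : plane -> Prop) : (\forall w \near z^', P w) ->
  exists2 w, w != z & P w.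
Proof.
move=> /dnbhs_ballP[e e0 H]; exists (z.1 + e / 2, z.2); last apply: H.
- by apply/eqP => /(congr1 fst) /=; lra.
- apply/ball_planeE => /=; rewrite subrr normr0 e0; split=> //.
  rewrite opprD addrA subrr sub0r normrN gtr0_norm; lra.
- by apply/eqP => /(congr1 fst) /=; lra.
Qed.

(* a punctured square is the union of four convex half squares *)
Lemma punctured_locally_constant z (e : R) (S : set plane) : 0 < e ->
  (forall w, ball z e w -> w != z ->
     \forall u \near w, ball z e u -> u != z -> (S u <-> S w)) ->
  forall x y, ball z e x -> x != z -> ball z e y -> y != z -> S x -> S y.
Proof.
move=> e0 lc.
(* Open half lines are convex; [cv] and [cv'] serve both for the half planes and for the two sides
   of the square. *)
have cv (a b c t : R) : 0 <= t <= 1 -> a < b -> a < c -> a < b + t * (c - b).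
  move=> /andP[t0 t1] ab ac; have [bc|bc] := leP b c.
    have : 0 <= t * (c - b) by rewrite mulr_ge0 ?subr_ge0.
    have : 0 <= (1 - t) * (c - b) by rewrite mulr_ge0 ?subr_ge0.
    lra.
  have : 0 <= t * (b - c) by rewrite mulr_ge0 ?subr_ge0 // ltW.
  have : 0 <= (1 - t) * (b - c) by rewrite mulr_ge0 ?subr_ge0 // ltW.
  lra.
have cv' (a b c t : R) : 0 <= t <= 1 -> b < a -> c < a -> b + t * (c - b) < a.
  move=> /andP[t0 t1] ab ac; have [bc|bc] := leP b c.
    have : 0 <= t * (c - b) by rewrite mulr_ge0 ?subr_ge0.
    have : 0 <= (1 - t) * (c - b) by rewrite mulr_ge0 ?subr_ge0.
    lra.
  have : 0 <= t * (b - c) by rewrite mulr_ge0 ?subr_ge0 // ltW.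
  have : 0 <= (1 - t) * (b - c) by rewrite mulr_ge0 ?subr_ge0 // ltW.
  lra.
have half (H : plane -> Prop) : (forall w, H w -> w != z) ->
    (forall x y (t : R), 0 <= t <= 1 -> H x -> H y -> H (x + t *: (y - x))) ->
    forall x y, ball z e x -> H x -> ball z e y -> H y -> S x <-> S y.
  move=> Hz Hc x y bx hx by' hy.
  apply: (@convex_locally_constant _ [set w | ball z e w /\ H w]) => //=.
  - move=> {bx hx by' hy}x {}y t t01 [/ball_planeE[x1 x2] hx] [/ball_planeE[y1 y2] hy].
    split; last exact: Hc.
    move: t01 x1 x2 y1 y2 => /andP[t0 t1].
    have conv (a b c : R) : `|a - b| < e -> `|a - c| < e ->
       `|a - (b + t * (c - b))| < e.
      rewrite !ltr_norml => /andP[h1 h2] /andP[h3 h4].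
      have t01 : 0 <= t <= 1 by rewrite t0 t1.
      have i1 : b < a + e by lra.
      have i2 : c < a + e by lra.
      have i3 : a - e < b by lra.
      have i4 : a - e < c by lra.
      have := cv' _ _ _ _ t01 i1 i2; have := cv _ _ _ _ t01 i3 i4.
      by move=> *; apply/andP; split; lra.
    by move=> x1 x2 y1 y2; apply/ball_planeE; split; apply: conv.
  - move=> w [bw hw]; apply: filterS (lc w bw (Hz w hw)) => u h [bu hu].
    by apply: h => //; exact: Hz.
pose r1 := (fun w : plane => z.1 < w.1); pose l1 := (fun w : plane => w.1 < z.1).
pose r2 := (fun w : plane => z.2 < w.2); pose l2 := (fun w : plane => w.2 < z.2).
have hr1 := half r1 _ (fun x y t h1 h2 h3 => cv _ _ _ t h1 h2 h3).
have hr2 := half r2 _ (fun x y t h1 h2 h3 => cv _ _ _ t h1 h2 h3).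
have hl1 := half l1 _ (fun x y t h1 h2 h3 => cv' _ _ _ t h1 h2 h3).
have hl2 := half l2 _ (fun x y t h1 h2 h3 => cv' _ _ _ t h1 h2 h3).
have nr1 w : r1 w -> w != z by apply: contraTneq => ->; rewrite /r1 ltxx.
have nr2 w : r2 w -> w != z by apply: contraTneq => ->; rewrite /r2 ltxx.
have nl1 w : l1 w -> w != z by apply: contraTneq => ->; rewrite /l1 ltxx.
have nl2 w : l2 w -> w != z by apply: contraTneq => ->; rewrite /l2 ltxx.
have {}hr1 := hr1 nr1.
have {}hr2 := hr2 nr2.
have {}hl1 := hl1 nl1.
have {}hl2 := hl2 nl2.
(* Three corners link the half squares: p and r lie on the right, r and q lie below, p also lies
   above and q also lies on the left. *)
pose p : plane := (z.1 + e / 2, z.2 + e / 2).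
pose q : plane := (z.1 - e / 2, z.2 - e / 2).
pose r : plane := (z.1 + e / 2, z.2 - e / 2).
have small : e / 2 < e by lra.
have pos : 0 < e / 2 by lra.
have d1 (a : R) : `|a - (a + e / 2)| < e.
  by rewrite opprD addrA subrr sub0r normrN gtr0_norm.
have d2 (a : R) : `|a - (a - e / 2)| < e.
  by rewrite opprB addrCA subrr addr0 gtr0_norm.
have bp : ball z e p by apply/ball_planeE.
have bq : ball z e q by apply/ball_planeE.
have br : ball z e r by apply/ball_planeE.
have g1 (a : R) : a < a + e / 2 by lra.
have g2 (a : R) : a - e / 2 < a by lra.
have pr : S p <-> S r by apply: hr1 => //; rewrite /r1 /=.
have rq : S r <-> S q by apply: hl2 => //; rewrite /l2 /=.
have all w : ball z e w -> w != z -> S w <-> S p.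
  move=> bw wz.
  have [c|c|c1] := ltgtP z.1 w.1.
  - by apply: hr1 => //; rewrite /r1 /=.
  - by rewrite pr rq; apply: hl1 => //; rewrite /l1 /=.
  - have [c|c|c2] := ltgtP z.2 w.2.
    + by apply: hr2 => //; rewrite /r2 /=.
    + by rewrite pr rq; apply: hl2 => //; rewrite /l2 /=.
    + by case/eqP: wz; case: (w) (z) c1 c2 => ? ? [? ?] /= -> ->.
by move=> x y bx xz by' yz; rewrite (all x) // (all y).
Qed.

Lemma nsq0 : nsq (0 : C) = 0.
Proof. by apply/eqP; rewrite nsq_eq0. Qed.

Lemma toC_inj : injective (@toC R).
Proof. by move=> [a b] [c d] [-> ->]. Qed.

Lemma near_dnbhs z (P : plane -> Prop) :
  (\forall w \near z, P w) -> \forall w \near z^', P w.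
Proof. by move=> /nbhs_ballP[e e0 H]; apply/dnbhs_ballP; exists e => // w /H. Qed.

(** Write q = (X - z)^m r with r(z) non-zero. By continuity [nsq] of r stays above half its value at
    z, and this half is the constant c. *)
Lemma poly_lower_bound z (q : {poly C}) : q != 0 ->
  exists2 c : R, 0 < c & exists m : nat, \forall w \near z,
    c * nsq (toC w - toC z) ^+ m <= nsq q.[toC w].
Proof.
move=> q0; have [m [r rz qE]] := multiplicity_XsubC q (toC z).
move: rz; rewrite q0 /= => rz.
have c0 : 0 < nsq r.[toC z].
  by rewrite lt_def nsq_ge0 nsq_eq0 andbT.
exists (nsq r.[toC z] / 2); first by rewrite divr_gt0.
exists m.
have cr : ccont z (fun w => r.[toC w]).
  have := eval2_ccont (r%:P) (ccontC z 0).
  by under eq_fun do rewrite /eval2 hornerC.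
have lt2 : nsq r.[toC z] / 2 < nsq r.[toC z] by lra.
have H : \forall w \near z, nsq r.[toC z] / 2 < nsq r.[toC w].
  exact: cvgr_gt _ (cvg_nsq cr) _ lt2.
apply: filterS H => w h; rewrite qE hornerM horner_exp hornerXsubC nsqM nsqX.
by rewrite ler_wpM2r ?exprn_ge0 ?nsq_ge0 // ltW.
Qed.

(** This and [lower_bounded] concern punctured neighbourhoods, since z may be a singularity at which
    the value of g means nothing. *)
Definition germ0 z g := \forall w \near z^', g w = 0.
Definition lower_bounded z g := exists2 c : R, 0 < c & exists m : nat,
  \forall w \near z^', c * nsq (toC w - toC z) ^+ m <= nsq (g w).

(** The exponent j is the multiplicity of the root t = 0; after dividing it out the constant term
    [q0] in t survives. *)
Lemma eval2_split (P : {poly {poly C}}) : P != 0 -> exists j q0 q1,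
  q0 != 0 /\ forall x y, eval2 P x y = (q0.[x] + y * eval2 q1 x y) * y ^+ j.
Proof.
move=> P0; have [j [q + PE]] := multiplicity_XsubC P 0; rewrite P0 /= => rq.
have : root (q - (q.[0])%:P) 0 by rewrite /root hornerD hornerN hornerC subrr.
move/factor_theorem => [q1 qE].
exists j, q.[0], q1; split=> // x y.
rewrite /eval2 PE hornerM horner_exp hornerXsubC subr0 hornerM horner_exp hornerC.
congr (_ * _); rewrite -[q](subrK (q.[0])%:P) qE subr0.
rewrite !(hornerD, hornerM, hornerC, hornerX).
by rewrite mulr0 add0r addrC mulrC.
Qed.

Lemma algebraic_dichotomy z g (P : {poly {poly C}}) : P != 0 ->
  (\forall w \near z^', ccont w g) ->
  (\forall w \near z^', eval2 P (toC w) (g w) = 0) ->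
  germ0 z g \/ lower_bounded z g.
Proof.
move=> P0 cg Pg; have [j [q0 [q1 [q00 PE]]]] := eval2_split P0.
have [c c0 [m lq]] := poly_lower_bound z q00.
have [M M0 HM] := eval2_bound q1 (nsq (toC z) + 1) 1.
have bz : \forall w \near z, nsq (toC w) <= nsq (toC z) + 1.
  have lt1 : nsq (toC z) < nsq (toC z) + 1 by lra.
  have H : \forall w \near z, nsq (toC w) < nsq (toC z) + 1.
    exact: cvgr_lt _ (cvg_nsq (ccont_toC z)) _ lt1.
  by apply: filterS H => w; apply: ltW.
have b1 : \forall w \near z, nsq (toC w - toC z) <= 1.
  have cd := ccontD (ccont_toC z) (ccontC z (- toC z)).
  have lt1 : nsq (toC z - toC z) < 1.
    by rewrite subrr nsq0.
  have H : \forall w \near z, nsq (toC w - toC z) < 1.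
    exact: cvgr_lt _ (cvg_nsq cd) _ lt1.
  by apply: filterS H => w; apply: ltW.
have : \forall w \near z^', [/\ ccont w g, eval2 P (toC w) (g w) = 0,
    nsq (toC w) <= nsq (toC z) + 1, nsq (toC w - toC z) <= 1 &
    c * nsq (toC w - toC z) ^+ m <= nsq q0.[toC w]].
  move: bz b1 lq => /near_dnbhs bz /near_dnbhs b1 /near_dnbhs lq.
  by apply: filterS3 cg Pg (filterI bz (filterI b1 lq)) => w ? ? [? [? ?]]; split.
move=> /dnbhs_ballP[e e0 H].
have q0n0 w : ball z e w -> w != z -> q0.[toC w] != 0.
  move=> bw wz; have [_ _ _ _ h] := H w bw wz.
  rewrite -nsq_eq0 gt_eqF //; apply: lt_le_trans h.
  rewrite mulr_gt0 // exprn_gt0 // lt_def nsq_ge0 nsq_eq0 andbT subr_eq0.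
  by apply: contra wz => /eqP/toC_inj ->.
have ev0 w : ball z e w -> w != z -> g w = 0 \/ q0.[toC w] + g w * eval2 q1 (toC w) (g w) = 0.
  move=> bw wz; have [_ + _ _ _] := H w bw wz; rewrite PE => /eqP.
  by rewrite mulf_eq0 => /orP[/eqP|]; [right|rewrite expf_eq0 => /andP[_ /eqP]; left].
(* Near a zero of g the other factor is close to [q0], hence non-zero, and so g has to vanish; near
   a non-zero value continuity suffices. *)
have lc : forall w, ball z e w -> w != z ->
     \forall u \near w, ball z e u -> u != z -> (g u = 0 <-> g w = 0).
  move=> w bw wz; have [cw _ _ _ _] := H w bw wz.
  have [gw|gw] := eqVneq (g w) 0; last first.
    apply: filterS (ccont_neq0 gw cw) => u /eqP gu _ _.
    by split=> // /eqP; rewrite (negbTE gw).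
  have cev : ccont w (fun u => q0.[toC u] + g u * eval2 q1 (toC u) (g u)).
    apply: ccontD; last by apply: ccontM => //; exact: eval2_ccont.
    have := eval2_ccont (q0%:P) (ccontC w 0).
    by under eq_fun do rewrite /eval2 hornerC.
  have n0 : q0.[toC w] + g w * eval2 q1 (toC w) (g w) != 0.
    by rewrite gw mul0r addr0; exact: q0n0.
  apply: filterS (ccont_neq0 n0 cev) => u un0 bu uz.
  by split=> // _; case: (ev0 u bu uz) => // /eqP; rewrite (negbTE un0).
have [[u [bu uz gu]]|no] :=
    pselect (exists u, [/\ ball z e u, u != z & g u = 0]).
  left; apply/dnbhs_ballP; exists e => // w bw wz.
  exact: (punctured_locally_constant (S := [set w | g w = 0]) e0 lc bu uz bw wz).
(* Here |q0| = |g| |q1|. If |g| <= 1, then |q1|^2 <= M and the lower bound for [q0] passes to g with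
   constant c / M. If |g| > 1, the claim holds because |w - z| <= 1. The denominator M + c covers
   both cases. *)
right; exists (c / (M + c)); first by rewrite divr_gt0 // addr_gt0.
exists m; apply/dnbhs_ballP; exists e => // w bw wz.
have [_ _ h1 h2 h3] := H w bw wz.
have gw : g w <> 0 by move=> gw; apply: no; exists w.
case: (ev0 w bw wz) => // /eqP; rewrite addrC addr_eq0 => /eqP ev.
have := congr1 (@nsq R) ev; rewrite nsqM => nev.
have nN (x : C) : nsq (- x) = nsq x by case: x => a b; rewrite /nsq /= !sqrrN.
rewrite nN in nev.
have Mc : 0 < M + c by rewrite addr_gt0.
rewrite mulrAC ler_pdivrMr //.
have [le1|gt1] := leP (nsq (g w)) 1.
  have Mw := HM _ _ h1 le1; rewrite -nev in h3.
  apply: le_trans h3 _; apply: ler_wpM2l; first exact: nsq_ge0.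
  by apply: le_trans Mw _; rewrite lerDl ltW.
apply: (@le_trans _ _ c).
  by rewrite ger_pMr // exprn_ile1 // nsq_ge0.
by apply: (@le_trans _ _ (M + c)); [rewrite lerDr ltW|rewrite ler_peMl // ltW].
Qed.

Lemma germ0_lower_bounded z g : germ0 z g -> lower_bounded z g -> False.
Proof.
move=> g0 [c c0 [m lb]].
have [w wz [gw]] := dnbhs_neq0 (filterI g0 lb).
rewrite gw nsq0; apply/negP; rewrite -ltNge.
rewrite mulr_gt0 // exprn_gt0 // lt_def nsq_ge0 nsq_eq0 andbT subr_eq0.
by apply: contra wz => /eqP/toC_inj ->.
Qed.

Lemma lower_bounded_neq0 z g : lower_bounded z g -> \forall w \near z^', g w != 0.
Proof.
move=> [c c0 [m /dnbhs_ballP[e e0 H]]].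
apply/dnbhs_ballP; exists e => // w bw wz.
rewrite -nsq_eq0 gt_eqF //; apply: lt_le_trans (H w bw wz).
rewrite mulr_gt0 // exprn_gt0 // lt_def nsq_ge0 nsq_eq0 andbT subr_eq0.
by apply: contra wz => /eqP/toC_inj ->.
Qed.

(** Openness of the punctured square: it turns a condition valid throughout the square into one
    valid on a neighbourhood of each of its points. *)
Lemma near_punctured z u (e : R) : ball z e u -> u != z ->
  \forall v \near u, v != z /\ ball z e v.
Proof.
move=> bu uz; apply: filterI; last exact: (open_nbhs_nbhs (conj (ball_open z e) bu)).
have := @ccont_neq0 _ u (fun w => toC w - toC z).
rewrite subr_eq0 (inj_eq toC_inj) => /(_ uz) H.
have : \forall v \near u, toC v - toC z != 0.
  by apply: H; apply: ccontD; [exact: ccont_toC|exact: ccontC].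
by apply: filterS => v; rewrite subr_eq0 (inj_eq toC_inj).
Qed.

Lemma ccont_germ0 z g : ccont z g -> germ0 z g -> g z = 0.
Proof.
move=> cg g0; apply/eqP; apply: contrapT => /negP gz.
have /near_dnbhs h := ccont_neq0 gz cg.
by have [w _ [/eqP]] := dnbhs_neq0 (filterI h g0).
Qed.

Lemma nashg_dichotomy z g : nashg z g ->
  (\forall w \near z, g w = 0) \/ \forall w \near z^', g w != 0.
Proof.
move=> [hg [P P0 Pg]].
have cg : \forall w \near z, ccont w g.
  by apply: filterS (holg_join hg) => w; exact: holg_ccont.
have [g0|lb] :=
  algebraic_dichotomy P0 (near_dnbhs cg) (near_dnbhs Pg).
  left; have gz := ccont_germ0 (nbhs_singleton cg) g0.
  move/dnbhs_ballP: g0 => [e e0 H]; apply/nbhs_ballP; exists e => // w bw.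
  by have [->|/H] := eqVneq w z; last exact.
by right; exact: lower_bounded_neq0.
Qed.

Lemma eval2_nashg z g P : nashg z g -> nashg z (fun w => eval2 P (toC w) (g w)).
Proof.
move=> ng; apply: (eval2_closed (Phi := nashg z)) => //.
- exact: nashgC.
- by move=> u v; apply: nashgD.
- by move=> u v; apply: nashgM.
- exact: nashg_toC.
Qed.

(* a polynomial annihilating [g] near one point of the punctured square
   annihilates it on the whole of it, by [nashg_dichotomy] for [P(w, g w)] *)
Lemma nash_punctured_dichotomy z g : (\forall w \near z^', nashg w g) ->
  germ0 z g \/ lower_bounded z g.
Proof.
move=> ng; have /dnbhs_ballP[e e0 H] := ng.
have [p pz bp] : exists2 p, p != z & ball z e p.
  by apply: dnbhs_neq0; apply/dnbhs_ballP; exists e.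
have [_ [P P0 Pp]] := H p bp pz.
apply: (algebraic_dichotomy P0).
  by apply: filterS ng => w [/holg_ccont].
apply/dnbhs_ballP; exists e => // w bw wz.
pose h u := eval2 P (toC u) (g u).
suff : \forall v \near w, h v = 0 by move=> /nbhs_singleton.
apply: (punctured_locally_constant (S := [set u | \forall v \near u, h v = 0])
  e0 _ bp pz bw wz) => // {w bw wz} w bw wz.
(* Either h vanishes on a neighbourhood of w, and then near every close point, or it is non-zero on
   a punctured neighbourhood, and then no close point has a vanishing germ. *)
have [h0|hn0] := nashg_dichotomy (eval2_nashg P (H w bw wz)).
  apply: filterS (near_join h0) => u hu _ _.
  by split.
move/dnbhs_ballP: hn0 => [d d0 Hd]; apply/nbhs_ballP; exists d => // u bu _ _.
have [->//|uw] := eqVneq u w; split=> /= h0.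
  by case/eqP: (Hd u bu uw); exact: (nbhs_singleton h0).
have [v vw [+ /eqP]] := dnbhs_neq0 (filterI (near_dnbhs h0)
   (proj2 (dnbhs_ballP w (fun u => h u != 0)) (ex_intro2 _ _ d d0 Hd))).
by [].
Qed.

(** [germ0] is locally constant on E: where g vanishes on a punctured square it does so around each
    of its points, and where the lower bound holds g is non-zero nearby, which excludes vanishing
    germs. *)
Lemma nash_global_dichotomy (E : set plane) g : connected E ->
  (forall z, E z -> \forall w \near z^', nashg w g) ->
  (forall z, E z -> germ0 z g) \/ (forall z, E z -> lower_bounded z g).
Proof.
move=> cE H.
have [[z Ez g0]|no] := pselect (exists2 z, E z & germ0 z g); last first.
  right=> z Ez; case: (nash_punctured_dichotomy (H z Ez)) => // g0.
  by case: no; exists z.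
left=> x Ex.
apply: (connected_locally_constant (S := [set z | germ0 z g]) cE _ Ez Ex g0).
move=> w Ew; case: (nash_punctured_dichotomy (H w Ew)) => [w0|wlb].
  have /dnbhs_ballP[e e0 h] := w0.
  apply/nbhs_ballP; exists e => // u bu Eu; split=> // _ /=.
  have [->//|uw] := eqVneq u w.
  have := near_punctured bu uw.
  by move=> /near_dnbhs H1; apply: filterS H1 => v [vw bv]; exact: h.
have /dnbhs_ballP[d d0 Hd] := lower_bounded_neq0 wlb.
apply/nbhs_ballP; exists d => // u bu Eu.
have [->//|uw] := eqVneq u w; split=> /= h0; last first.
  by case: (germ0_lower_bounded h0 wlb).
have /near_dnbhs hu := near_punctured bu uw. have [v _ [[vw bv] gv]] := dnbhs_neq0 (filterI hu h0).
by have := Hd v bv vw; rewrite gv eqxx.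
Qed.

End Dichotomy.

(** * Reciprocals near a zero *)

Section PoleExtension.
Variable R : realType.
Notation C := (R[i]%C).
Notation plane := (plane R).
Implicit Types (z w : plane) (f g : plane -> C).

(** As v vanishes at z, the difference quotient of the product is u at the shifted point times the
    difference quotient of v. Continuity of u, with limit 0, is all that it takes from u. *)
Lemma is_derive_mul0 z (dir : plane) (u v : plane -> R^o) (l : R) :
  u @ z --> (0 : R^o) -> v z = 0 -> is_derive z dir v l ->
  is_derive z dir (fun w => u w * v w : R^o) (0 : R^o).
Proof.
move=> cu vz [/cvg_ex[/= l' hl] _].
apply: is_derive_cvg.
have cz : h *: dir + z @[h --> (0:R)^'] --> z.
  apply: cvg_within_filter.
  have : h *: dir + z @[h --> (0:R)] --> 0 *: dir + z.
    by apply: cvgD; [apply: cvgZr_tmp; exact: cvg_id|exact: cvg_cst].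
  by rewrite scale0r add0r.
have : u (h *: dir + z) * (h^-1 *: (v (h *: dir + z) - v z)) @[h --> (0:R)^'] --> (0 : R^o) * l'.
  by apply: cvgM => //; apply: cvg_comp cz cu.
rewrite mul0r; apply: cvg_trans; apply: near_eq_cvg; apply: nearW => h.
by rewrite vz mulr0 !subr0 /GRing.scale /=; ring.
Qed.

Lemma has_cderiv_mul0 z f g (q : C) : ccont z f -> f z = 0 -> g z = 0 ->
  has_cderiv z g q -> has_cderiv z (fun w => f w * g w) 0.
Proof.
move=> [f1 f2] fz gz [g1 g2 g3 g4]; rewrite fz in f1 f2.
have gr : complex.Re (g z) = 0 by rewrite gz.
have gi : complex.Im (g z) = 0 by rewrite gz.
rewrite /has_cderiv /= oppr0.
have -> : (fun w => complex.Re (f w * g w) : R^o) =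
  (fun w => complex.Re (f w) * complex.Re (g w) : R^o) -
  (fun w => complex.Im (f w) * complex.Im (g w) : R^o).
  by apply/funext => w; rewrite cReM.
have -> : (fun w => complex.Im (f w * g w) : R^o) =
  (fun w => complex.Re (f w) * complex.Im (g w) : R^o) +
  (fun w => complex.Im (f w) * complex.Re (g w) : R^o).
  by apply/funext => w; rewrite cImM.
split.
- apply: is_derive_eq (is_deriveB (is_derive_mul0 f1 gr g1) (is_derive_mul0 f2 gi g2)) _.
  by rewrite subr0.
- apply: is_derive_eq (is_deriveD (is_derive_mul0 f1 gi g2) (is_derive_mul0 f2 gr g1)) _.
  by rewrite addr0.
- apply: is_derive_eq (is_deriveB (is_derive_mul0 f1 gr g3) (is_derive_mul0 f2 gi g4)) _.
  by rewrite subr0.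
- apply: is_derive_eq (is_deriveD (is_derive_mul0 f1 gi g4) (is_derive_mul0 f2 gr g3)) _.
  by rewrite addr0.
Qed.

(** The bound taken at w = z forces f z = 0; nearby it squeezes both real parts to 0. *)
Lemma nsq_ccont0 z f (B : R) :
  (\forall w \near z, nsq (f w) <= B * nsq (toC w - toC z)) -> ccont z f.
Proof.
move=> fB.
have fz : f z = 0.
  apply/eqP; rewrite -nsq_eq0 eq_le nsq_ge0 andbT.
  by have := nbhs_singleton fB; rewrite subrr nsq0 mulr0.
have cB : (fun w => B * nsq (toC w - toC z) : R^o) @ z --> (0 : R^o).
  rewrite -[X in _ --> X](mulr0 B) -(nsq0 R) -(subrr (toC z)).
  apply: cvgM; first exact: cvg_cst.
  by apply: (cvg_nsq (ccontD (ccont_toC z) (ccontC z (- toC z)))).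
suff main (h : C -> R) : (forall x, h x ^+ 2 <= nsq x) -> h 0 = 0 ->
    (fun w => h (f w) : R^o) @ z --> (h (f z) : R^o).
  split; [apply: (main (@complex.Re R))|apply: (main (@complex.Im R))] => //.
  - by case=> a b; rewrite /nsq /= lerDl sqr_ge0.
  - by case=> a b; rewrite /nsq /= lerDr sqr_ge0.
move=> hx h0; rewrite fz h0; apply/cvgrPdist_lt => e e0.
have /cvgrPdist_lt /(_ _ (exprn_gt0 2 e0)) H := cB.
apply: filterS2 fB H => w h1 h2; rewrite sub0r normrN.
rewrite -(ltr_pXn2r (ltn0Sn 1)) ?nnegrE ?normr_ge0 ?(ltW e0) //.
rewrite real_normK ?num_real //; apply: le_lt_trans (hx _) _.
apply: le_lt_trans h1 _; apply: le_lt_trans h2.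
by rewrite sub0r normrN ler_norm.
Qed.

(** This plays the part of a removable singularity theorem for d^m / n. It will be used with d =
    [delta z] and n the norm of a stem cleared of its pole. *)
Lemma holg_pole_extension z d n (B : R) :
  holg z d -> holg z n -> lower_bounded z n -> d z = 0 ->
  (\forall w \near z^', d w != 0) ->
  (\forall w \near z, nsq (d w) <= B * nsq (toC w - toC z)) ->
  exists m, holg z (fun w => if d w == 0 then 0 else d w ^+ m / n w).
Proof.
move=> hd hn lb dz dn0 dB; have nn0 := lower_bounded_neq0 lb.
case: lb => c c0 [m lb]; exists (m.+1 + m.+1)%N.
(* [d^(2m+2) / n = r * t] with [r = d^(m+1) / n] continuous and zero at [z];
   its derivative is [2 r t' - r^2 n'], again continuous and zero at [z] *)
pose t w := d w ^+ m.+1; have ht : holg z t by exact: holgX.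
pose r w := if d w == 0 then 0 else t w / n w.
have rz : r z = 0 by rewrite /r dz eqxx.
have tz : t z = 0 by rewrite /t dz expr0n.
have cr : ccont z r.
  (* With e = |w - z|^2 one has |d|^2 <= |B| e and c e^m <= |n|^2. Hence |d^(m+1) / n|^2 is at most
     |B|^(m+1) e^(m+1) / |n|^2, and so at most (|B|^(m+1) / c) e. *)
  apply: (@nsq_ccont0 _ _ (`|B| ^+ m.+1 / c)).
  move: dn0 nn0 lb => /dnbhs_ballP[e1 e10 H1] /dnbhs_ballP[e2 e20 H2] /dnbhs_ballP[e3 e30 H3].
  near=> w; have [->|wz] := eqVneq w z; first by rewrite rz subrr !nsq0 mulr0.
  have dw := H1 w; have nw := H2 w; have lw := H3 w.
  have {}dw : d w != 0 by apply: dw => //; near: w; exact: (near_ball z e1 e10).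
  have {}nw : n w != 0 by apply: nw => //; near: w; exact: (near_ball z e2 e20).
  have {lw} : c * nsq (toC w - toC z) ^+ m <= nsq (n w).
    by apply: lw => //; near: w; exact: (near_ball z e3 e30).
  have : nsq (d w) <= B * nsq (toC w - toC z) by near: w.
  rewrite /r (negbTE dw) nsqM nsqV nsqX.
  have dw0 : 0 < nsq (d w) by rewrite lt_def nsq_ge0 nsq_eq0 dw.
  have nw0 : 0 < nsq (n w) by rewrite lt_def nsq_ge0 nsq_eq0 nw.
  have := nsq_ge0 (toC w - toC z).
  move: (nsq (d w)) (nsq (n w)) (nsq (toC w - toC z)) dw0 nw0 => D N e D0 N0 e0 h1 h2.
  rewrite ler_pdivrMr //.
  have h3 : D <= `|B| * e by apply: le_trans h1 _; rewrite ler_wpM2r // ler_norm.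
  have h4 : D ^+ m.+1 <= (`|B| * e) ^+ m.+1.
    by rewrite lerXn2r // nnegrE ?mulr_ge0 // ltW.
  apply: le_trans h4 _; rewrite exprMn [e ^+ m.+1]exprSr.
  have -> : `|B| ^+ m.+1 / c * e * N = `|B| ^+ m.+1 * (N / c * e) by ring.
  apply: ler_wpM2l; first by rewrite exprn_ge0.
  by apply: ler_wpM2r => //; rewrite ler_pdivlMr // mulrC.
pose H w := r w * t w.
have : holg z H.
  case: ht => t' Ht; case: hn => n' Hn.
  have ht' := holg_join (ex_intro _ t' Ht : holg z t).
  have hn' := holg_join (ex_intro _ n' Hn : holg z n).
  exists (fun w => (t' w + t' w) * r w - r w * r w * n' w).
  move: dn0 nn0 => /dnbhs_ballP[e1 e10 H1] /dnbhs_ballP[e2 e20 H2].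
  near=> w.
  have [Ht1 Ht2] : has_cderiv w t (t' w) /\ ccont w t' by near: w.
  have [Hn1 Hn2] : has_cderiv w n (n' w) /\ ccont w n' by near: w.
  have ct : ccont w t by apply: holg_ccont; near: w.
  have cn : ccont w n by apply: holg_ccont; near: w.
  have cd : ccont w d by apply: holg_ccont; near: w; exact: holg_join.
  have loc : w != z -> [/\ d w != 0, n w != 0 & \forall u \near w, t u / n u = r u].
    move=> wz; have dw : d w != 0 by apply: H1 => //; near: w; exact: (near_ball z e1 e10).
    have nw : n w != 0 by apply: H2 => //; near: w; exact: (near_ball z e2 e20).
    by split=> //; apply: filterS (ccont_neq0 dw cd) => u du; rewrite /r (negbTE du).
  have crw : ccont w r.
    have [->//|/loc[dw nw near_r]] := eqVneq w z.
    by apply: ccont_near near_r _; apply: ccontM => //; exact: ccontV.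
  split; last first.
    by apply: ccontD; [|apply: ccontN]; apply: ccontM => //; [exact: ccontD|exact: ccontM].
  (* At z both terms of the announced derivative vanish with r, and the product lemma gives
     derivative 0; elsewhere the ordinary product and quotient rules give that formula. *)
  have [wz|/loc[dw nw near_r]] := eqVneq w z.
    rewrite wz rz !mulr0 mul0r subr0; rewrite wz in Ht1.
    exact: has_cderiv_mul0 cr rz tz Ht1.
  have := has_cderivM (has_cderivM Ht1 (has_cderivV nw Hn1)) Ht1.
  have rw : r w = t w / n w by rewrite -(nbhs_singleton near_r).
  have -> : (t' w * (n w)^-1 + t w * (- n' w * (n w)^-1 * (n w)^-1)) * t w +
      t w / n w * t' w = (t' w + t' w) * r w - r w * r w * n' w.
    by rewrite rw; ring.
  by apply: has_cderiv_near; apply: filterS near_r => u hu; rewrite /H -hu.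
apply: holg_near; apply: plane_nearW => w; rewrite /H /r.
case: eqP => [dw|dw]; first by rewrite mul0r.
by rewrite mulrAC /t exprD.
Unshelve. all: by end_near. Qed.

End PoleExtension.

(** * Cayley-Dickson algebras over a commutative ring *)

Section CayleyDicksonRing.
Variable S : comNzRingType.

(** The doubling over any commutative ring S: R gives the real algebras and [R[i]] their
    complexifications, so one proof of an identity serves both. Bare tuples let [ring] work on the
    coordinates. *)
Fixpoint cdt (n : nat) : Type := if n is m.+1 then (cdt m * cdt m)%type else S.

Fixpoint cdt_zero n : cdt n :=
  match n return cdt n with 0 => 0 | m.+1 => (cdt_zero m, cdt_zero m) end.

Fixpoint cdt_one n : cdt n :=
  match n return cdt n with 0 => 1 | m.+1 => (cdt_one m, cdt_zero m) end.

Fixpoint cdt_add n : cdt n -> cdt n -> cdt n :=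
  match n return cdt n -> cdt n -> cdt n with
  | 0 => fun x y => x + y
  | m.+1 => fun x y => (cdt_add x.1 y.1, cdt_add x.2 y.2)
  end.

Fixpoint cdt_scale n (a : S) : cdt n -> cdt n :=
  match n return cdt n -> cdt n with
  | 0 => fun x => a * x
  | m.+1 => fun x => (cdt_scale a x.1, cdt_scale a x.2)
  end.

Fixpoint cdt_conj n : cdt n -> cdt n :=
  match n return cdt n -> cdt n with
  | 0 => fun x => x
  | m.+1 => fun x => (cdt_conj x.1, cdt_scale (-1) x.2)
  end.

Fixpoint cdt_mul n : cdt n -> cdt n -> cdt n :=
  match n return cdt n -> cdt n -> cdt n with
  | 0 => fun x y => x * y
  | m.+1 => fun x y =>
      (cdt_add (cdt_mul x.1 y.1) (cdt_scale (-1) (cdt_mul (cdt_conj y.2) x.2)),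
       cdt_add (cdt_mul y.2 x.1) (cdt_mul x.2 (cdt_conj y.1)))
  end.

Fixpoint cdt_norm n : cdt n -> S :=
  match n return cdt n -> S with
  | 0 => fun x => x * x
  | m.+1 => fun x => cdt_norm x.1 + cdt_norm x.2
  end.

Local Notation "x +' y" := (cdt_add x y) (at level 50, left associativity).
Local Notation "x *' y" := (cdt_mul x y) (at level 40, left associativity).
Local Notation "a *:' x" := (cdt_scale a x) (at level 40).
Local Notation "x ^c" := (cdt_conj x) (at level 1).

Lemma cdt_addA n (x y z : cdt n) : x +' (y +' z) = x +' y +' z.
Proof. by elim: n x y z => [|n IH] x y z /=; [exact: addrA|rewrite !IH]. Qed.

Lemma cdt_addC n (x y : cdt n) : x +' y = y +' x.
Proof. by elim: n x y => [|n IH] x y /=; [exact: addrC|congr pair; exact: IH]. Qed.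

Lemma cdt_add0 n (x : cdt n) : cdt_zero n +' x = x.
Proof. by elim: n x => [|n IH] x /=; [exact: add0r|case: x => a b /=; rewrite !IH]. Qed.

Lemma cdt_addACA n (x y z t : cdt n) : (x +' y) +' (z +' t) = (x +' z) +' (y +' t).
Proof. by rewrite -!cdt_addA; congr (_ +' _); rewrite !cdt_addA (cdt_addC y). Qed.

Lemma cdt_scaleA n a b (x : cdt n) : a *:' (b *:' x) = (a * b) *:' x.
Proof. by elim: n x => [|n IH] x /=; [exact: mulrA|rewrite !IH]. Qed.

Lemma cdt_scale1 n (x : cdt n) : 1 *:' x = x.
Proof. by elim: n x => [|n IH] x /=; [exact: mul1r|case: x => a b /=; rewrite !IH]. Qed.

Lemma cdt_scaleDr n a (x y : cdt n) : a *:' (x +' y) = a *:' x +' a *:' y.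
Proof. by elim: n x y => [|n IH] x y /=; [exact: mulrDr|rewrite !IH]. Qed.

Lemma cdt_scaleDl n a b (x : cdt n) : (a + b) *:' x = a *:' x +' b *:' x.
Proof. by elim: n x => [|n IH] x /=; [exact: mulrDl|rewrite !IH]. Qed.

Lemma cdt_scale0 n (x : cdt n) : 0 *:' x = cdt_zero n.
Proof. by elim: n x => [|n IH] x /=; [exact: mul0r|rewrite !IH]. Qed.

Lemma cdt_scale0r n a : a *:' cdt_zero n = cdt_zero n.
Proof. by elim: n => [|n IH] /=; [exact: mulr0|rewrite !IH]. Qed.

Lemma cdt_addN n (x : cdt n) : (-1) *:' x +' x = cdt_zero n.
Proof. by rewrite -{2}[x]cdt_scale1 -cdt_scaleDl addNr cdt_scale0. Qed.

Lemma cdt_conjD n (x y : cdt n) : (x +' y)^c = x^c +' y^c.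
Proof. by elim: n x y => [|n IH] x y //=; rewrite IH cdt_scaleDr. Qed.

Lemma cdt_conjZ n a (x : cdt n) : (a *:' x)^c = a *:' x^c.
Proof. by elim: n x => [|n IH] x //=; rewrite IH !cdt_scaleA mulrC. Qed.

Lemma cdt_conjK n (x : cdt n) : x^c^c = x.
Proof.
elim: n x => [|n IH] x //=; rewrite IH cdt_scaleA mulrNN mulr1 cdt_scale1.
by case: x.
Qed.

Lemma cdt_conj1 n : (cdt_one n)^c = cdt_one n.
Proof. by elim: n => [|n IH] //=; rewrite IH cdt_scale0r. Qed.

(** The two sides are proved together because the doubled product contains factors in both orders;
    the same holds for scalars and for the unit below. *)
Lemma cdt_mulDlr n : (forall x y z : cdt n, (x +' y) *' z = x *' z +' y *' z) /\
  (forall x y z : cdt n, x *' (y +' z) = x *' y +' x *' z).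
Proof.
elim: n => [|n [IHl IHr]]; first by split=> x y z; [exact: mulrDl|exact: mulrDr].
split=> x y z /=; rewrite ?cdt_conjD !(IHl, IHr) !cdt_scaleDr.
  by rewrite cdt_addACA; congr pair; rewrite cdt_addACA.
by rewrite cdt_addACA; congr pair; rewrite cdt_addACA.
Qed.

Lemma cdt_mulDl n (x y z : cdt n) : (x +' y) *' z = x *' z +' y *' z.
Proof. exact: (cdt_mulDlr n).1. Qed.

Lemma cdt_mulDr n (x y z : cdt n) : x *' (y +' z) = x *' y +' x *' z.
Proof. exact: (cdt_mulDlr n).2. Qed.

Lemma cdt_mulZlr n a : (forall x y : cdt n, (a *:' x) *' y = a *:' (x *' y)) /\
  (forall x y : cdt n, x *' (a *:' y) = a *:' (x *' y)).
Proof.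
elim: n => [|n [IHl IHr]].
  by split=> x y /=; [rewrite mulrA|rewrite mulrCA].
split=> x y /=; rewrite ?cdt_conjZ !(IHl, IHr) !cdt_scaleDr !cdt_scaleA;
  by rewrite (mulrC a).
Qed.

Lemma cdt_mulZl n a (x y : cdt n) : (a *:' x) *' y = a *:' (x *' y).
Proof. exact: (cdt_mulZlr n a).1. Qed.

Lemma cdt_mulZr n a (x y : cdt n) : x *' (a *:' y) = a *:' (x *' y).
Proof. exact: (cdt_mulZlr n a).2. Qed.

Lemma cdt_mul0 n (x : cdt n) : cdt_zero n *' x = cdt_zero n /\ x *' cdt_zero n = cdt_zero n.
Proof.
rewrite -(cdt_scale0 (cdt_one n)); split.
  by rewrite cdt_mulZl !cdt_scale0.
by rewrite cdt_mulZr !cdt_scale0.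
Qed.

Lemma cdt_conj0 n : (cdt_zero n)^c = cdt_zero n.
Proof. by elim: n => [|n IH] //=; rewrite IH cdt_scale0r. Qed.

Lemma cdt_addr0 n (x : cdt n) : x +' cdt_zero n = x.
Proof. by rewrite cdt_addC cdt_add0. Qed.

Lemma cdt_mul1 n : (forall x : cdt n, cdt_one n *' x = x) /\
  (forall x : cdt n, x *' cdt_one n = x).
Proof.
elim: n => [|n [IHl IHr]]; first by split=> x; [exact: mul1r|exact: mulr1].
split=> -[a b] /=.
  rewrite IHl IHr; have [-> _] := cdt_mul0 (a^c); have [_ ->] := cdt_mul0 (b^c).
  by rewrite cdt_scale0r !cdt_addr0.
rewrite IHr cdt_conj1 IHr cdt_conj0; have [-> _] := cdt_mul0 b; have [-> _] := cdt_mul0 a.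
by rewrite cdt_scale0r cdt_addr0 cdt_add0.
Qed.

Lemma cdt_mul1l n (x : cdt n) : cdt_one n *' x = x.
Proof. exact: (cdt_mul1 n).1. Qed.

Lemma cdt_mul1r n (x : cdt n) : x *' cdt_one n = x.
Proof. exact: (cdt_mul1 n).2. Qed.

Lemma cdt_conjM n (x y : cdt n) : (x *' y)^c = y^c *' x^c.
Proof.
elim: n x y => [|n IH] x y; first exact: mulrC.
case: x y => a b [c d] /=.
rewrite !(cdt_conjD, cdt_conjZ, IH, cdt_conjK, cdt_mulZl, cdt_mulZr, cdt_scaleDr, cdt_scaleA).
by rewrite mulrNN mulr1 mul1r; congr pair; rewrite cdt_addC.
Qed.

Lemma cdt_norm_scale n a (x : cdt n) : cdt_norm (a *:' x) = a * a * cdt_norm x.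
Proof. by elim: n x => [|n IH] x /=; [ring|rewrite !IH mulrDr]. Qed.

Lemma cdt_norm_conj n (x : cdt n) : cdt_norm x^c = cdt_norm x.
Proof. by elim: n x => [|n IH] x //=; rewrite IH cdt_norm_scale; ring. Qed.

(** The product (a, b)(a^c, -b) is (a a^c + b^c b, -b a + b a), so the identity climbs through all
    levels. *)
Lemma cdt_mul_conj n (x : cdt n) : x *' x^c = cdt_norm x *:' cdt_one n.
Proof.
elim: n x => [|n IH] x; first by rewrite /= mulr1.
case: x => a b /=.
have IHl (u : cdt n) : u^c *' u = cdt_norm u *:' cdt_one n.
  by rewrite -{2}[u]cdt_conjK IH cdt_norm_conj.
rewrite IH cdt_conjZ cdt_mulZl cdt_scaleA mulrNN mulr1 cdt_scale1 IHl.
rewrite -cdt_scaleDl; congr pair.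
by rewrite cdt_conjK cdt_mulZl cdt_addN cdt_scale0r.
Qed.

Lemma cdt_conj_mul n (x : cdt n) : x^c *' x = cdt_norm x *:' cdt_one n.
Proof. by rewrite -{2}[x]cdt_conjK cdt_mul_conj cdt_norm_conj. Qed.

Fixpoint cdt_re n : cdt n -> S :=
  match n return cdt n -> S with 0 => fun x => x | m.+1 => fun x => cdt_re x.1 end.

Lemma cdt_trace n (x : cdt n) : x +' x^c = (cdt_re x + cdt_re x) *:' cdt_one n.
Proof.
elim: n x => [|n IH] x /=; first by rewrite mulr1.
by rewrite IH (cdt_addC x.2) cdt_addN cdt_scale0r.
Qed.

(** A polynomial identity in the coordinates at each of the levels 0, 1 and 2. *)
Lemma cdt_mulA n (x y z : cdt n) : (n <= 2)%N -> x *' (y *' z) = x *' y *' z.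
Proof.
case: n x y z => [|[|[|//]]] x y z _ /=.
- exact: mulrA.
- by congr pair; ring.
- by congr (_, _, (_, _)); ring.
Qed.

Lemma cdt_alt_left n (x y : cdt n) : (n <= 3)%N -> x *' x *' y = x *' (x *' y).
Proof.
case: n x y => [|[|[|[|//]]]] x y _.
- by rewrite cdt_mulA.
- by rewrite cdt_mulA.
- by rewrite cdt_mulA.
- case: x => [[[? ?] [? ?]] [[? ?] [? ?]]]; case: y => [[[? ?] [? ?]] [[? ?] [? ?]]] /=.
  by congr (((_, _), (_, _)), ((_, _), (_, _))); ring.
Qed.

(** Conjugation reverses products and so exchanges the two alternative laws. *)
Lemma cdt_alt_right n (x y : cdt n) : (n <= 3)%N -> y *' x *' x = y *' (x *' x).
Proof.
move=> n3; apply: (can_inj (@cdt_conjK n)); rewrite !cdt_conjM.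
by rewrite cdt_alt_left.
Qed.

Lemma cdt_alt_flex n (x y : cdt n) : (n <= 3)%N -> x *' y *' x = x *' (y *' x).
Proof.
case: n x y => [|[|[|[|//]]]] x y _.
- by rewrite cdt_mulA.
- by rewrite cdt_mulA.
- by rewrite cdt_mulA.
- case: x => [[[? ?] [? ?]] [[? ?] [? ?]]]; case: y => [[[? ?] [? ?]] [[? ?] [? ?]]] /=.
  by congr (((_, _), (_, _)), ((_, _), (_, _))); ring.
Qed.

(** Since x^c is the scalar x + x^c minus x, left alternativity also re-associates x^c, x, y. This
    and its three variants take the place of associativity when equations are solved. *)
Lemma cdt_conj_mulK n (x y : cdt n) : (n <= 3)%N -> x^c *' (x *' y) = cdt_norm x *:' y.
Proof.
move=> n3; have -> : cdt_norm x *:' y = x^c *' x *' y.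
  by rewrite cdt_conj_mul cdt_mulZl cdt_mul1l.
have -> : x^c = (cdt_re x + cdt_re x) *:' cdt_one n +' (-1) *:' x.
  by rewrite -cdt_trace [x +' _]cdt_addC -cdt_addA (cdt_addC x) cdt_addN cdt_addr0.
by rewrite !(cdt_mulDl, cdt_mulZl, cdt_mul1l) cdt_alt_left.
Qed.

Lemma cdt_mul_conjK n (x y : cdt n) : (n <= 3)%N -> x *' (x^c *' y) = cdt_norm x *:' y.
Proof. by move=> n3; rewrite -{1}[x]cdt_conjK cdt_conj_mulK // cdt_norm_conj. Qed.

Lemma cdt_mulK_conj n (x y : cdt n) : (n <= 3)%N -> y *' x *' x^c = cdt_norm x *:' y.
Proof.
move=> n3; apply: (can_inj (@cdt_conjK n)); rewrite !cdt_conjM cdt_conjZ cdt_conjK.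
by rewrite cdt_mul_conjK.
Qed.

Lemma cdt_mulK n (x y : cdt n) : (n <= 3)%N -> y *' x^c *' x = cdt_norm x *:' y.
Proof. by move=> n3; rewrite -{2}[x]cdt_conjK cdt_mulK_conj // cdt_norm_conj. Qed.

End CayleyDicksonRing.

(** * Quaternions and octonions over the reals *)

Section RealAlgebra.
Variable R : realType.
Notation C := (R[i]%C).

Local Notation "x +' y" := (cdt_add x y) (at level 50, left associativity).
Local Notation "x *' y" := (cdt_mul x y) (at level 40, left associativity).
Local Notation "a *:' x" := (cdt_scale a x) (at level 40).

(** It only forgets the normed module structure; being injective and compatible with all operations,
    it transports the laws of [cdt]. *)
Fixpoint cdr n : CD R n -> cdt R n :=
  match n return CD R n -> cdt R n with
  | 0 => fun x => x
  | m.+1 => fun x : (CD R m * CD R m)%type => (cdr x.1, cdr x.2)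
  end.

Lemma cdr_inj n : injective (@cdr n).
Proof.
elim: n => [|n IH]; first by move=> x y.
by move=> [a b] [c d] /= [/IH -> /IH ->].
Qed.

Lemma cdrD n (x y : CD R n) : cdr (x + y) = cdr x +' cdr y.
Proof. by elim: n x y => [|n IH] x y //=; rewrite !IH. Qed.

Lemma cdrZ n a (x : CD R n) : cdr (a *: x) = a *:' cdr x.
Proof. by elim: n x => [|n IH] x //=; rewrite !IH. Qed.

Lemma cdrN n (x : CD R n) : cdr (- x) = (-1) *:' cdr x.
Proof. by rewrite -cdrZ scaleN1r. Qed.

Lemma cdr0 n : cdr (0 : CD R n) = cdt_zero R n.
Proof. by elim: n => [|n IH] //=; rewrite IH. Qed.

Lemma cdr1 n : cdr (cdone R n) = cdt_one R n.
Proof. by elim: n => [|n IH] //=; rewrite IH cdr0. Qed.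

Lemma cdr_conj n (x : CD R n) : cdr (cdconj x) = cdt_conj (cdr x).
Proof. by elim: n x => [|n IH] x //=; rewrite IH cdrN. Qed.

Lemma cdrM n (x y : CD R n) : cdr (cdmul x y) = cdr x *' cdr y.
Proof.
elim: n x y => [|n IH] x y //=.
by rewrite !cdrD cdrN !IH !cdr_conj.
Qed.

Definition cdrE := (cdrD, cdrZ, cdrN, cdr0, cdr1, cdr_conj, cdrM).

Lemma cdmulDl n (x y z : CD R n) : cdmul (x + y) z = cdmul x z + cdmul y z.
Proof. by apply: cdr_inj; rewrite !cdrE cdt_mulDl. Qed.

Lemma cdmulDr n (x y z : CD R n) : cdmul x (y + z) = cdmul x y + cdmul x z.
Proof. by apply: cdr_inj; rewrite !cdrE cdt_mulDr. Qed.

Lemma cdmulZl n a (x y : CD R n) : cdmul (a *: x) y = a *: cdmul x y.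
Proof. by apply: cdr_inj; rewrite !cdrE cdt_mulZl. Qed.

Lemma cdmulZr n a (x y : CD R n) : cdmul x (a *: y) = a *: cdmul x y.
Proof. by apply: cdr_inj; rewrite !cdrE cdt_mulZr. Qed.

Lemma cdmulNl n (x y : CD R n) : cdmul (- x) y = - cdmul x y.
Proof. by rewrite -scaleN1r cdmulZl scaleN1r. Qed.

Lemma cdmulNr n (x y : CD R n) : cdmul x (- y) = - cdmul x y.
Proof. by rewrite -scaleN1r cdmulZr scaleN1r. Qed.

Lemma cdmul1l n (x : CD R n) : cdmul (cdone R n) x = x.
Proof. by apply: cdr_inj; rewrite !cdrE cdt_mul1l. Qed.

Lemma cdmul1r n (x : CD R n) : cdmul x (cdone R n) = x.
Proof. by apply: cdr_inj; rewrite !cdrE cdt_mul1r. Qed.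

Lemma cdmul0r n (x : CD R n) : cdmul x 0 = 0.
Proof. by rewrite -(scale0r (0 : CD R n)) cdmulZr !scale0r. Qed.

Definition cdre n (x : CD R n) : R := cdt_re (cdr x).
Definition cdnorm n (x : CD R n) : R := cdt_norm (cdr x).

Lemma cdnorm_ge0 n (x : CD R n) : 0 <= cdnorm x.
Proof.
rewrite /cdnorm; elim: n x => [|n IH] x /=; first by rewrite -expr2 sqr_ge0.
by rewrite addr_ge0.
Qed.

Lemma cdnorm_eq0 n (x : CD R n) : cdnorm x = 0 -> x = 0.
Proof.
elim: n x => [|n IH] x.
  by rewrite /cdnorm /= => /eqP; rewrite mulf_eq0 orbb => /eqP.
case: x => a b; rewrite /cdnorm /= => /eqP.
by rewrite paddr_eq0 ?cdnorm_ge0 // => /andP[/eqP/IH -> /eqP/IH ->].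
Qed.

Lemma cdre_slice n a b (x : CD R n) : cdre (a *: cdone R n + b *: x) = a + b * cdre x.
Proof.
rewrite /cdre; elim: n x => [|n IH] x /=; last by rewrite IH.
by rewrite /GRing.scale /= mulr1.
Qed.

Lemma cdnorm_slice n a b (x : CD R n) : cdnorm (a *: cdone R n + b *: x) =
  a ^+ 2 + a * b * cdre x *+ 2 + b ^+ 2 * cdnorm x.
Proof.
rewrite /cdre /cdnorm; elim: n x => [|n IH] x /=.
  by rewrite /GRing.scale /=; ring.
rewrite IH scaler0 add0r cdrZ cdt_norm_scale; ring.
Qed.

Lemma cdreZ1 n a : cdre (a *: cdone R n) = a.
Proof.
by have := cdre_slice a 0 (cdone R n); rewrite scale0r addr0 mul0r addr0.
Qed.

Lemma cdre0 n : cdre (0 : CD R n) = 0.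
Proof. by rewrite -(scale0r (cdone R n)) cdreZ1. Qed.

(** The quadratic equation x^2 = t(x) x - n(x), obtained by writing one factor x as t(x) - x^c. *)
Lemma cdmul_sq n (x : CD R n) :
  cdmul x x = (cdre x *+ 2) *: x - cdnorm x *: cdone R n.
Proof.
apply: cdr_inj; rewrite !cdrE -/(cdnorm x) /cdnorm -cdt_mul_conj.
have xE : cdr x = (cdre x + cdre x) *:' cdt_one R n +' (-1) *:' cdt_conj (cdr x).
  by rewrite -cdt_trace -cdt_addA (cdt_addC (cdt_conj _)) cdt_addN cdt_addr0.
rewrite {2}xE cdt_mulDr !cdt_mulZr cdt_mul1r mulr2n.
by [].
Qed.

(** By the quadratic equation, a square root of -1 with non-zero real part would be a real
    scalar. *)
Lemma imunitP n (x : CD R n) :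
  cdmul x x = - cdone R n <-> cdre x = 0 /\ cdnorm x = 1.
Proof.
split=> [|[r0 n1]]; last by rewrite cdmul_sq r0 n1 mul0rn scale0r sub0r scale1r.
rewrite cdmul_sq => H.
have e1 : (cdre x *+ 2) *: x = (cdnorm x - 1) *: cdone R n.
  by rewrite scalerBl scale1r -H addrC addrNK.
have [r0|r0] := eqVneq (cdre x) 0.
  split=> //; move: e1; rewrite r0 mul0rn scale0r => /(congr1 (@cdre n)).
  rewrite cdre0 cdreZ1.
  by move=> /eqP; rewrite eq_sym subr_eq0 => /eqP.
have r2 : cdre x *+ 2 != 0 by rewrite mulrn_eq0.
have xE : x = ((cdnorm x - 1) / (cdre x *+ 2)) *: cdone R n.
  by rewrite mulrC -scalerA -e1 scalerA mulVf // scale1r.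
move: xE; set s := (_ / _) => xE.
have : cdre (cdmul x x) = - 1.
  by rewrite cdmul_sq H -scaleN1r cdreZ1.
rewrite xE cdmulZl cdmul1l scalerA cdreZ1.
by rewrite -expr2 => h; have := sqr_ge0 s; rewrite h oppr_ge0 ler10.
Qed.

Lemma cdmul_imunitK n (I x : CD R n) : (n <= 3)%N ->
  cdmul I I = - cdone R n -> cdmul I (cdmul I x) = - x.
Proof.
move=> n3 hI; have -> : cdmul I (cdmul I x) = cdmul (cdmul I I) x.
  by apply: cdr_inj; rewrite !cdrM cdt_alt_left.
by rewrite hI cdmulNl cdmul1l.
Qed.

Lemma fst_continuous (U V : normedModType R) :
  continuous (fst : (U * V)%type -> U).
Proof. by move=> x; exact: (@cvg_fst _ _ (nbhs x.1) (nbhs x.2)). Qed.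

Lemma snd_continuous (U V : normedModType R) :
  continuous (snd : (U * V)%type -> V).
Proof. by move=> x; exact: (@cvg_snd _ _ (nbhs x.1) (nbhs x.2)). Qed.

Lemma cdre_continuous n : continuous (@cdre n : CD R n -> R^o).
Proof.
elim: n => [|n IH]; first by move=> x; exact: cvg_id.
have -> : (@cdre n.+1 : CD R n.+1 -> R^o) = (@cdre n : CD R n -> R^o) \o fst by [].
by move=> x; apply: continuous_comp; [exact: fst_continuous|exact: IH].
Qed.

Lemma cdnorm_continuous n : continuous (@cdnorm n : CD R n -> R^o).
Proof.
elim: n => [|n IH]; first by move=> x; apply: cvgM; exact: cvg_id.
have -> : (@cdnorm n.+1 : CD R n.+1 -> R^o) =
  ((@cdnorm n : CD R n -> R^o) \o fst) + ((@cdnorm n : CD R n -> R^o) \o snd) by [].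
move=> x; apply: cvgD.
  by apply: continuous_comp; [exact: fst_continuous|exact: IH].
by apply: continuous_comp; [exact: snd_continuous|exact: IH].
Qed.

End RealAlgebra.

(** * The complexified algebra in coordinates *)

Section Complexify.
Variable R : realType.
Notation C := (R[i]%C).
Local Notation "x +' y" := (cdt_add x y) (at level 50, left associativity).
Local Notation "x *' y" := (cdt_mul x y) (at level 40, left associativity).
Local Notation "a *:' x" := (cdt_scale a x) (at level 40).

(* [cdc x y] is [x + iota y] *)
Fixpoint cdc n : CD R n -> CD R n -> cdt C n :=
  match n return CD R n -> CD R n -> cdt C n with
  | 0 => fun x y => Complex x y
  | m.+1 => fun x y : (CD R m * CD R m)%type => (cdc x.1 y.1, cdc x.2 y.2)
  end.

Fixpoint cdc_re n : cdt C n -> CD R n :=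
  match n return cdt C n -> CD R n with
  | 0 => fun x => complex.Re x
  | m.+1 => fun x => (cdc_re x.1, cdc_re x.2)
  end.

Fixpoint cdc_im n : cdt C n -> CD R n :=
  match n return cdt C n -> CD R n with
  | 0 => fun x => complex.Im x
  | m.+1 => fun x => (cdc_im x.1, cdc_im x.2)
  end.

Lemma cdc_reK n (x y : CD R n) : cdc_re (cdc x y) = x.
Proof. by elim: n x y => [|n IH] x y //=; rewrite !IH; case: x. Qed.

Lemma cdc_imK n (x y : CD R n) : cdc_im (cdc x y) = y.
Proof. by elim: n x y => [|n IH] x y //=; rewrite !IH; case: y. Qed.

Lemma cdcK n (t : cdt C n) : cdc (cdc_re t) (cdc_im t) = t.
Proof. by elim: n t => [|n IH] /= [a b] //=; rewrite !IH. Qed.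

Lemma cdc_reD n (t u : cdt C n) : cdc_re (t +' u) = cdc_re t + cdc_re u.
Proof. by elim: n t u => [|n IH] t u /=; [exact: cReD|rewrite !IH]. Qed.

Lemma cdc_imD n (t u : cdt C n) : cdc_im (t +' u) = cdc_im t + cdc_im u.
Proof. by elim: n t u => [|n IH] t u /=; [exact: cImD|rewrite !IH]. Qed.

Lemma cdc_reZ n (c : C) (t : cdt C n) :
  cdc_re (c *:' t) = complex.Re c *: cdc_re t - complex.Im c *: cdc_im t.
Proof. by elim: n t => [|n IH] t /=; [exact: cReM|rewrite !IH]. Qed.

Lemma cdc_imZ n (c : C) (t : cdt C n) :
  cdc_im (c *:' t) = complex.Re c *: cdc_im t + complex.Im c *: cdc_re t.
Proof. by elim: n t => [|n IH] t /=; [exact: cImM|rewrite !IH]. Qed.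

Lemma cdc_reN n (t : cdt C n) : cdc_re ((-1) *:' t) = - cdc_re t.
Proof. by rewrite cdc_reZ /= oppr0 scale0r subr0 scaleN1r. Qed.

Lemma cdc_imN n (t : cdt C n) : cdc_im ((-1) *:' t) = - cdc_im t.
Proof. by rewrite cdc_imZ /= oppr0 scale0r addr0 scaleN1r. Qed.

Lemma cdc_re_conj n (t : cdt C n) : cdc_re (cdt_conj t) = cdconj (cdc_re t).
Proof. by elim: n t => [|n IH] t //=; rewrite IH cdc_reN. Qed.

Lemma cdc_im_conj n (t : cdt C n) : cdc_im (cdt_conj t) = cdconj (cdc_im t).
Proof. by elim: n t => [|n IH] t //=; rewrite IH cdc_imN. Qed.

Lemma cdc_reM_imM n : (forall t u : cdt C n, cdc_re (t *' u) =
    cdmul (cdc_re t) (cdc_re u) - cdmul (cdc_im t) (cdc_im u)) /\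
  (forall t u : cdt C n, cdc_im (t *' u) =
    cdmul (cdc_re t) (cdc_im u) + cdmul (cdc_im t) (cdc_re u)).
Proof.
elim: n => [|n [IHr IHi]].
  by split=> t u; [exact: cReM|exact: cImM].
split=> t u /=; rewrite !(cdc_reD, cdc_imD, cdc_reN, cdc_imN, IHr, IHi, cdc_re_conj, cdc_im_conj).
  apply/pair_equal_spec; split=> /=.
    by rewrite !opprD !opprK addrACA.
  by rewrite addrACA -opprD.
apply/pair_equal_spec; split=> /=.
  by rewrite opprD [- _ - _]addrC addrACA.
by rewrite [X in X + _]addrC addrACA.
Qed.

End Complexify.

(** * Circular sets and the half plane *)

Section Circular.
Variables (R : realType) (K : algebra_kind).
Notation A := (alg R K).
Notation plane := (plane R).
Notation n := (cdlevel K).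
Implicit Types (x y : A) (z w : plane) (W : set A) (I J : A).

Lemma level_le3 : (n <= 3)%N. Proof. by case: K. Qed.

Lemma imunitE I : imunit I <-> cdre (I : CD R n) = 0 /\ cdnorm (I : CD R n) = 1.
Proof. exact: imunitP. Qed.

Lemma imunit_opp I : imunit I -> imunit (- I).
Proof.
move=> hI; have /= h : cdmul (I : CD R n) I = - cdone R n := hI.
rewrite /imunit /= /alg_mul.
by rewrite [LHS](_ : _ = cdmul (I : CD R n) I) // cdmulNl cdmulNr opprK.
Qed.

Lemma imunit_exists : exists I : A, imunit I.
Proof.
suff [I h] : exists I : CD R n, cdre I = 0 /\ cdnorm I = 1 by exists I; apply/imunitE.
case: K.
- exists (((0 : R, 1 : R), (0 : R, 0 : R)) : CD R 2); rewrite /cdre /cdnorm /=.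
  by rewrite !mulr0 mulr1 !addr0 add0r.
- exists ((((0 : R, 1 : R), (0 : R, 0 : R)), ((0 : R, 0 : R), (0 : R, 0 : R))) : CD R 3).
  by rewrite /cdre /cdnorm /= !mulr0 mulr1 !addr0 add0r.
Qed.

(* [alpha + beta I] is mapped to [(alpha, |beta|)]; [circular] sets are the
   preimages under this map *)
Definition half_plane_proj x : plane :=
  (cdre (x : CD R n), Num.sqrt (cdnorm (x : CD R n) - cdre (x : CD R n) ^+ 2)).
Notation pr := half_plane_proj.

Lemma pr_slice_point (a b : R) I : imunit I -> pr (slice_point a b I) = (a, `|b|).
Proof.
move=> /imunitE[r0 n1]; rewrite /pr /slice_point.
have -> : cdre (a *: alg_one R K + b *: I : CD R n) = a.
  by rewrite [LHS]cdre_slice r0 mulr0 addr0.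
have -> : cdnorm (a *: alg_one R K + b *: I : CD R n) = a ^+ 2 + b ^+ 2.
  by rewrite [LHS]cdnorm_slice r0 n1 mulr0 mul0rn addr0 mulr1.
by rewrite addrC addKr sqrtr_sqr.
Qed.

(** The difference is the norm of x minus its real part. *)
Lemma cdnorm_re_ge0 x : 0 <= cdnorm (x : CD R n) - cdre (x : CD R n) ^+ 2.
Proof.
have := cdnorm_ge0 ((- cdre (x : CD R n)) *: cdone R n + 1 *: (x : CD R n)).
rewrite cdnorm_slice; congr (0 <= _); ring.
Qed.

Lemma slice_point_pr x : exists2 I, imunit I & x = slice_point (pr x).1 (pr x).2 I.
Proof.
set r := cdre (x : CD R n).
pose v : CD R n := (- r) *: cdone R n + 1 *: (x : CD R n).
have vr : cdre v = 0 by rewrite cdre_slice mul1r addNr.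
have vn : cdnorm v = cdnorm (x : CD R n) - r ^+ 2.
  by rewrite cdnorm_slice -/r; ring.
set b := (pr x).2.
have b2 : b ^+ 2 = cdnorm v by rewrite vn sqr_sqrtr // cdnorm_re_ge0.
have xv : x = r *: cdone R n + v.
  by rewrite /v addrA -scalerDl subrr scale0r add0r scale1r.
(* A real x lies on every slice, so any unit will do; otherwise the unit is the normalised imaginary
   part. *)
have [b0|b0] := eqVneq b 0.
  have [I hI] := imunit_exists; exists I => //.
  have v0 : v = 0 by apply: cdnorm_eq0; rewrite -b2 b0 expr0n.
  by rewrite /slice_point -/b b0 scale0r addr0 [LHS]xv v0 addr0.
exists (b^-1 *: v); last first.
  by rewrite /slice_point -/b scalerA mulfV // scale1r; exact: xv.
apply/imunitE; rewrite -[X in cdre X]add0r -[X in cdnorm X]add0r -(scale0r (cdone R n)).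
rewrite cdre_slice cdnorm_slice vr -b2; split; first by ring.
by field.
Qed.

Lemma pr_continuous : continuous (pr : A -> plane).
Proof.
move=> x; have c1 := @cdre_continuous R n x; have c2 := @cdnorm_continuous R n x.
have c3 : (fun y : A => Num.sqrt (cdnorm (y : CD R n) - cdre (y : CD R n) ^+ 2) : R^o) @ x -->
   (Num.sqrt (cdnorm (x : CD R n) - cdre (x : CD R n) ^+ 2) : R^o).
  apply: (@cvg_comp _ _ _ (fun y : A => cdnorm (y : CD R n) - cdre (y : CD R n) ^+ 2 : R^o)
    (fun t : R => Num.sqrt t)); last exact: sqrt_continuous.
  by apply: cvgB => //; under eq_fun do rewrite expr2; rewrite expr2; apply: cvgM.
exact: cvg_pair c1 c3.
Qed.

Lemma pr_ge0 x : 0 <= (pr x).2. Proof. exact: sqrtr_ge0. Qed.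

Lemma slice_point_oppI (a b : R) I : slice_point a (- b) I = slice_point a b (- I).
Proof. by rewrite /slice_point scaleNr scalerN. Qed.

(** The working form of [circular], free of the planar set; [circularP] identifies the two. *)
Definition saturated W := forall x y, pr x = pr y -> W x -> W y.

Lemma planarP W z I : saturated W -> imunit I ->
  planar W z <-> W (slice_point z.1 z.2 I).
Proof.
move=> sW hI; split; last by exists I.
by move=> [J hJ]; apply: sW; rewrite !pr_slice_point.
Qed.

Lemma planar_conj W z : saturated W -> planar W z -> planar W (planeconj z).
Proof.
move=> sW [I hI h]; exists (- I); first exact: imunit_opp.
by rewrite /planeconj /= slice_point_oppI opprK.
Qed.

Lemma planar_pr W x : saturated W -> planar W (pr x) <-> W x.
Proof.
move=> sW; have [I hI xE] := slice_point_pr x.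
by rewrite (planarP _ sW hI) -xE.
Qed.

Lemma circularP W : circular W <-> saturated W.
Proof.
split=> [[D cD ->] x y xy|sW].
  move=> [z [I [Dz hI xE]]]; move: xy; rewrite xE pr_slice_point // => yE.
  have [J hJ ->] := slice_point_pr y; exists (pr y), J; split=> //; rewrite -yE.
  have [b0|b0] := lerP 0 z.2; first by case: z Dz {xE yE} b0 => a b /= Dz b0; rewrite ger0_norm.
  rewrite ltr0_norm //; exact: cD.
exists (planar W); first by move=> z; exact: planar_conj.
apply/seteqP; split=> x.
  move=> Wx; have [I hI xE] := slice_point_pr x; exists (pr x), I; split=> //.
  exact/planar_pr.
by move=> [z [I [h hI ->]]]; apply/(planarP _ sW hI).
Qed.

Lemma slice_point_continuous I :
  continuous (fun z : plane => slice_point z.1 z.2 I : A).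
Proof.
move=> z; apply: cvgD.
  by apply: cvgZr_tmp; exact: (@fst_continuous R (R^o) (R^o) z).
by apply: cvgZr_tmp; exact: (@snd_continuous R (R^o) (R^o) z).
Qed.

Lemma planar_open W : saturated W -> open W -> open (planar W).
Proof.
move=> sW oW; have [I hI] := imunit_exists.
have -> : planar W = (fun z : plane => slice_point z.1 z.2 I : A) @^-1` W.
  by apply/seteqP; split=> z /(planarP _ sW hI).
by apply: open_comp => // z _; exact: slice_point_continuous.
Qed.

Lemma preimage_pr_open (V : set plane) : open V -> open (pr @^-1` V).
Proof. by move=> oV; apply: open_comp => // x _; exact: pr_continuous. Qed.

Lemma preimage_pr_saturated (V : set plane) : saturated (pr @^-1` V).
Proof. by move=> x y; rewrite /preimage /= => ->. Qed.

Lemma planar_preimage_pr (V : set plane) :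
  conj_invariant V -> planar (pr @^-1` V) = V.
Proof.
move=> cV; have [I hI] := imunit_exists.
apply/seteqP; split=> z.
  move/(planarP _ (@preimage_pr_saturated V) hI); rewrite /preimage /= pr_slice_point //.
  have [b0|b0] := lerP 0 z.2; first by case: z b0 => a b /= b0; rewrite ger0_norm.
  move=> /cV; rewrite /planeconj /= ltr0_norm // opprK.
  by case: z {b0}.
move=> Vz; apply/(planarP _ (@preimage_pr_saturated V) hI); rewrite /preimage /= pr_slice_point //.
have [b0|b0] := lerP 0 z.2; first by case: z Vz b0 => a b /= Vz b0; rewrite ger0_norm.
by rewrite ltr0_norm //; exact: cV.
Qed.

Lemma preimage_planar W : saturated W -> pr @^-1` (planar W) = W.
Proof. by move=> sW; apply/seteqP; split=> x; rewrite /preimage /= planar_pr. Qed.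

Lemma sphereP x y : sphere y x <-> pr x = pr y.
Proof.
split=> [[a [b [I [J [hI hJ -> ->]]]]]|xy]; first by rewrite !pr_slice_point.
have [I hI xE] := slice_point_pr x; have [J hJ yE] := slice_point_pr y.
exists (pr y).1, (pr y).2, J, I; split=> //.
by rewrite -xy.
Qed.

Lemma planeconjK : involutive (@planeconj R).
Proof. by move=> [a b]; rewrite /planeconj /= opprK. Qed.

Lemma planeconj_ball z (e : R) w : ball z e w -> ball (planeconj z) e (planeconj w).
Proof.
move=> /ball_planeE[h1 h2]; apply/ball_planeE; split=> //=.
by rewrite -opprD normrN.
Qed.

Lemma near_planeconj z (P : plane -> Prop) :
  (\forall w \near z, P w) -> \forall w \near planeconj z, P (planeconj w).
Proof.
move=> /nbhs_ballP[e e0 H]; apply/nbhs_ballP; exists e => // w bw; apply: H.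
by rewrite -[z]planeconjK; exact: planeconj_ball.
Qed.

Lemma dnbhs_planeconj z (P : plane -> Prop) :
  (\forall w \near z^', P w) -> \forall w \near (planeconj z)^', P (planeconj w).
Proof.
move=> /dnbhs_ballP[e e0 H]; apply/dnbhs_ballP; exists e => // w bw wz; apply: H.
  by rewrite -[z]planeconjK; exact: planeconj_ball.
by apply: contra wz => /eqP <-; rewrite planeconjK.
Qed.

Lemma pr_eq z w I J : imunit I -> imunit J ->
  pr (slice_point z.1 z.2 I) = pr (slice_point w.1 w.2 J) -> w = z \/ w = planeconj z.
Proof.
move=> hI hJ; rewrite !pr_slice_point //; case: z w => a b [c d] [/= -> ].
by move=> /eqP; rewrite eqr_norm2 => /orP[] /eqP ->; [left|right]; rewrite /planeconj /= ?opprK.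
Qed.

(** For real z the puncture removes the conjugate, which is z itself; otherwise the conjugate is at
    positive distance. *)
Lemma near_notconj z : \forall w \near z^', w != planeconj z.
Proof.
have [<-|zz] := eqVneq z (planeconj z).
  by apply/dnbhs_ballP; exists 1.
apply: near_dnbhs.
have := @ccont_neq0 R z (fun w => toC w - toC (planeconj z)).
rewrite subr_eq0 (inj_eq (@toC_inj R)) => /(_ zz) H.
have {}H : \forall w \near z, toC w - toC (planeconj z) != 0.
  by apply: H; apply: ccontD; [exact: ccont_toC|exact: ccontC].
by apply: filterS H => w; rewrite subr_eq0 (inj_eq (@toC_inj R)).
Qed.

Lemma near_of_dnbhs z (P : plane -> Prop) :
  (\forall w \near z^', P w) -> P z -> \forall w \near z, P w.
Proof.
move=> /dnbhs_ballP[e e0 H] Pz; apply/nbhs_ballP; exists e => // w bw.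
by have [->|wz] := eqVneq w z; last exact: H.
Qed.

(** Relative closedness and isolation of the spheres say together that the planar trace has no
    accumulation point in [planar W]. In this form the condition combines with others by filter
    operations. *)
Lemma discrete_singularitiesP W W0 : saturated W -> open W ->
  discrete_singularities W W0 <->
  [/\ W0 `<=` W, saturated W0 &
      forall z, planar W z -> \forall w \near z^', ~ planar W0 w].
Proof.
move=> sW oW; have [I hI] := imunit_exists; split.
  move=> [sub [Z cZ W0E] sph iso].
  have s0 : saturated W0.
    by move=> x y xy W0x; apply: sph W0x _ _; apply/sphereP.
  split=> // z /(planarP _ sW hI) Wz.
  have [W0z|W0z] := pselect (W0 (slice_point z.1 z.2 I)); last first.
    have oZ : open (~` Z) by exact: closed_openC.
    have Zz : (~` Z) (slice_point z.1 z.2 I) by move=> Zz; apply: W0z; rewrite W0E.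
    have H := @slice_point_continuous I z _ (open_nbhs_nbhs (conj oZ Zz)).
    have {}H : \forall w \near z, (~` Z) (slice_point w.1 w.2 I) by [].
    apply: near_dnbhs; apply: filterS H => w /= h.
    by move=> /(planarP _ s0 hI); rewrite W0E => -[].
  have [U oU UE] := iso _ W0z.
  have Uz : U (slice_point z.1 z.2 I).
    suff: (U `&` W0) (slice_point z.1 z.2 I) by case.
    by rewrite UE; apply/sphereP.
  have H := @slice_point_continuous I z _ (open_nbhs_nbhs (conj oU Uz)).
  have {H} /near_dnbhs H : \forall w \near z, U (slice_point w.1 w.2 I) by [].
  have nz : \forall w \near z^', w != z by apply/dnbhs_ballP; exists 1.
  (* The sphere isolated by U meets the slice only in z and its conjugate, and both are avoided near
     [z^']. *)
  apply: filterS3 H nz (near_notconj z) => w Uw wz wzc /(planarP _ s0 hI) W0w.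
  have : (U `&` W0) (slice_point w.1 w.2 I) by [].
  rewrite UE => /sphereP /esym /(pr_eq hI hI)[] wE.
    by rewrite wE eqxx in wz.
  by rewrite wE eqxx in wzc.
move=> [sub s0 H]; split=> //.
(* A point of W in the closure belongs to W0: otherwise no planar singularity is near its
   projection, and continuity of the projection contradicts adherence. *)
- exists (closure W0); first exact: closed_closure.
  apply/seteqP; split=> x; first by move=> W0x; split; [exact: sub|exact: subset_closure].
  move=> [Wx cx]; apply: contrapT => W0x.
  have Wz : planar W (pr x) by apply/planar_pr.
  have H1 : \forall w \near pr x, ~ planar W0 w.
    by apply: near_of_dnbhs; [exact: H|rewrite planar_pr].
  have [y [W0y /= hy]] := cx _ (pr_continuous H1).
  by apply: hy; apply/planar_pr.
- by move=> y W0y x /sphereP xy; apply: s0 W0y.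
- move=> y W0y.
  have Wz : planar W (pr y) by apply/planar_pr => //; exact: sub.
  pose good w := planar W0 w -> w = pr y.
  have H1 : \forall w \near pr y, good w.
    by apply: near_of_dnbhs => //; apply: filterS (H _ Wz) => w h /h.
  exists (pr @^-1` [set z | \forall w \near z, good w]).
    by apply: preimage_pr_open; rewrite openE => u /= /near_join.
  apply/seteqP; split=> x; rewrite /preimage /=.
    by move=> [/nbhs_singleton h W0x]; apply/sphereP; apply: h; apply/planar_pr.
  move=> /sphereP xy; split; first by rewrite /= xy.
  by apply: s0 W0y.
Qed.

End Circular.

(** * Holomorphic and Nash vector-valued germs *)

Section Coordinatewise.
Variable R : realType.
Notation C := (R[i]%C).
Notation plane := (plane R).
Implicit Types (z w : plane) (f g : plane -> C).

(** The property is a parameter, so the same lemmas apply to holomorphy, to the Nash property and to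
    vanishing. *)
Fixpoint coordwise (Phi : (plane -> C) -> Prop) n : (plane -> cdt C n) -> Prop :=
  match n return (plane -> cdt C n) -> Prop with
  | 0 => fun F => Phi F
  | m.+1 => fun F => coordwise Phi (fun w => (F w).1) /\
                     coordwise Phi (fun w => (F w).2)
  end.

Lemma coordwise_impl (Phi Psi : (plane -> C) -> Prop) n (F : plane -> cdt C n) :
  (forall f, Phi f -> Psi f) -> coordwise Phi F -> coordwise Psi F.
Proof.
move=> PP; elim: n F => [|n IH] F /=; first exact: PP.
by move=> [? ?]; split; apply: IH.
Qed.

Lemma coordwise_near z (Phi : (plane -> C) -> Prop) n (F G : plane -> cdt C n) :
  (forall f g, (\forall w \near z, f w = g w) -> Phi f -> Phi g) ->
  (\forall w \near z, F w = G w) -> coordwise Phi F -> coordwise Phi G.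
Proof.
move=> PP; elim: n F G => [|n IH] F G /= FG; first exact: PP.
by move=> [h1 h2]; split; [apply: IH h1|apply: IH h2];
  apply: filterS FG => w ->.
Qed.

Lemma coordwise_and (Phi Psi : (plane -> C) -> Prop) n (F : plane -> cdt C n) :
  coordwise Phi F -> coordwise Psi F -> coordwise (fun f => Phi f /\ Psi f) F.
Proof.
elim: n F => [|n IH] F //=.
by move=> [? ?] [? ?]; split; apply: IH.
Qed.

Section Closure.
Variable Phi : (plane -> C) -> Prop.
Hypothesis PhiC : forall c, Phi (fun=> c).
Hypothesis PhiD : forall u v, Phi u -> Phi v -> Phi (fun w => u w + v w).
Hypothesis PhiM : forall u v, Phi u -> Phi v -> Phi (fun w => u w * v w).

Lemma coordwiseC n (t : cdt C n) : coordwise Phi (fun=> t).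
Proof. by elim: n t => [|n IH] t //=; exact: PhiC. Qed.

Lemma coordwiseD n (F G : plane -> cdt C n) : coordwise Phi F -> coordwise Phi G ->
  coordwise Phi (fun w => cdt_add (F w) (G w)).
Proof.
elim: n F G => [|n IH] F G /=; first exact: PhiD.
by move=> [? ?] [? ?]; split; apply: IH.
Qed.

Lemma coordwiseZ n (a : plane -> C) (F : plane -> cdt C n) :
  Phi a -> coordwise Phi F -> coordwise Phi (fun w => cdt_scale (a w) (F w)).
Proof.
move=> Pa; elim: n F => [|n IH] F /=; first exact: PhiM.
by move=> [? ?]; split; apply: IH.
Qed.

Lemma coordwise_conj n (F : plane -> cdt C n) :
  coordwise Phi F -> coordwise Phi (fun w => cdt_conj (F w)).
Proof.
elim: n F => [|n IH] F //= [? ?]; split; first exact: IH.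
exact: (@coordwiseZ n (fun=> -1)).
Qed.

Lemma coordwiseM n (F G : plane -> cdt C n) : coordwise Phi F -> coordwise Phi G ->
  coordwise Phi (fun w => cdt_mul (F w) (G w)).
Proof.
elim: n F G => [|n IH] F G /=; first exact: PhiM.
move=> [F1 F2] [G1 G2]; split; apply: coordwiseD; try exact: IH.
- apply: (@coordwiseZ n (fun=> -1)) => //.
  by apply: IH => //; exact: coordwise_conj.
- by apply: IH => //; exact: coordwise_conj.
Qed.

Lemma coordwise_norm n (F : plane -> cdt C n) :
  coordwise Phi F -> Phi (fun w => cdt_norm (F w)).
Proof.
elim: n F => [|n IH] F /=; first by move=> ?; exact: PhiM.
by move=> [? ?]; apply: PhiD; apply: IH.
Qed.

End Closure.

Definition holT z n (F : plane -> cdt C n) := coordwise (holg z) F.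
Definition nashT z n (F : plane -> cdt C n) := coordwise (nashg z) F.

Lemma holT_near z n (F G : plane -> cdt C n) :
  (\forall w \near z, F w = G w) -> holT z F -> holT z G.
Proof. by apply: coordwise_near => f g; exact: holg_near. Qed.

Lemma nashT_near z n (F G : plane -> cdt C n) :
  (\forall w \near z, F w = G w) -> nashT z F -> nashT z G.
Proof. by apply: coordwise_near => f g; exact: nashg_near. Qed.

Lemma nashT_holT z n (F : plane -> cdt C n) : nashT z F -> holT z F.
Proof. by apply: coordwise_impl => f []. Qed.

Lemma holT_join z n (F : plane -> cdt C n) : holT z F -> \forall w \near z, holT w F.
Proof.
rewrite /holT; elim: n F => [|n IH] F /=; first exact: holg_join.
by move=> [/IH h1 /IH h2]; exact: filterI.
Qed.

Lemma is_derive_pair (U V : normedModType R) z (v : plane) (f : plane -> (U * V)%type)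
    (l : (U * V)%type) :
  is_derive z v f l <->
  is_derive z v (fun w => (f w).1) l.1 /\ is_derive z v (fun w => (f w).2) l.2.
Proof.
pose q (W : normedModType R) (g : plane -> W) (h : R) := h^-1 *: (g (h *: v + z) - g z).
have qE : q _ f = fun h => (q _ (fun w => (f w).1) h, q _ (fun w => (f w).2) h) by [].
have cvgq (W : normedModType R) (g : plane -> W) a :
    is_derive z v g a <-> q _ g @ (0 : R)^' --> a.
  split; last exact: is_derive_cvg.
  by move=> [dg <-]; exact: dg.
rewrite !cvgq qE; split=> [h|[h1 h2]]; last by case: l h1 h2 => a b /= h1 h2; exact: cvg_pair.
split.
  by apply: (@cvg_comp _ _ _ _ fst _ _ _ h); exact: fst_continuous.
by apply: (@cvg_comp _ _ _ _ snd _ _ _ h); exact: snd_continuous.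
Qed.

Lemma cvg_near_eq (W : normedModType R) z (f g : plane -> W) (l : W) :
  (\forall w \near z, f w = g w) -> f @ z --> l -> g @ z --> l.
Proof. by move=> fg fl; apply: cvg_trans fl; exact: near_eq_cvg. Qed.

Lemma cvg_pair_comp (U V : normedModType R) z (f : plane -> U) (g : plane -> V) l m :
  f @ z --> l -> g @ z --> m ->
  (fun w => (f w, g w) : (U * V)%type) @ z --> ((l, m) : (U * V)%type).
Proof. exact: cvg_pair. Qed.

Lemma cvg_fst_comp (U V : normedModType R) z (p : plane -> (U * V)%type) (l : (U * V)%type) :
  p @ z --> l -> (fun w => (p w).1) @ z --> l.1.
Proof. by move=> cp; apply: (@cvg_comp _ _ _ _ fst _ _ _ cp); exact: fst_continuous. Qed.

Lemma cvg_snd_comp (U V : normedModType R) z (p : plane -> (U * V)%type) (l : (U * V)%type) :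
  p @ z --> l -> (fun w => (p w).2) @ z --> l.2.
Proof. by move=> cp; apply: (@cvg_comp _ _ _ _ snd _ _ _ cp); exact: snd_continuous. Qed.

(** The pair (- p.2, p.1) is iota p: this is the Cauchy-Riemann equation solved for the second
    partial derivative. *)
Definition has_vderiv (V : normedModType R) z (F : plane -> (V * V)%type) (p : (V * V)%type) :=
  is_derive z (dir_re R) F p /\ is_derive z (dir_im R) F (- p.2, p.1).

Definition holV (V : normedModType R) z (F : plane -> (V * V)%type) :=
  exists p : plane -> (V * V)%type,
    \forall w \near z, has_vderiv w F (p w) /\ p @ w --> p w.

(** The witness is the derivative along 1, the equation dictates the derivative along iota, and
    openness of D turns conditions at points into conditions near points. *)
Lemma holomorphicP (V : normedModType R) (D : set plane) (F : plane -> (V * V)%type) :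
  open D -> holomorphic D F <-> forall z, D z -> holV z F.
Proof.
move=> oD; split=> [H z Dz|H e1' e2' z Dz].
  exists (fun w => 'D_(dir_re R) F w).
  have nD : \forall w \near z, D w by exact: open_nbhs_nbhs.
  apply: filterS nD => w Dw; have [d1 d2 c1 c2 cr] := H w Dw.
  split; last exact: c1.
  split; first exact: (DeriveDef d1 erefl).
  apply: (DeriveDef d2).
  have := congr1 fst cr; have := congr1 snd cr; rewrite /=.
  set d := 'D_ _ _ _; set d' := 'D_ _ _ _ => h2 h1.
  rewrite [LHS](_ : _ = (d'.1, d'.2)); last by case: (d').
  apply/pair_equal_spec; split; apply/eqP.
    by rewrite -addr_eq0 addrC h2.
  by rewrite eq_sym -subr_eq0 h1.
have [p Hp] := H z Dz; have [[d1 d2] cp] := nbhs_singleton Hp.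
have e1 : \forall w \near z, p w = 'D_(dir_re R) F w.
  by apply: filterS Hp => w [[[_ ->]]].
have e2 : \forall w \near z, (- (p w).2, (p w).1) = 'D_(dir_im R) F w.
  by apply: filterS Hp => w [[_ [_ ->]]].
split.
- by case: d1.
- by case: d2.
- suff h : (fun w => 'D_(dir_re R) F w) @ z --> 'D_(dir_re R) F z by exact: h.
  by rewrite -(nbhs_singleton e1); exact: cvg_near_eq e1 cp.
- suff h : (fun w => 'D_(dir_im R) F w) @ z --> 'D_(dir_im R) F z by exact: h.
  rewrite -(nbhs_singleton e2).
  have c1 := cvg_fst_comp cp; have c2 := cvg_snd_comp cp.
  have c3 : (fun w => (- (p w).2, (p w).1) : (V * V)%type) @ z -->
    ((- (p z).2, (p z).1) : (V * V)%type) by apply: cvg_pair => //; exact: cvgN.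
  exact: cvg_near_eq e2 c3.
- rewrite -[e1']/(dir_re R) -[e2']/(dir_im R) -(nbhs_singleton e1) -(nbhs_singleton e2) /=.
  by apply/pair_equal_spec; split=> /=; rewrite ?subrr ?addNr.
Qed.

(** Complexification commutes with doubling up to this regrouping of coordinates, which is the
    inductive step down to scalar functions. *)
Lemma holV_pair (U : normedModType R) z (F : plane -> ((U * U) * (U * U))%type) :
  holV (V := (U * U)%type : normedModType R) z F <->
  holV z (fun w => ((F w).1.1, (F w).2.1)) /\ holV z (fun w => ((F w).1.2, (F w).2.2)).
Proof.
split.
  move=> [p Hp]; split.
    exists (fun w => ((p w).1.1, (p w).2.1)).
    apply: filterS Hp => w [[/is_derive_pair[/= /is_derive_pair[a1 a2] /is_derive_pair[a3 a4]]]].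
    move=> /is_derive_pair[/= /is_derive_pair[b1 b2] /is_derive_pair[b3 b4]] cp.
    split; first by split; apply/is_derive_pair.
    by apply: cvg_pair; [exact: cvg_fst_comp (cvg_fst_comp cp)
                        |exact: cvg_fst_comp (cvg_snd_comp cp)].
  exists (fun w => ((p w).1.2, (p w).2.2)).
  apply: filterS Hp => w [[/is_derive_pair[/= /is_derive_pair[a1 a2] /is_derive_pair[a3 a4]]]].
  move=> /is_derive_pair[/= /is_derive_pair[b1 b2] /is_derive_pair[b3 b4]] cp.
  split; first by split; apply/is_derive_pair.
  by apply: cvg_pair; [exact: cvg_snd_comp (cvg_fst_comp cp)
                      |exact: cvg_snd_comp (cvg_snd_comp cp)].
move=> [[p Hp] [q Hq]].
exists (fun w => (((p w).1, (q w).1), ((p w).2, (q w).2))).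
apply: filterS2 Hp Hq => w.
move=> [[/is_derive_pair[/= a1 a2] /is_derive_pair[/= a3 a4]] cp].
move=> [[/is_derive_pair[/= b1 b2] /is_derive_pair[/= b3 b4]] cq].
split; last first.
  have c1 : (fun u => ((p u).1, (q u).1) : (U * U)%type) @ w -->
      (((p w).1, (q w).1) : (U * U)%type).
    by apply: cvg_pair; [exact: cvg_fst_comp cp|exact: cvg_fst_comp cq].
  have c2 : (fun u => ((p u).2, (q u).2) : (U * U)%type) @ w -->
      (((p w).2, (q w).2) : (U * U)%type).
    by apply: cvg_pair; [exact: cvg_snd_comp cp|exact: cvg_snd_comp cq].
  exact: cvg_pair c1 c2.
by split; apply/is_derive_pair; split; apply/is_derive_pair.
Qed.

Lemma holV_holg z (F : plane -> (R^o * R^o)%type) :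
  holV (V := R^o) z F <-> holg z (fun w => Complex (F w).1 (F w).2).
Proof.
split=> [[p Hp]|[p Hp]].
  exists (fun w => Complex (p w).1 (p w).2); apply: filterS Hp => w.
  move=> [[/is_derive_pair[/= a1 a2] /is_derive_pair[/= b1 b2]] cp]; split=> //.
  by split=> /=; [exact: cvg_fst_comp cp|exact: cvg_snd_comp cp].
exists (fun w => (complex.Re (p w), complex.Im (p w))); apply: filterS Hp => w.
move=> [[a1 a2 a3 a4] [c1 c2]]; split; last first.
  have c : (fun u => (complex.Re (p u), complex.Im (p u)) : (R^o * R^o)%type) @ w -->
      ((complex.Re (p w), complex.Im (p w)) : (R^o * R^o)%type).
    exact: cvg_pair_comp c1 c2.
  exact: c.
by split; apply/is_derive_pair.
Qed.

Lemma holV_holT n z (F : plane -> (CD R n * CD R n)%type) :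
  holV z F <-> holT z (fun w => cdc (F w).1 (F w).2).
Proof.
elim: n F => [|n IH] F; first exact: holV_holg.
have H := @holV_pair (CD R n) z F; split=> [/H.1[/IH h1 /IH h2]|[h1 h2]].
  by split.
by apply: H.2; split; apply/IH.
Qed.

Lemma complex_nashP (D : set plane) (g : plane -> plane) : open D ->
  complex_nash D g <-> forall z, D z -> nashg z (fun w => toC (g w)).
Proof.
move=> oD; split=> H z Dz.
  have [U [oU Uz UD hU [P P0 HP]]] := H z Dz.
  have nU : \forall w \near z, U w by exact: open_nbhs_nbhs.
  split; last by exists P => //; apply: filterS nU.
  by apply/holV_holg; apply: (holomorphicP _ oU).1 Uz.
have [hg [P P0 HP]] := H z Dz.
exists (D `&` [set w | \forall u \near w, eval2 P (toC u) (toC (g u)) = 0]).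
have oU : open [set w : plane | \forall u \near w, eval2 P (toC u) (toC (g u)) = 0].
  by rewrite openE => w /= /near_join.
split=> //.
- exact: openI.
- apply/(holomorphicP _ (openI oD oU)) => w [Dw _].
  by apply/holV_holg; case: (H w Dw).
- by exists P => // w [_ /nbhs_singleton].
Qed.

End Coordinatewise.

(** * Stems and slice functions *)

Section TensorBar.
Variable R : realType.
Notation C := (R[i]%C).
Local Notation "x +' y" := (cdt_add x y) (at level 50, left associativity).
Local Notation "x *' y" := (cdt_mul x y) (at level 40, left associativity).
Local Notation "a *:' x" := (cdt_scale a x) (at level 40).

Lemma conjcD (x y : C) : conjc (x + y) = conjc x + conjc y.
Proof. by case: x => a b; case: y => c d; rewrite /= opprD. Qed.

Lemma conjcM (x y : C) : conjc (x * y) = conjc x * conjc y.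
Proof.
case: x => a b; case: y => c d; apply/eqP; rewrite eq_complex /=.
by apply/andP; split; apply/eqP; ring.
Qed.

Lemma conjcN1 : conjc (-1 : C) = -1.
Proof. by rewrite /= oppr0. Qed.

(** Conjugation in the factor C of the tensor product. Unlike [cdt_conj] it preserves the order of
    factors. *)
Fixpoint cdt_bar n : cdt C n -> cdt C n :=
  match n return cdt C n -> cdt C n with
  | 0 => fun x => conjc x
  | m.+1 => fun x => (cdt_bar x.1, cdt_bar x.2)
  end.

Lemma cdt_barD n (t u : cdt C n) : cdt_bar (t +' u) = cdt_bar t +' cdt_bar u.
Proof. by elim: n t u => [|n IH] t u /=; [exact: conjcD|rewrite !IH]. Qed.

Lemma cdt_barZ n c (t : cdt C n) : cdt_bar (c *:' t) = conjc c *:' cdt_bar t.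
Proof. by elim: n t => [|n IH] t /=; [exact: conjcM|rewrite !IH]. Qed.

Lemma cdt_bar_conj n (t : cdt C n) : cdt_bar (cdt_conj t) = cdt_conj (cdt_bar t).
Proof. by elim: n t => [|n IH] t //=; rewrite IH cdt_barZ conjcN1. Qed.

Lemma cdt_barM n (t u : cdt C n) : cdt_bar (t *' u) = cdt_bar t *' cdt_bar u.
Proof.
elim: n t u => [|n IH] t u /=; first exact: conjcM.
by rewrite !cdt_barD cdt_barZ conjcN1 !IH !cdt_bar_conj.
Qed.

Lemma cdt_bar_norm n (t : cdt C n) : cdt_norm (cdt_bar t) = conjc (cdt_norm t).
Proof. by elim: n t => [|n IH] t /=; [rewrite conjcM|rewrite !IH conjcD]. Qed.

Lemma cdc_re_bar n (t : cdt C n) : cdc_re (cdt_bar t) = cdc_re t.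
Proof. by elim: n t => [|n IH] t /=; [case: t|rewrite !IH]. Qed.

Lemma cdc_im_bar n (t : cdt C n) : cdc_im (cdt_bar t) = - cdc_im t.
Proof. by elim: n t => [|n IH] t /=; [case: t|rewrite !IH]. Qed.

Lemma cdc_inj n (t u : cdt C n) : cdc_re t = cdc_re u -> cdc_im t = cdc_im u -> t = u.
Proof. by move=> h1 h2; rewrite -[t]cdcK -[u]cdcK h1 h2. Qed.

Lemma cdc_re0 n : cdc_re (cdt_zero C n) = 0.
Proof. by elim: n => [|n IH] //=; rewrite IH. Qed.

Lemma cdc_im0 n : cdc_im (cdt_zero C n) = 0.
Proof. by elim: n => [|n IH] //=; rewrite IH. Qed.

Lemma cdc_re1 n : cdc_re (cdt_one C n) = cdone R n.
Proof. by elim: n => [|n IH] //=; rewrite IH cdc_re0. Qed.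

Lemma cdc_im1 n : cdc_im (cdt_one C n) = 0.
Proof. by elim: n => [|n IH] //=; rewrite IH cdc_im0. Qed.

End TensorBar.

Section SliceFunctions.
Variables (R : realType) (K : algebra_kind).
Notation C := (R[i]%C).
Notation A := (alg R K).
Notation plane := (plane R).
Notation n := (cdlevel K).
Notation T := (cdt C n).
Notation pr := (@half_plane_proj R K).
Implicit Types (x y : A) (z w : plane) (W : set A) (I J : A) (D : set plane).
Implicit Types (F G : plane -> T) (f g : A -> A).

Lemma addrr_inj (V : lmodType R) (x y : V) : x + x = y + y -> x = y.
Proof.
have half (v : V) : v = 2^-1 *: (v + v).
  by rewrite scalerDr -scalerDl -[LHS]scale1r; congr (_ *: _); lra.
by move=> h; rewrite (half x) (half y) h.
Qed.

(** Replaces iota by I. This is linear over C acting by left multiplication through C_I ([evZ]), but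
    in general not multiplicative, because I need not commute with the coefficients. *)
Definition ev I (t : T) : A := (cdc_re t : CD R n) + cdmul (I : CD R n) (cdc_im t).

Lemma evD I (t u : T) : ev I (cdt_add t u) = ev I t + ev I u.
Proof.
rewrite /ev cdc_reD cdc_imD cdmulDr.
exact: (@addrACA (CD R n)).
Qed.

Lemma ev_conjI I (t : T) : imunit I -> ev (- I) (cdt_bar t) = ev I t.
Proof.
by move=> hI; rewrite /ev cdc_re_bar cdc_im_bar [X in _ + X]cdmulNl cdmulNr opprK.
Qed.

Lemma evZ I (c : C) (t : T) : imunit I ->
  ev I (cdt_scale c t) = alg_mul (slice_point (complex.Re c) (complex.Im c) I) (ev I t).
Proof.
move=> hI; rewrite /ev /alg_mul /slice_point cdc_reZ cdc_imZ.
have h : cdmul (complex.Re c *: cdone R n + complex.Im c *: (I : CD R n))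
    (cdc_re t + cdmul (I : CD R n) (cdc_im t)) =
    (complex.Re c *: cdc_re t - complex.Im c *: cdc_im t) +
    cdmul (I : CD R n) (complex.Re c *: cdc_im t + complex.Im c *: cdc_re t).
  rewrite cdmulDl !cdmulZl cdmul1l !cdmulDr (cdmul_imunitK _ (level_le3 K) hI).
  rewrite !cdmulZr !scalerDr scalerN -!addrA; congr (_ + _).
  by rewrite addrC -addrA addrC -addrA; congr (_ + _); rewrite addrC.
exact: esym h.
Qed.

(** The values at I and -I suffice: their sum isolates the real part, and left multiplication by I
    is injective on the rest. *)
Lemma ev_inj (t u : T) : (forall I, imunit I -> ev I t = ev I u) -> t = u.
Proof.
move=> H; have [I hI] := @imunit_exists R K.
have h1 := H I hI; have h2 := H (- I) (imunit_opp hI).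
have {}h2 : cdc_re t - cdmul (I : CD R n) (cdc_im t) =
    cdc_re u - cdmul (I : CD R n) (cdc_im u) by rewrite -!cdmulNl; exact: h2.
have {}h1 : cdc_re t + cdmul (I : CD R n) (cdc_im t) =
    cdc_re u + cdmul (I : CD R n) (cdc_im u) by exact: h1.
have e1 : cdc_re t = cdc_re u.
  have := congr2 +%R h1 h2; rewrite addrACA subrr addr0 addrACA subrr addr0.
  exact: addrr_inj.
apply: cdc_inj => //; move: h1; rewrite e1 => /addrI.
move=> /(congr1 (fun v => cdmul (I : CD R n) v)).
by rewrite !(cdmul_imunitK _ (level_le3 K) hI) => /oppr_inj.
Qed.

Definition stem D F := forall z, D z -> F (planeconj z) = cdt_bar (F z).

Definition represents D F f :=
  forall z I, D z -> imunit I -> f (slice_point z.1 z.2 I) = ev I (F z).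

Lemma represents_uniq D F G f g : (forall z I, D z -> imunit I ->
    f (slice_point z.1 z.2 I) = g (slice_point z.1 z.2 I)) ->
  represents D F f -> represents D G g -> forall z, D z -> F z = G z.
Proof.
move=> fg HF HG z Dz; apply: ev_inj => I hI.
by rewrite -(HF z I Dz hI) -(HG z I Dz hI) fg.
Qed.

Lemma slice_point_inj0 (b : R) I J (a : R) : b != 0 ->
  slice_point a b I = slice_point a b J -> I = J.
Proof.
move=> b0 /addrI /(congr1 (fun v : A => b^-1 *: v)).
by rewrite !scalerA mulVf // !scale1r.
Qed.

(** Every x is written with non-negative second coordinate and a chosen unit. The stem condition
    handles presentations with negative second coordinate, and at real points it kills the iota
    part, so that the choice of unit has no effect. *)
Lemma represents_exists D F : conj_invariant D -> stem D F ->
  exists f, represents D F f.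
Proof.
move=> cD sF.
have P x : exists I, imunit I /\ x = slice_point (pr x).1 (pr x).2 I.
  by have [I hI xE] := slice_point_pr x; exists I.
pose unit_of x := projT1 (cid (P x)).
have unitP x : imunit (unit_of x) by have [] := projT2 (cid (P x)).
have unitE x : x = slice_point (pr x).1 (pr x).2 (unit_of x).
  by have [] := projT2 (cid (P x)).
exists (fun x => ev (unit_of x) (F (pr x))) => z I Dz hI.
set x := slice_point _ _ _; have prE := pr_slice_point z.1 z.2 hI.
have xE := unitE x; have uI := unitP x.
move: xE uI; rewrite prE; move: (unit_of x) => J; rewrite /x /= => xE hJ.
have [b0|b0|b0] := ltgtP z.2 0.
- have -> : ((z.1, `|z.2|) : plane) = planeconj z by rewrite ltr0_norm.
  rewrite sF // -[RHS]ev_conjI //; congr ev.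
  move: xE; rewrite ltr0_norm // slice_point_oppI => /slice_point_inj0.
  by rewrite lt_eqF // => /(_ isT) ->; rewrite opprK.
- move: xE; rewrite gtr0_norm // => /slice_point_inj0; rewrite gt_eqF // => /(_ isT) <-.
  by congr (ev _ (F _)); case: (z).
- have zz : planeconj z = z by case: (z) b0 => a b /= ->; rewrite /planeconj /= oppr0.
  have -> : ((z.1, `|z.2|) : plane) = z by rewrite b0 normr0 -b0; case: (z).
  have := sF z Dz; rewrite zz => /(congr1 (@cdc_im R n)); rewrite cdc_im_bar.
  move=> h; have i0 : cdc_im (F z) = 0.
    have h2 : cdc_im (F z) + cdc_im (F z) = 0 by rewrite {1}h addNr.
    by apply: addrr_inj; rewrite addr0.
  by rewrite /ev i0 !cdmul0r.
Qed.

Definition enc (F : plane -> (A * A)%type) : plane -> T :=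
  fun z => cdc ((F z).1 : CD R n) (F z).2.
Definition dec F : plane -> (A * A)%type := fun z => (cdc_re (F z) : A, cdc_im (F z) : A).

Lemma enc_dec F : enc (dec F) = F.
Proof. by apply/funext => z; rewrite /enc /= cdcK. Qed.

Lemma stem_functionP D (F : plane -> (A * A)%type) :
  stem_function D F <-> [/\ open D, conj_invariant D & stem D (enc F)].
Proof.
split=> -[oD cD sF]; split=> // z Dz.
  by apply: cdc_inj; rewrite ?cdc_re_bar ?cdc_im_bar /enc sF // ?cdc_reK ?cdc_imK.
have := sF z Dz; rewrite /enc => h.
have /= := congr1 (@cdc_re R n) h; have /= := congr1 (@cdc_im R n) h.
rewrite cdc_re_bar cdc_im_bar !cdc_reK !cdc_imK.
by case: (F (planeconj z)) => a b /= -> ->.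
Qed.

Lemma inducesP D (F : plane -> (A * A)%type) f : induces D F f <-> represents D (enc F) f.
Proof.
by split=> H z I Dz hI; rewrite (H z I Dz hI) /ev /enc cdc_reK cdc_imK.
Qed.

Lemma stem_ofP D F f : open D -> conj_invariant D -> stem D F -> represents D F f ->
  forall z, D z -> enc (stem_of D f) z = F z.
Proof.
move=> oD cD sF rF.
have [] : stem_function D (stem_of D f) /\ induces D (stem_of D f) f.
  apply: (@xgetPex _ _ [set G | stem_function D G /\ induces D G f]).
  exists (dec F); split; first by apply/stem_functionP; rewrite enc_dec.
  by apply/inducesP; rewrite enc_dec.
by move=> _ /inducesP h; apply: represents_uniq h rF.
Qed.

Lemma slice_ofP D F : conj_invariant D -> stem D F -> represents D F (slice_of D (dec F)).
Proof.
move=> cD sF; rewrite -{1}[F]enc_dec; apply/inducesP.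
apply: (@xgetPex _ _ [set f | induces D (dec F) f]).
have [f Hf] := represents_exists cD sF; exists f.
by apply/inducesP; rewrite enc_dec.
Qed.

(** Agreement is required on D alone, because the stems produced by [stem_of] are unspecified
    elsewhere. *)
Lemma slice_of_ext D (F : plane -> (A * A)%type) G : conj_invariant D -> stem D G ->
  (forall z, D z -> enc F z = G z) -> represents D G (slice_of D F).
Proof.
move=> cD sG FG.
have h : represents D (enc F) (slice_of D F).
  apply/inducesP; apply: (@xgetPex _ _ [set f | induces D F f]).
  have [f Hf] := represents_exists cD sG; exists f.
  by apply/inducesP => z I Dz hI; rewrite Hf // FG.
by move=> z I Dz hI; rewrite h // FG.
Qed.

Lemma slice_regularP W f : saturated W -> open W ->
  slice_regular W f <-> exists F, [/\ stem (planar W) F, represents (planar W) F f &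
    forall z, planar W z -> holT z F].
Proof.
move=> sW oW; have oD := planar_open sW oW.
have cD : conj_invariant (planar W) by move=> z; exact: planar_conj.
split=> [[F [/stem_functionP[_ _ sF] /inducesP iF hF]]|[F [sF rF hF]]].
  exists (enc F); split=> // z Dz; apply/holV_holT.
  exact: (holomorphicP F oD).1.
exists (dec F); split.
- by apply/stem_functionP; rewrite enc_dec.
- by apply/inducesP; rewrite enc_dec.
- apply/(holomorphicP _ oD) => z Dz; apply/holV_holT.
  by have := hF z Dz; rewrite -{1}[F]enc_dec.
Qed.

Lemma slice_mulP W F G f g : saturated W -> open W ->
  stem (planar W) F -> stem (planar W) G ->
  represents (planar W) F f -> represents (planar W) G g ->
  represents (planar W) (fun z => cdt_mul (F z) (G z)) (slice_mul W f g).
Proof.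
move=> sW oW sF sG rF rG; have oD := planar_open sW oW.
have cD : conj_invariant (planar W) by move=> z; exact: planar_conj.
apply: slice_of_ext => //.
  by move=> z Dz; rewrite sF // sG // cdt_barM.
move=> z Dz; rewrite -(stem_ofP oD cD sF rF Dz) -(stem_ofP oD cD sG rG Dz).
apply: cdc_inj; rewrite ?(proj1 (cdc_reM_imM _ _)) ?(proj2 (cdc_reM_imM _ _)).
  by rewrite /enc !cdc_reK !cdc_imK.
by rewrite /enc !cdc_reK !cdc_imK.
Qed.

Lemma slice_conjP W F f : saturated W -> open W ->
  stem (planar W) F -> represents (planar W) F f ->
  represents (planar W) (fun z => cdt_conj (F z)) (slice_conj W f).
Proof.
move=> sW oW sF rF; have oD := planar_open sW oW.
have cD : conj_invariant (planar W) by move=> z; exact: planar_conj.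
apply: slice_of_ext => //.
  by move=> z Dz; rewrite sF // cdt_bar_conj.
move=> z Dz; rewrite -(stem_ofP oD cD sF rF Dz).
by apply: cdc_inj; rewrite ?cdc_re_conj ?cdc_im_conj /enc ?cdc_reK ?cdc_imK.
Qed.

End SliceFunctions.

(** * Splitting bases and stem-Nash functions *)

Section StemNash.
Variable R : realType.
Notation C := (R[i]%C).
Notation plane := (plane R).

Lemma coordwise_sum (Phi : (plane -> C) -> Prop) n (I : Type) (r : seq I)
    (F : I -> plane -> cdt C n) :
  (forall c, Phi (fun=> c)) ->
  (forall u v, Phi u -> Phi v -> Phi (fun w => u w + v w)) ->
  (forall i, coordwise Phi (F i)) ->
  coordwise Phi (fun w => \big[@cdt_add C n/cdt_zero C n]_(i <- r) F i w).
Proof.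
move=> PC PD H; elim: r => [|i r IH].
  by under [fun w => _]eq_fun do rewrite big_nil; exact: coordwiseC.
by under [fun w => _]eq_fun do rewrite big_cons; exact: coordwiseD.
Qed.

Lemma cdc_re_sum n (I : Type) (r : seq I) (F : I -> cdt C n) :
  cdc_re (\big[@cdt_add C n/cdt_zero C n]_(i <- r) F i) = \sum_(i <- r) cdc_re (F i).
Proof. by apply: big_morph; [exact: cdc_reD|exact: cdc_re0]. Qed.

Lemma cdc_im_sum n (I : Type) (r : seq I) (F : I -> cdt C n) :
  cdc_im (\big[@cdt_add C n/cdt_zero C n]_(i <- r) F i) = \sum_(i <- r) cdc_im (F i).
Proof. by apply: big_morph; [exact: cdc_imD|exact: cdc_im0]. Qed.

Section Base.
Variable K : algebra_kind.
Notation A := (alg R K).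
Notation n := (cdlevel K).

Lemma splitting_coordP (I : A) (J : 'I_(alg_u K).+1 -> A) (x : A) :
  splitting_base I J -> x = lincomb I J (splitting_coord I J x).
Proof.
move=> [_ H]; have [c [xc _]] := H x.
exact: (@xgetI _ _ [set c | x = lincomb I J c] c xc).
Qed.

Lemma splitting_coord_uniq (I : A) (J : 'I_(alg_u K).+1 -> A) (x : A) c :
  splitting_base I J -> x = lincomb I J c -> splitting_coord I J x = c.
Proof.
move=> sb xc; have [_ /(_ x)[d [xd du]]] := sb.
by rewrite -(du c xc); apply/esym/du; exact: splitting_coordP.
Qed.

(** The stem is the sum of the constant vectors [J k] and I [J k] with Nash coefficients, so its
    standard coordinates are Nash for whichever splitting base was given. *)
Lemma nash_coords_nashT z (I : A) (J : 'I_(alg_u K).+1 -> A)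
    (F : plane -> (A * A)%type) : splitting_base I J ->
  (forall k, nashg z (fun w => toC ((splitting_coord I J (F w).1 k).1,
                                    (splitting_coord I J (F w).2 k).1)) /\
             nashg z (fun w => toC ((splitting_coord I J (F w).1 k).2,
                                    (splitting_coord I J (F w).2 k).2))) ->
  nashT z (enc F).
Proof.
move=> sb H.
pose real (x : A) : cdt C n := cdc (x : CD R n) 0.
pose a k w := toC ((splitting_coord I J (F w).1 k).1, (splitting_coord I J (F w).2 k).1).
pose b k w := toC ((splitting_coord I J (F w).1 k).2, (splitting_coord I J (F w).2 k).2).
have -> : enc F = fun w => \big[@cdt_add C n/cdt_zero C n]_(k <- index_enum _)
    cdt_add (cdt_scale (a k w) (real (J k))) (cdt_scale (b k w) (real (alg_mul I (J k)))).
  apply/funext => w; apply: cdc_inj; rewrite /enc ?cdc_reK ?cdc_imK.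
    rewrite cdc_re_sum {1}(splitting_coordP (F w).1 sb) /lincomb.
    apply: eq_bigr => k _.
    rewrite cdc_reD !cdc_reZ !cdc_reK !cdc_imK !scaler0 !subr0 /=.
    rewrite /alg_mul /slice_point [LHS]cdmulDl; congr (_ + _).
      by rewrite [LHS]cdmulZl cdmul1l.
    by rewrite [LHS]cdmulZl.
  rewrite cdc_im_sum {1}(splitting_coordP (F w).2 sb) /lincomb.
  apply: eq_bigr => k _.
  rewrite cdc_imD !cdc_imZ !cdc_reK !cdc_imK !scaler0 !add0r /=.
  rewrite /alg_mul /slice_point [LHS]cdmulDl; congr (_ + _).
    by rewrite [LHS]cdmulZl cdmul1l.
  by rewrite [LHS]cdmulZl.
have nC := nashgC z; have nD := @nashgD R z; have nM := @nashgM R z.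
apply: coordwise_sum => // k.
have [h1 h2] := H k.
apply: coordwiseD => //; apply: coordwiseZ => //; exact: coordwiseC.
Qed.

End Base.

Definition quat_unit : alg R quaternions := (((0 : R, 1 : R), (0 : R, 0 : R)) : CD R 2).
Definition quat_base (k : 'I_2) : alg R quaternions :=
  if val k == 0%N then alg_one R quaternions
  else (((0 : R, 0 : R), (1 : R, 0 : R)) : CD R 2).

Lemma quat_lincomb (c : 'I_2 -> plane) : lincomb (K := quaternions) quat_unit quat_base c =
  ((((c ord0).1, (c ord0).2), ((c ord_max).1, (c ord_max).2)) : CD R 2).
Proof.
rewrite /lincomb !big_ord_recl big_ord0 /=.
have -> : lift ord0 ord0 = ord_max :> 'I_2 by apply: val_inj.
apply: (@cdr_inj R 2); rewrite addr0 [LHS]cdrD !cdrM !cdrD !cdrZ /=.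
move: (c ord0) (c ord_max) => [a b] [a' b'] /=.
by congr ((_, _), (_, _)); ring.
Qed.

Lemma quat_splitting : splitting_base (K := quaternions) quat_unit quat_base.
Proof.
split=> // x.
exists (fun k : 'I_2 => if val k == 0%N then (x : CD R 2).1 : plane else (x : CD R 2).2 : plane).
split; first by rewrite quat_lincomb /=; case: x => [[? ?] [? ?]].
move=> c ->; rewrite quat_lincomb; apply/funext => -[[|[|//]] i] /=.
  by rewrite -surjective_pairing; congr c; apply: val_inj.
by rewrite -surjective_pairing; congr c; apply: val_inj.
Qed.

Definition octonion (a b c d e f g h : R) : CD R 3 :=
  (((a, b), (c, d)), ((e, f), (g, h))).

Definition oct_unit : alg R octonions := octonion 0 1 0 0 0 0 0 0.
Definition oct_base (k : 'I_4) : alg R octonions :=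
  if val k == 0%N then alg_one R octonions
  else if val k == 1%N then octonion 0 0 1 0 0 0 0 0
  else if val k == 2%N then octonion 0 0 0 0 1 0 0 0
  else octonion 0 0 0 0 0 0 1 0.

Lemma oct_term0 (a b : R) :
  cdmul (a *: cdone R 3 + b *: (oct_unit : CD R 3)) (octonion 1 0 0 0 0 0 0 0) =
  octonion a b 0 0 0 0 0 0.
Proof.
apply: (@cdr_inj R 3); rewrite cdrM cdrD !cdrZ /=.
by congr (((_, _), (_, _)), ((_, _), (_, _))); ring.
Qed.

Lemma oct_term1 (a b : R) :
  cdmul (a *: cdone R 3 + b *: (oct_unit : CD R 3)) (octonion 0 0 1 0 0 0 0 0) =
  octonion 0 0 a b 0 0 0 0.
Proof.
apply: (@cdr_inj R 3); rewrite cdrM cdrD !cdrZ /=.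
by congr (((_, _), (_, _)), ((_, _), (_, _))); ring.
Qed.

Lemma oct_term2 (a b : R) :
  cdmul (a *: cdone R 3 + b *: (oct_unit : CD R 3)) (octonion 0 0 0 0 1 0 0 0) =
  octonion 0 0 0 0 a b 0 0.
Proof.
apply: (@cdr_inj R 3); rewrite cdrM cdrD !cdrZ /=.
by congr (((_, _), (_, _)), ((_, _), (_, _))); ring.
Qed.

(** The sign is forced by the doubling formula: left multiplication by [oct_unit] sends the seventh
    basis vector to minus the eighth. *)
Lemma oct_term3 (a b : R) :
  cdmul (a *: cdone R 3 + b *: (oct_unit : CD R 3)) (octonion 0 0 0 0 0 0 1 0) =
  octonion 0 0 0 0 0 0 a (- b).
Proof.
apply: (@cdr_inj R 3); rewrite cdrM cdrD !cdrZ /=.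
by congr (((_, _), (_, _)), ((_, _), (_, _))); ring.
Qed.

Lemma oct_sum (a0 b0 a1 b1 a2 b2 a3 b3 : R) :
  octonion a0 b0 0 0 0 0 0 0 + (octonion 0 0 a1 b1 0 0 0 0 +
  (octonion 0 0 0 0 a2 b2 0 0 + (octonion 0 0 0 0 0 0 a3 (- b3) + 0))) =
  octonion a0 b0 a1 b1 a2 b2 a3 (- b3).
Proof.
apply: (@cdr_inj R 3); rewrite addr0 !cdrD /=.
by congr (((_, _), (_, _)), ((_, _), (_, _))); ring.
Qed.

Definition oct_term (c : plane) (k : nat) : alg R octonions :=
  match k with
  | 0 => octonion c.1 c.2 0 0 0 0 0 0
  | 1 => octonion 0 0 c.1 c.2 0 0 0 0
  | 2 => octonion 0 0 0 0 c.1 c.2 0 0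
  | _ => octonion 0 0 0 0 0 0 c.1 (- c.2)
  end.

Lemma oct_lincomb (c : 'I_4 -> plane) :
  lincomb (K := octonions) oct_unit oct_base c =
  octonion (c (inord 0)).1 (c (inord 0)).2 (c (inord 1)).1 (c (inord 1)).2
    (c (inord 2)).1 (c (inord 2)).2 (c (inord 3)).1 (- (c (inord 3)).2).
Proof.
have -> : lincomb (K := octonions) oct_unit oct_base c = \sum_(k < 4) oct_term (c k) k.
  apply: eq_bigr => -[[|[|[|[|//]]]] i] _.
  - exact: oct_term0.
  - exact: oct_term1.
  - exact: oct_term2.
  - exact: oct_term3.
rewrite !big_ord_recl big_ord0.
have -> : lift ord0 (lift ord0 (lift ord0 ord0)) = inord 3 :> 'I_4.
  by apply: val_inj; rewrite /= inordK.
have -> : lift ord0 (lift ord0 ord0) = inord 2 :> 'I_4.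
  by apply: val_inj; rewrite /= inordK.
have -> : lift ord0 ord0 = inord 1 :> 'I_4 by apply: val_inj; rewrite /= inordK.
have -> : ord0 = inord 0 :> 'I_4 by apply: val_inj; rewrite /= inordK.
rewrite !inordK // /oct_term.
exact: oct_sum.
Qed.

Definition oct_coords (x : CD R 3) (k : 'I_4) : plane :=
  if val k == 0%N then x.1.1 : plane
  else if val k == 1%N then x.1.2 : plane
  else if val k == 2%N then x.2.1 : plane
  else ((x.2.2.1, - x.2.2.2) : plane).

Lemma oct_splitting : splitting_base (K := octonions) oct_unit oct_base.
Proof.
split=> // x; exists (oct_coords (x : CD R 3)); split.
  rewrite oct_lincomb /oct_coords /= !inordK //= opprK.
  by case: x => [[[? ?] [? ?]] [[? ?] [? ?]]].
move=> c ->; rewrite oct_lincomb; apply/funext => k; rewrite /oct_coords.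
have kE : k = inord (val k) by apply: val_inj; rewrite /= inordK.
rewrite [in RHS]kE; case: k {kE} => [[|[|[|[|//]]]] i] /=;
  by rewrite ?opprK -surjective_pairing.
Qed.

Definition quat_coords (x : CD R 2) (k : 'I_2) : plane :=
  if val k == 0%N then x.1 : plane else x.2 : plane.

(** The definition of stem-Nash asks for one splitting base, so a base whose coordinates are the
    standard ones up to a sign is enough for the converse. *)
Lemma exists_nash_base (K : algebra_kind) :
  exists (I : alg R K) (J : 'I_(alg_u K).+1 -> alg R K),
    [/\ imunit I, splitting_base I J &
      forall z (F : plane -> (alg R K * alg R K)%type), nashT z (enc F) ->
      forall k, nashg z (fun w => toC ((splitting_coord I J (F w).1 k).1,
                                       (splitting_coord I J (F w).2 k).1)) /\
                nashg z (fun w => toC ((splitting_coord I J (F w).1 k).2,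
                                       (splitting_coord I J (F w).2 k).2))].
Proof.
case: K.
- exists quat_unit, quat_base; split.
  + by apply/imunitE; rewrite /cdre /cdnorm /= !mulr0 mulr1 !addr0 add0r.
  + exact: quat_splitting.
  + move=> z F [[h1 h2] [h3 h4]] k.
    have E (x : alg R quaternions) : splitting_coord quat_unit quat_base x = quat_coords x.
      apply: splitting_coord_uniq; first exact: quat_splitting.
      by rewrite quat_lincomb /quat_coords /=; case: x => [[? ?] [? ?]].
    rewrite (_ : (fun w => _) = fun w => toC ((quat_coords (F w).1 k).1, (quat_coords (F w).2 k).1));
      last by apply/funext => w; rewrite !E.
    rewrite (_ : (fun w => toC ((splitting_coord _ _ _ _).2, _)) =
      fun w => toC ((quat_coords (F w).1 k).2, (quat_coords (F w).2 k).2));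
      last by apply/funext => w; rewrite !E.
    by case: k => [[|[|//]] i]; split.
- exists oct_unit, oct_base; split.
  + by apply/imunitE; rewrite /cdre /cdnorm /= !mulr0 mulr1 !addr0 add0r.
  + exact: oct_splitting.
  + move=> z F [[[h1 h2] [h3 h4]] [[h5 h6] [h7 h8]]] k.
    have E (x : alg R octonions) : splitting_coord oct_unit oct_base x = oct_coords x.
      apply: splitting_coord_uniq; first exact: oct_splitting.
      rewrite oct_lincomb /oct_coords /= !inordK //= opprK.
      by case: x => [[[? ?] [? ?]] [[? ?] [? ?]]].
    rewrite (_ : (fun w => _) = fun w => toC ((oct_coords (F w).1 k).1, (oct_coords (F w).2 k).1));
      last by apply/funext => w; rewrite !E.
    rewrite (_ : (fun w => toC ((splitting_coord _ _ _ _).2, _)) =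
      fun w => toC ((oct_coords (F w).1 k).2, (oct_coords (F w).2 k).2));
      last by apply/funext => w; rewrite !E.
    by case: k => [[|[|[|[|//]]]] i]; split => //; exact: nashgN h8.
Qed.

Lemma stem_nashP (K : algebra_kind) (D : set plane)
    (F : plane -> (alg R K * alg R K)%type) : open D ->
  stem_nash D F <-> forall z, D z -> nashT z (enc F).
Proof.
move=> oD; split.
  move=> [I [J [hI sb H]]] z Dz; apply: (nash_coords_nashT sb) => k.
  have [h1 h2] := H k.
  by split; [apply: (complex_nashP _ oD).1 h1 _ Dz|apply: (complex_nashP _ oD).1 h2 _ Dz].
move=> H; have [I [J [hI sb HN]]] := exists_nash_base K.
exists I, J; split=> // k; split; apply/(complex_nashP _ oD) => z Dz.
  by have [] := HN z F (H z Dz) k.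
by have [] := HN z F (H z Dz) k.
Qed.

Lemma slice_nashP (K : algebra_kind) (W : set (alg R K)) f : saturated W -> open W ->
  slice_nash W f <-> exists F, [/\ stem (planar W) F, represents (planar W) F f &
    forall z, planar W z -> nashT z F].
Proof.
move=> sW oW; have oD := planar_open sW oW.
have cD : conj_invariant (planar W) by move=> z; exact: planar_conj.
split=> [[F [/stem_functionP[_ _ sF] /inducesP iF _ /(stem_nashP _ oD) nF]]|[F [sF rF nF]]].
  by exists (enc F).
exists (dec F); split.
- by apply/stem_functionP; rewrite enc_dec.
- by apply/inducesP; rewrite enc_dec.
- apply/(holomorphicP _ oD) => z Dz; apply/holV_holT.
  by apply: nashT_holT; have := nF z Dz; rewrite -{1}[F]enc_dec.
- by apply/(stem_nashP _ oD); rewrite enc_dec.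
Qed.

End StemNash.

(** * Semiregular functions as meromorphic stems *)

Section Polar.
Variables (R : realType) (n : nat).
Notation C := (R[i]%C).
Notation plane := (plane R).
Implicit Types (z w : plane) (F G : plane -> cdt C n).

(** The planar trace of [Delta]: it is symmetric in z and z^c and has real coefficients in w, so its
    powers are stems of real slice polynomials. *)
Definition delta z w : C := (toC w - toC z) * (toC w - conjc (toC z)).

Lemma toC_planeconj z : toC (planeconj z) = conjc (toC z).
Proof. by []. Qed.

Lemma delta_eq0 z w : delta z w = 0 <-> w = z \/ w = planeconj z.
Proof.
rewrite /delta -toC_planeconj; split=> [/eqP|].
  by rewrite mulf_eq0 !subr_eq0 => /orP[/eqP/toC_inj ->|/eqP/toC_inj ->]; [left|right].
by move=> [->|->]; rewrite subrr ?mul0r ?mulr0.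
Qed.

Lemma delta_conjl z w : delta (planeconj z) w = delta z w.
Proof. by rewrite /delta toC_planeconj mulrC -!toC_planeconj planeconjK. Qed.

Lemma delta_conjr z w : delta z (planeconj w) = conjc (delta z w).
Proof.
case: z w => a b [c d]; apply/eqP; rewrite eq_complex /delta /toC /planeconj /=.
by apply/andP; split; apply/eqP; ring.
Qed.

Lemma holg_delta z w : holg w (delta z).
Proof.
by apply: holgM; apply: holgD; try exact: holg_toC; exact: holgC.
Qed.

Lemma near_delta_neq0 z : \forall w \near z^', delta z w != 0.
Proof.
have nz : \forall w \near z^', w != z by apply/dnbhs_ballP; exists 1.
apply: filterS2 nz (near_notconj z) => w wz wzc.
by apply/eqP => /delta_eq0[] h; [rewrite h eqxx in wz|rewrite h eqxx in wzc].
Qed.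

Lemma delta_bound z : exists B : R, \forall w \near z,
  nsq (delta z w) <= B * nsq (toC w - toC z).
Proof.
pose B := nsq (toC z - conjc (toC z)) + 1.
exists B.
have cd := ccontD (ccont_toC z) (ccontC z (- conjc (toC z))).
have lt1 : nsq (toC z - conjc (toC z)) < B by rewrite ltrDl.
have H : \forall w \near z, nsq (toC w - conjc (toC z)) < B.
  exact: cvgr_lt _ (cvg_nsq cd) _ lt1.
apply: filterS H => w h; rewrite /delta nsqM mulrC.
by apply: ler_wpM2r (ltW h); exact: nsq_ge0.
Qed.

(** The exponent is at least 1, so the product is 0 at z whatever value F takes there. *)
Definition polar z F := exists k, holT z (fun w => cdt_scale (delta z w ^+ k.+1) (F w)).

Lemma holT_scale z (a : plane -> C) F : holg z a -> holT z F ->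
  holT z (fun w => cdt_scale (a w) (F w)).
Proof. by move=> ha; apply: coordwiseZ => // u v; exact: holgM. Qed.

Lemma holT_mul z F G : holT z F -> holT z G -> holT z (fun w => cdt_mul (F w) (G w)).
Proof.
apply: coordwiseM; [by move=> c; exact: holgC|by move=> u v; exact: holgD|
  by move=> u v; exact: holgM].
Qed.

Lemma holT_add z F G : holT z F -> holT z G -> holT z (fun w => cdt_add (F w) (G w)).
Proof. by apply: coordwiseD => u v; exact: holgD. Qed.

Lemma holT_conj z F : holT z F -> holT z (fun w => cdt_conj (F w)).
Proof.
apply: coordwise_conj; [by move=> c; exact: holgC|by move=> u v; exact: holgM].
Qed.

Lemma holT_cst z (t : cdt C n) : holT z (fun=> t).
Proof. by apply: coordwiseC => c; exact: holgC. Qed.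

Lemma holT_eq z F G : (forall w, F w = G w) -> holT z F -> holT z G.
Proof. by move=> FG; apply: holT_near; apply: plane_nearW. Qed.

Lemma polar_le z F k m : (k <= m)%N ->
  holT z (fun w => cdt_scale (delta z w ^+ k.+1) (F w)) ->
  holT z (fun w => cdt_scale (delta z w ^+ m.+1) (F w)).
Proof.
move=> km h; have := holT_scale (holgX (m - k) (holg_delta z z)) h.
apply: holT_eq => w; rewrite cdt_scaleA -exprD; congr (cdt_scale (_ ^+ _) _).
by rewrite addnS subnK.
Qed.

Lemma holT_polar z F : holT z F -> polar z F.
Proof. by move=> h; exists 0; apply: holT_scale => //; exact/holgX/holg_delta. Qed.

Lemma polar_add z F G : polar z F -> polar z G -> polar z (fun w => cdt_add (F w) (G w)).
Proof.
move=> [k hF] [l hG]; exists (maxn k l).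
have := holT_add (polar_le (leq_maxl k l) hF) (polar_le (leq_maxr k l) hG).
by apply: holT_eq => w; rewrite cdt_scaleDr.
Qed.

Lemma polar_mul z F G : polar z F -> polar z G -> polar z (fun w => cdt_mul (F w) (G w)).
Proof.
move=> [k hF] [l hG]; exists (k + l.+1)%N.
have := holT_mul hF hG; apply: holT_eq => w.
by rewrite cdt_mulZl cdt_mulZr cdt_scaleA -exprD addnS addSn -addnS.
Qed.

Lemma polar_conj z F : polar z F -> polar z (fun w => cdt_conj (F w)).
Proof.
move=> [k hF]; exists k; have := holT_conj hF.
by apply: holT_eq => w; rewrite cdt_conjZ.
Qed.

Lemma polar_scale z a F : polar z F -> polar z (fun w => cdt_scale a (F w)).
Proof.
move=> [k hF]; exists k; have := holT_scale (holgC z a) hF.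
by apply: holT_eq => w; rewrite !cdt_scaleA mulrC.
Qed.

End Polar.

Section Semiregular.
Variables (R : realType) (K : algebra_kind) (Om : set (alg R K)).
Hypotheses (Om_open : open Om) (Om_sat : saturated Om).
Notation C := (R[i]%C).
Notation A := (alg R K).
Notation plane := (plane R).
Notation n := (cdlevel K).
Notation T := (cdt C n).
Notation pr := (@half_plane_proj R K).
Notation D := (planar Om).
Implicit Types (x y : A) (z w : plane) (I J : A) (S : set plane).
Implicit Types (F G : plane -> T) (f g : pslice R K).

Lemma planar_Om_open : open D. Proof. exact: planar_open. Qed.
Lemma planar_Om_conj : conj_invariant D. Proof. by move=> z; exact: planar_conj. Qed.
Lemma planar_Om_near z : D z -> \forall w \near z, D w.
Proof. by move=> Dz; exact: open_nbhs_nbhs (conj planar_Om_open Dz). Qed.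

Lemma planar_setD (W W0 : set A) : saturated W -> saturated W0 ->
  planar (W `\` W0) = planar W `\` planar W0.
Proof.
move=> sW s0; have [I hI] := @imunit_exists R K.
have sD : saturated (W `\` W0).
  by move=> x y xy [Wx W0x]; split; [exact: sW Wx|move=> W0y; apply: W0x; exact: s0 W0y].
apply/seteqP; split=> z.
  by move=> /(planarP _ sD hI)[h1 h2]; split; [exists I|move/(planarP _ s0 hI)].
by move=> [/(planarP _ sW hI) h1 h2]; exists I => //; split=> // /(planarP _ s0 hI).
Qed.

Lemma planar_setU (W W0 : set A) : planar (W `|` W0) = planar W `|` planar W0.
Proof.
apply/seteqP; split=> z; first by move=> [I hI [h|h]]; [left|right]; exists I.
by move=> [[I hI h]|[I hI h]]; exists I => //; [left|right].
Qed.

Lemma saturated_setU (W W0 : set A) : saturated W -> saturated W0 -> saturated (W `|` W0).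
Proof. by move=> h1 h2 x y xy [/(h1 _ _ xy)|/(h2 _ _ xy)]; [left|right]. Qed.

Lemma saturated_setD (W W0 : set A) : saturated W -> saturated W0 -> saturated (W `\` W0).
Proof.
move=> h1 h2 x y xy [Wx W0x]; split; first exact: h1 Wx.
by move=> W0y; apply: W0x; apply: h2 W0y.
Qed.

(* the values of [F] on [S] are irrelevant: [delta z] vanishes there in [polar] *)
Record mero_stem S F : Prop := MeroStem {
  mero_sub : S `<=` D;
  mero_conj : conj_invariant S;
  mero_disc : forall z, D z -> \forall w \near z^', ~ S w;
  mero_stem_eq : stem (D `\` S) F;
  mero_hol : forall z, (D `\` S) z -> holT z F;
  mero_polar : forall z, D z -> polar z F }.

Definition rep f F := [/\ saturated (sing f), mero_stem (planar (sing f)) F &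
  represents (D `\` planar (sing f)) F (fn f)].

(** An exceptional set in the plane is symmetrised under conjugation to become the trace of a
    circular set of singularities. *)
Lemma discrete_of_near (Q : plane -> Prop) :
  (forall z, D z -> \forall w \near z^', ~ Q w) ->
  exists W0, [/\ discrete_singularities Om W0, saturated W0 &
    planar W0 = [set w | D w /\ (Q w \/ Q (planeconj w))]].
Proof.
move=> H; set E := [set w | _].
have cE : conj_invariant E.
  by move=> z [/planar_Om_conj Dz [h|h]]; split=> //; [right; rewrite planeconjK|left].
have pE := planar_preimage_pr K cE.
exists (pr @^-1` E); split=> //; last exact: preimage_pr_saturated.
apply/discrete_singularitiesP => //; rewrite pE; split.
- by move=> x [h _]; apply/planar_pr.
- exact: preimage_pr_saturated.
- move=> z Dz; have h1 := H _ Dz; have h2 := dnbhs_planeconj (H _ (planar_Om_conj Dz)).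
  by rewrite planeconjK in h2; apply: filterS2 h1 h2 => w q1 q2 [_ []].
Qed.

Lemma setD_open S : (forall z, D z -> \forall w \near z^', ~ S w) -> open (D `\` S).
Proof.
move=> dS; rewrite openE => z [Dz Sz].
by apply: filterI; [exact: planar_Om_near|apply: near_of_dnbhs => //; exact: dS].
Qed.

Lemma open_setD_sing (W0 : set A) : saturated W0 ->
  (forall z, D z -> \forall w \near z^', ~ planar W0 w) -> open (Om `\` W0).
Proof.
move=> s0 dS; rewrite -(preimage_planar (saturated_setD Om_sat s0)) planar_setD //.
by apply: preimage_pr_open; exact: setD_open.
Qed.

Lemma punctured_nonempty (Q : plane -> Prop) : (forall z, D z -> \forall w \near z^', Q w) ->
  Om !=set0 -> exists2 z, D z & Q z.
Proof.
move=> H [x Ox]; have Dx : D (pr x) by apply/planar_pr.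
have [w _ [Dw Qw]] := dnbhs_neq0 (filterI (near_dnbhs (planar_Om_near Dx)) (H _ Dx)).
by exists w.
Qed.

(** For the converse the exceptional set consists of both singular sets together with the points
    where the stems differ, up to conjugation. *)
Lemma sem_eqP f g F G : rep f F -> rep g G ->
  sem_eq Om f g <-> forall z, D z -> \forall w \near z^', F w = G w.
Proof.
move=> [sf mf rf] [sg mg rg]; have [I hI] := @imunit_exists R K; split.
  move=> [W0 /(discrete_singularitiesP _ Om_sat Om_open)[sub s0 d0] fg] z Dz.
  have h0 := near_dnbhs (planar_Om_near Dz); have h1 := d0 z Dz.
  have h2 := mero_disc mf Dz; have h3 := mero_disc mg Dz.
  near=> w.
  have Dw : D w by near: w.
  have n0 : ~ planar W0 w by near: w.
  have nf : ~ planar (sing f) w by near: w.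
  have ng : ~ planar (sing g) w by near: w.
  apply: ev_inj => J hJ; rewrite -rf // -rg //.
  apply: fg; split; first by apply/(planarP _ Om_sat hJ).
  by move/(planarP _ s0 hJ).
move=> H.
pose Q w := ~ (~ planar (sing f) w /\ ~ planar (sing g) w /\ F w = G w).
have HQ z : D z -> \forall w \near z^', ~ Q w.
  move=> Dz.
  by apply: filterS3 (mero_disc mf Dz) (mero_disc mg Dz) (H z Dz) => w ? ? ? h; apply: h.
have [W0 [d0 s0 pE]] := discrete_of_near HQ.
exists W0 => // x [Ox W0x].
have [J hJ xE] := slice_point_pr x.
have Dx : D (pr x) by apply/planar_pr.
have : ~ planar W0 (pr x) by rewrite planar_pr.
rewrite pE => h; have : ~ Q (pr x) by move=> h1; apply: h; split=> //; left.
by move=> /contrapT[h1 [h2 h3]]; rewrite xE rf // rg // h3.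
Unshelve. all: by end_near. Qed.

End Semiregular.

(** * Poles of slice functions and poles of stems *)

Section RepresentSemiregular.
Variables (R : realType) (K : algebra_kind) (Om : set (alg R K)).
Hypotheses (Om_open : open Om) (Om_sat : saturated Om).
Notation C := (R[i]%C).
Notation A := (alg R K).
Notation plane := (plane R).
Notation n := (cdlevel K).
Notation T := (cdt C n).
Notation pr := (@half_plane_proj R K).
Notation D := (planar Om).
Implicit Types (x y : A) (z w : plane) (I J : A) (S : set plane).
Implicit Types (F G : plane -> T) (f g : pslice R K).

(** The copy of c in C_I; the multipliers (x - y)^k and Delta^k are computed inside this commutative
    line. *)
Definition slice_const (c : C) I : A := slice_point (complex.Re c) (complex.Im c) I.

Lemma slice_constE (c : C) I : imunit I -> slice_const c I = ev I (cdt_scale c (cdt_one C n)).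
Proof.
move=> hI; rewrite evZ // /ev cdc_re1 cdc_im1 cdmul0r addr0.
by rewrite [RHS]cdmul1r.
Qed.

Lemma slice_constM (c d : C) I : imunit I ->
  alg_mul (slice_const c I) (slice_const d I) = slice_const (c * d) I.
Proof. by move=> hI; rewrite [RHS]slice_constE // -cdt_scaleA evZ // -slice_constE. Qed.

Lemma slice_constX (c : C) I k : imunit I ->
  alg_pow (slice_const c I) k = slice_const (c ^+ k) I.
Proof.
move=> hI; elim: k => [|k IH].
  by rewrite expr0 /slice_const /slice_point /= scale1r scale0r addr0.
by rewrite /alg_pow iterS -/(alg_pow _ k) IH slice_constM // exprS.
Qed.

Lemma slice_const_real (a : R) I : slice_const (a%:C)%C I = a *: alg_one R K.
Proof. by rewrite /slice_const /slice_point /= scale0r addr0. Qed.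

Lemma slice_constD (c d : C) I : slice_const (c + d) I = slice_const c I + slice_const d I.
Proof. by rewrite /slice_const /slice_point cReD cImD !scalerDl addrACA. Qed.

Lemma slice_constN (c : C) I : slice_const (- c) I = - slice_const c I.
Proof.
by case: c => a b; rewrite /slice_const /slice_point /= !scaleNr opprD.
Qed.

Lemma trace_slice_point (a b : R) I : imunit I ->
  alg_tr (slice_point a b I) = (a *+ 2) *: alg_one R K.
Proof.
move=> hI; have /imunitE[r0 n1] := hI.
suff h : (a *: cdone R n + b *: (I : CD R n)) + cdconj (a *: cdone R n + b *: (I : CD R n)) =
  (a *+ 2) *: cdone R n by exact: h.
apply: cdr_inj; rewrite cdrD cdr_conj cdt_trace cdrZ cdr1.
by rewrite -/(cdre _) cdre_slice r0 mulr0 addr0 mulr2n.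
Qed.

Lemma norm_slice_point (a b : R) I : imunit I ->
  alg_norm (slice_point a b I) = (a ^+ 2 + b ^+ 2) *: alg_one R K.
Proof.
move=> hI; have /imunitE[r0 n1] := hI.
suff h : cdmul (a *: cdone R n + b *: (I : CD R n)) (cdconj (a *: cdone R n + b *: (I : CD R n))) =
  (a ^+ 2 + b ^+ 2) *: cdone R n by exact: h.
apply: cdr_inj; rewrite cdrM cdr_conj cdt_mul_conj cdrZ cdr1.
by rewrite -/(cdnorm _) cdnorm_slice r0 n1 mulr0 mul0rn addr0 mulr1.
Qed.

(** The trace and norm of y are twice the real part and the squared modulus of z, so the quadratic
    polynomial splits as (w - z)(w - z^c). *)
Lemma Delta_slice_point z w I J : imunit I -> imunit J ->
  Delta (slice_point z.1 z.2 I) (slice_point w.1 w.2 J) = slice_const (delta z w) J.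
Proof.
move=> hI hJ; rewrite /Delta trace_slice_point // norm_slice_point //.
rewrite -[slice_point w.1 w.2 J]/(slice_const (toC w) J) slice_constM //.
rewrite -!(slice_const_real _ J) slice_constM // -slice_constN -!slice_constD.
congr slice_const; rewrite /delta /toC; case: z => a b; case: w => c d.
by apply/eqP; rewrite eq_complex /=; apply/andP; split; apply/eqP; ring.
Qed.

Lemma sub_real_slice_point (a : R) w J : imunit J ->
  slice_point w.1 w.2 J - a *: alg_one R K = slice_const (toC w - (a%:C)%C) J.
Proof. by move=> hJ; rewrite slice_constD slice_constN slice_const_real. Qed.

Lemma realA_pr y : realA y <-> (pr y).2 = 0.
Proof.
split.
  move=> [a ->]; have [I hI] := @imunit_exists R K.
  have -> : a *: alg_one R K = slice_point a 0 I by rewrite /slice_point scale0r addr0.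
  by rewrite pr_slice_point //= normr0.
move=> h; have [I hI ->] := slice_point_pr y; exists (pr y).1.
by rewrite /slice_point h scale0r addr0.
Qed.

Lemma realA_slice_point z I : imunit I -> realA (slice_point z.1 z.2 I) -> z.2 = 0.
Proof.
by move=> hI /realA_pr; rewrite pr_slice_point //= => /eqP; rewrite normr_eq0 => /eqP.
Qed.

Lemma delta_real z w : z.2 = 0 -> delta z w = (toC w - (z.1%:C)%C) ^+ 2.
Proof.
case: z => a b /= ->; rewrite expr2 /delta; congr (_ * _); congr (_ - _).
by rewrite /toC /= oppr0.
Qed.

Section ExtendsPolar.
Variables (f : pslice R K) (F : plane -> T).
Hypothesis sf : saturated (sing f).

(** Common to removable singularities and both kinds of poles: e is the multiplier by which h arises
    from f, and e' completes it to a power of [delta z]. As e' vanishes with [delta z], the two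
    sides agree on the singular pair as well. *)
Lemma extends_near_polar z I (h : A -> A) (e e' : plane -> C) k :
  imunit I -> planar (sing f) z ->
  extends_near Om (sing f) h (slice_point z.1 z.2 I) ->
  (forall w J, (D `\` planar (sing f)) w -> imunit J ->
     h (slice_point w.1 w.2 J) = ev J (cdt_scale (e w) (F w))) ->
  (forall w, holg w e') -> (forall w, delta z w ^+ k.+1 = e' w * e w) ->
  (forall w, delta z w = 0 -> e' w = 0) ->
  polar z F.
Proof.
move=> hI Sz [U [g [[oU cU UOm UE] [rg gh]]]] he he' dE e0.
have sU : saturated U by apply/circularP.
have [G [sG rG hG]] := (slice_regularP g sU oU).1 rg.
have Uz : planar U z.
  exists I => //; suff : (U `&` sing f) (slice_point z.1 z.2 I) by case.
  by rewrite UE; apply/sphereP.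
exists k; apply: holT_near (holT_scale (he' z) (hG z Uz)).
have nU : \forall w \near z, planar U w by exact: open_nbhs_nbhs (conj (planar_open sU oU) Uz).
apply: filterS nU => w Uw; rewrite dE -cdt_scaleA.
have [/eqP/e0 ->|dn0] := boolP (delta z w == 0); first by rewrite !cdt_scale0.
congr cdt_scale.
have Sw : ~ planar (sing f) w.
  move=> [J hJ Sw].
  have Uw' : U (slice_point w.1 w.2 J) by apply/(planarP _ sU hJ).
  have : (U `&` sing f) (slice_point w.1 w.2 J) by [].
  rewrite UE => /sphereP /esym /(pr_eq hI hJ) /delta_eq0 h0.
  by rewrite h0 eqxx in dn0.
have Dw : D w.
  have /(planarP _ sU hI) /UOm h0 := Uw.
  by apply/(planarP _ Om_sat hI).
apply: ev_inj => J hJ; rewrite -rG // -(he w J) // gh //.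
split; first by apply/(planarP _ sU hJ).
by move/(planarP _ sf hJ).
Qed.

End ExtendsPolar.

Lemma SEM_rep f : SEM Om f -> exists F, rep Om f F.
Proof.
move=> [/(discrete_singularitiesP _ Om_sat Om_open)[sub s0 d0] sr rp sp].
have oW := open_setD_sing Om_open Om_sat s0 d0.
have sW := saturated_setD Om_sat s0.
have [F [sF rF hF]] := (slice_regularP (fn f) sW oW).1 sr.
rewrite planar_setD // in sF rF hF.
have subP : planar (sing f) `<=` D by move=> z [I hI /sub h]; exists I.
exists F; split=> //; split=> //; first by move=> z; exact: planar_conj.
move=> z Dz; have [Sz|Sz] := pselect (planar (sing f) z); last first.
  by apply: holT_polar; apply: hF.
have [I hI Sy] := Sz; set y := slice_point z.1 z.2 I in Sy.
have remov : removable Om (sing f) (fn f) y -> polar z F.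
  move=> h; apply: (extends_near_polar s0 (e := fun=> 1) (e' := delta z) (k := 0%N) hI Sz h).
  - by move=> w J Sw hJ; rewrite cdt_scale1 rF.
  - by move=> w; exact: holg_delta.
  - by move=> w; rewrite expr1 mulr1.
  - by [].
have [yr|yr] := pselect (realA y).
  have z2 := realA_slice_point hI yr.
  case: (rp y Sy yr) => [//|[_ [k k1 h]]].
  have yE : y = z.1 *: alg_one R K by rewrite /y /slice_point z2 scale0r addr0.
  (* At a real point [delta z] is a square, so its power k + 1 is (w - a)^(2k + 2), and the cofactor
     of (w - a)^k has exponent k + 2. *)
  apply: (extends_near_polar s0 (e := fun w => (toC w - (z.1%:C)%C) ^+ k)
    (e' := fun w => (toC w - (z.1%:C)%C) ^+ k.+2) (k := k) hI Sz h).
  - move=> w J Sw hJ; rewrite yE sub_real_slice_point // slice_constX //.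
    by rewrite rF // evZ.
  - move=> w; apply: holgX; apply: holgD; [exact: holg_toC|exact: holgC].
  - by move=> w; rewrite delta_real // -exprM -exprD; congr (_ ^+ _); rewrite mul2n -addnn [RHS]addSnnS.
  - by move=> w; rewrite delta_real // => /eqP; rewrite expf_eq0 /= => /eqP ->; rewrite expr0n.
case: (sp y Sy yr) => [//|[_ [k k1 h]]].
apply: (extends_near_polar s0 (e := fun w => delta z w ^+ k)
    (e' := delta z) (k := k) hI Sz h).
- move=> w J Sw hJ; rewrite Delta_slice_point // slice_constX //.
  by rewrite rF // evZ.
- by move=> w; exact: holg_delta.
- by move=> w; rewrite exprS.
- by [].
Qed.

Lemma cdt_bar0 m : cdt_bar (cdt_zero C m) = cdt_zero C m.
Proof. by elim: m => [|m IH] /=; [rewrite oppr0|rewrite IH]. Qed.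

Lemma conjcX (x : C) k : conjc (x ^+ k) = conjc x ^+ k.
Proof.
elim: k => [|k IH]; first by rewrite !expr0 /= oppr0.
by rewrite !exprS conjcM IH.
Qed.

(** The converse passage, done once for real points and spheres: the cleared stem is turned into a
    slice regular function on a circular neighbourhood of the whole sphere. *)
Lemma rep_extends f F y : rep Om f F -> sing f y ->
  exists (U : set A) (k : nat) (g : A -> A), [/\ open U, circular U, U `<=` Om & U `&` sing f = sphere y] /\
    slice_regular U g /\
    forall w J, imunit J -> (U `\` sing f) (slice_point w.1 w.2 J) ->
      g (slice_point w.1 w.2 J) = ev J (cdt_scale (delta (pr y) w ^+ k.+1) (F w)).
Proof.
move=> [sf mf rf] Sy; set z := pr y.
have Sz : planar (sing f) z by apply/planar_pr.
have Dz : D z by exact: (mero_sub mf).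
have Dzc := planar_Om_conj Om_sat Dz.
have [k1 h1] := mero_polar mf Dz; have [k2 h2] := mero_polar mf Dzc.
(* The pole orders at z and at its conjugate are given separately; their maximum clears both. *)
pose k := maxn k1 k2.
pose G w := cdt_scale (delta z w ^+ k.+1) (F w).
have hG : holT z G by exact: polar_le (leq_maxl _ _) h1.
have hGc : holT (planeconj z) G.
  have := polar_le (leq_maxr k1 k2) h2.
  by apply: holT_eq => w; rewrite delta_conjl.
pose good w := [/\ D w, (planar (sing f) w -> delta z w = 0) & holT w G].
have good_near u : D u -> delta z u = 0 -> holT u G -> \forall w \near u, good w.
  move=> Du du hu; have a1 := planar_Om_near Om_open Om_sat Du; have a2 := holT_join hu.
  have a3 : \forall w \near u, planar (sing f) w -> delta z w = 0.
    by apply: near_of_dnbhs => //; apply: filterS (mero_disc mf Du) => w h /h.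
  by apply: filterS3 a1 a2 a3 => w ? ? ?; split.
have gz : \forall w \near z, good w.
  by apply: good_near => //; apply/delta_eq0; left.
have gzc : \forall w \near planeconj z, good w.
  by apply: good_near => //; apply/delta_eq0; right.
(* Asking for good neighbourhoods at w and at its conjugate makes V both open and
   conjugation-invariant. *)
pose V := [set w | (\forall u \near w, good u) /\ (\forall u \near planeconj w, good u)].
have oV : open V.
  rewrite openE => w [a1 a2].
  have b1 : \forall u \near w, \forall v \near u, good v := near_join a1.
  have b2 : \forall u \near w, \forall v \near planeconj u, good v.
    by have := near_planeconj (near_join a2); rewrite planeconjK.
  by apply: filterS2 b1 b2 => u ? ?; split.
have cV : conj_invariant V by move=> w [a1 a2]; split=> //; rewrite planeconjK.
have Vz : V z by split.
have sU := @preimage_pr_saturated R K V.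
have pU := planar_preimage_pr K cV.
have Vgood w : V w -> good w by move=> [/nbhs_singleton].
have sG : stem V G.
  move=> w Vw; have [Dw Sw _] := Vgood w Vw; rewrite /G delta_conjr.
  have [d0|d0] := eqVneq (delta z w) 0.
    by rewrite d0 /= oppr0 expr0n !cdt_scale0 cdt_bar0.
  rewrite -conjcX cdt_barZ (mero_stem_eq mf) //; split=> // h.
  by rewrite (Sw h) eqxx in d0.
exists (pr @^-1` V), k, (slice_of V (dec G)); split; [split|split].
- exact: preimage_pr_open.
- exact/circularP.
- by move=> x /Vgood[h _ _]; apply/planar_pr.
- apply/seteqP; split=> x.
    move=> [/= /Vgood[_ h _] Sx]; apply/sphereP.
    (* If the projection of x is the conjugate of z, then z is real, because both projections have
       non-negative second coordinate. *)
    have /delta_eq0[//|e] : delta z (pr x) = 0 by apply: h; apply/planar_pr.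
    have : (pr x).2 = - z.2 by rewrite e.
    have := pr_ge0 x; have := pr_ge0 y; rewrite -/z => p1 p2 p3.
    have z2 : z.2 = 0 by apply/eqP; rewrite eq_le p1 andbT; rewrite p3 oppr_ge0 in p2.
    by rewrite e /planeconj z2 oppr0 -z2 -surjective_pairing.
  move=> /sphereP xy; split; first by rewrite /= xy.
  by apply: sf Sy.
- apply: (slice_regularP (slice_of V (dec G)) sU (@preimage_pr_open R K V oV)).2; exists G; rewrite pU; split=> //.
    exact: slice_ofP.
  by move=> w /Vgood[].
- move=> w J hJ [Uw Sw].
  have Vw : V w by rewrite -pU; apply/(planarP _ sU hJ).
  by rewrite (slice_ofP cV sG).
Qed.

Lemma rep_SEM f F : rep Om f F -> SEM Om f.
Proof.
move=> rp; have [sf mf rf] := rp.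
have dS := mero_disc mf.
have oW := open_setD_sing Om_open Om_sat sf dS.
have sW := saturated_setD Om_sat sf.
split.
- apply/discrete_singularitiesP => //; split=> //.
  by move=> x /(planar_pr x sf) /(mero_sub mf) /(planar_pr x Om_sat).
- apply/(slice_regularP _ sW oW); exists F; rewrite planar_setD //.
  by split=> //; [exact: mero_stem_eq mf|exact: mero_hol mf].
- move=> y Sy yr; have [|nr] := pselect (removable Om (sing f) (fn f) y); first by left.
  right; split=> //.
  have [U [k [g [hU [rg hg]]]]] := rep_extends rp Sy.
  (* At a real point y, [delta (pr y)] is the square of the linear factor, which doubles the
     exponent. *)
  exists (k.+1 * 2)%N; first by [].
  exists U, g; split=> //; split=> // x Ux.
  have [J hJ xE] := slice_point_pr x; rewrite xE in Ux *.
  have [Ux1 Ux2] := Ux.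
  have z2 := (realA_pr y).1 yr.
  have yE : y = (pr y).1 *: alg_one R K.
    by have [I hI {1}->] := slice_point_pr y; rewrite /slice_point z2 scale0r addr0.
  rewrite hg // {2}yE sub_real_slice_point // slice_constX // delta_real //.
  rewrite -exprM mulnC evZ // rf //.
  split; last by move/(planarP _ sf hJ).
  by have [_ _ /(_ _ Ux1) h _] := hU; apply/(planarP _ Om_sat hJ).
- move=> y Sy yr; have [|nr] := pselect (removable Om (sing f) (fn f) y); first by left.
  right; split=> //.
  have [U [k [g [hU [rg hg]]]]] := rep_extends rp Sy.
  exists k.+1; first by [].
  exists U, g; split=> //; split=> // x Ux.
  have [J hJ xE] := slice_point_pr x; rewrite xE in Ux *.
  have [Ux1 Ux2] := Ux.
  have [I hI yE] := slice_point_pr y.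
  rewrite hg // {2}yE Delta_slice_point // slice_constX // evZ // rf //.
  split; last by move/(planarP _ sf hJ).
  by have [_ _ /(_ _ Ux1) h _] := hU; apply/(planarP _ Om_sat hJ).
Qed.

End RepresentSemiregular.

(** * The algebra of semiregular functions *)

Section Operations.
Variables (R : realType) (K : algebra_kind) (Om : set (alg R K)).
Hypotheses (Om_open : open Om) (Om_sat : saturated Om).
Notation C := (R[i]%C).
Notation A := (alg R K).
Notation plane := (plane R).
Notation n := (cdlevel K).
Notation T := (cdt C n).
Notation pr := (@half_plane_proj R K).
Notation D := (planar Om).
Implicit Types (x y : A) (z w : plane) (I J : A) (S : set plane).
Implicit Types (F G : plane -> T) (f g : pslice R K).
Notation rep := (rep Om).

(** The germ form of being slice-Nash off some discrete set, which may differ from [sing f]. *)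
Definition near_nash F := forall z, D z -> \forall w \near z^', nashT w F.

Lemma SEN_near_nash f F : rep f F -> SEN Om f -> near_nash F.
Proof.
move=> [sf mf rf] [_ [W0 /(discrete_singularitiesP _ Om_sat Om_open)[sub s0 d0] sn]] z Dz.
have oW := open_setD_sing Om_open Om_sat s0 d0.
have sW := saturated_setD Om_sat s0.
have [G [sG rG nG]] := (slice_nashP (fn f) sW oW).1 sn.
rewrite planar_setD // in sG rG nG.
have good : \forall w \near z^', \forall u \near w,
    [/\ D u, ~ planar W0 u & ~ planar (sing f) u].
  have h1 := near_dnbhs (planar_Om_near Om_open Om_sat Dz).
  have h2 := d0 z Dz; have h3 := mero_disc mf Dz.
  have : \forall w \near z^', [/\ D w, ~ planar W0 w & ~ planar (sing f) w].
    by apply: filterS3 h1 h2 h3 => w ? ? ?; split.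
  move=> /dnbhs_ballP[e e0 H]; apply/dnbhs_ballP; exists e => // w bw wz.
  by apply: filterS (near_punctured bw wz) => u [uz bu]; exact: H.
apply: filterS good => w hw.
have [Dw Ww _] := nbhs_singleton hw.
apply: (@nashT_near _ w _ G); last exact: nG.
apply: filterS hw => u [Du Wu Su]; apply: ev_inj => J hJ.
by rewrite -rG // -rf.
Qed.

Lemma rep_SEN f F : rep f F -> near_nash F -> SEN Om f.
Proof.
move=> rp nF; have [sf mf rf] := rp; split; first exact: rep_SEM rp.
(* The set to be removed: the singularities and the points where the stem is not Nash. *)
pose Q w := ~ (~ planar (sing f) w /\ nashT w F).
have HQ z : D z -> \forall w \near z^', ~ Q w.
  move=> Dz.
  by apply: filterS2 (mero_disc mf Dz) (nF z Dz) => w ? ? h; apply: h.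
have [W0 [d0 s0 pE]] := discrete_of_near Om_open Om_sat HQ.
exists W0 => //.
have /(discrete_singularitiesP _ Om_sat Om_open)[_ _ dd] := d0.
have oW := open_setD_sing Om_open Om_sat s0 dd.
have sW := saturated_setD Om_sat s0.
apply/(slice_nashP _ sW oW); exists F; rewrite planar_setD // pE.
have hQ z : (D `\` [set w | D w /\ (Q w \/ Q (planeconj w))]) z ->
    (D `\` planar (sing f)) z /\ nashT z F.
  move=> [Dz Ez].
  have : ~ Q z by move=> h; apply: Ez; split=> //; left.
  by move=> /contrapT[h1 h2].
split.
- by move=> z /hQ[h _]; exact: (mero_stem_eq mf).
- by move=> z I /hQ[h _]; exact: rf.
- by move=> z /hQ[].
Qed.

(** Sums and products live off the union of two singular sets, so each stem is first viewed with the
    larger set. *)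
Lemma mero_widen S S' F : mero_stem Om S F -> S `<=` S' -> S' `<=` D ->
  conj_invariant S' -> (forall z, D z -> \forall w \near z^', ~ S' w) ->
  mero_stem Om S' F.
Proof.
move=> [h1 h2 h3 h4 h5 h6] SS S'D cS' dS'; split=> //.
- by move=> z [Dz Sz]; apply: h4; split=> // /SS.
- by move=> z [Dz Sz]; apply: h5; split=> // /SS.
Qed.

Lemma mero_setU S S' F G : mero_stem Om S F -> mero_stem Om S' G ->
  mero_stem Om (S `|` S') F.
Proof.
move=> mF mG; apply: (mero_widen mF).
- by move=> z; left.
- by move=> z [/(mero_sub mF)|/(mero_sub mG)].
- by move=> z [/(mero_conj mF)|/(mero_conj mG)]; [left|right].
- move=> z Dz; apply: filterS2 (mero_disc mF Dz) (mero_disc mG Dz) => w h1 h2.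
  by move=> [].
Qed.

Lemma mero_setUr S S' F G : mero_stem Om S F -> mero_stem Om S' G ->
  mero_stem Om (S `|` S') G.
Proof. by move=> mF mG; rewrite setUC; exact: mero_setU mG mF. Qed.

Lemma mero_add S F G : mero_stem Om S F -> mero_stem Om S G ->
  mero_stem Om S (fun w => cdt_add (F w) (G w)).
Proof.
move=> [h1 h2 h3 h4 h5 h6] [_ _ _ k4 k5 k6]; split=> //.
- by move=> z Dz; rewrite h4 // k4 // cdt_barD.
- by move=> z Dz; apply: holT_add; auto.
- by move=> z Dz; apply: polar_add; auto.
Qed.

Lemma mero_mul S F G : mero_stem Om S F -> mero_stem Om S G ->
  mero_stem Om S (fun w => cdt_mul (F w) (G w)).
Proof.
move=> [h1 h2 h3 h4 h5 h6] [_ _ _ k4 k5 k6]; split=> //.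
- by move=> z Dz; rewrite h4 // k4 // cdt_barM.
- by move=> z Dz; apply: holT_mul; auto.
- by move=> z Dz; apply: polar_mul; auto.
Qed.

Lemma mero_conjT S F : mero_stem Om S F -> mero_stem Om S (fun w => cdt_conj (F w)).
Proof.
move=> [h1 h2 h3 h4 h5 h6]; split=> //.
- by move=> z Dz; rewrite h4 // cdt_bar_conj.
- by move=> z Dz; apply: holT_conj; auto.
- by move=> z Dz; apply: polar_conj; auto.
Qed.

Lemma conjc_real (a : R) : conjc (a%:C)%C = (a%:C)%C.
Proof. by rewrite /= oppr0. Qed.

Lemma mero_scale S (a : R) F : mero_stem Om S F ->
  mero_stem Om S (fun w => cdt_scale (a%:C)%C (F w)).
Proof.
move=> [h1 h2 h3 h4 h5 h6]; split=> //.
- by move=> z Dz; rewrite h4 // cdt_barZ conjc_real.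
- by move=> z Dz; apply: holT_scale; [exact: holgC|auto].
- by move=> z Dz; apply: polar_scale; auto.
Qed.

Lemma mero_cst (t : T) : cdt_bar t = t -> mero_stem Om set0 (fun=> t).
Proof.
move=> tb; split=> //.
- by move=> z Dz; apply/dnbhs_ballP; exists 1 => // w _ _ [].
- by move=> z Dz; exact: holT_cst.
- by move=> z Dz; exact/holT_polar/holT_cst.
Qed.

Lemma cdt_bar1 m : cdt_bar (cdt_one C m) = cdt_one C m.
Proof. by elim: m => [|m IH] /=; [rewrite oppr0|rewrite IH cdt_bar0]. Qed.

Lemma rep_add f g F G : rep f F -> rep g G ->
  rep (sem_add f g) (fun w => cdt_add (F w) (G w)).
Proof.
move=> [sf mf rf] [sg mg rg]; split.
- exact: saturated_setU.
- by rewrite planar_setU; apply: mero_add; [exact: mero_setU mg|exact: mero_setUr mf _].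
- rewrite planar_setU => z I [Dz Sz] hI /=.
  rewrite rf ?rg ?evD //.
    by split=> // h; apply: Sz; right.
  by split=> // h; apply: Sz; left.
Qed.

Lemma rep_scale a f F : rep f F ->
  rep (sem_scale a f) (fun w => cdt_scale (a%:C)%C (F w)).
Proof.
move=> [sf mf rf]; split=> //; first exact: mero_scale.
move=> z I Dz hI /=; rewrite rf // evZ // -[slice_point _ _ _]/(slice_const (a%:C)%C I).
rewrite slice_const_real; apply/esym; rewrite /alg_mul [LHS]cdmulZl.
by congr (_ *: _); exact: cdmul1l.
Qed.

Lemma rep_open f F : rep f F -> open (Om `\` sing f).
Proof. by move=> [sf mf _]; exact: open_setD_sing (mero_disc mf). Qed.

Lemma rep_mul f g F G : rep f F -> rep g G ->
  rep (sem_mul Om f g) (fun w => cdt_mul (F w) (G w)).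
Proof.
move=> [sf mf rf] [sg mg rg].
have sU : saturated (sing f `|` sing g) by exact: saturated_setU.
have mF := mero_setU mf mg; have mG := mero_setUr mf mg.
rewrite -planar_setU in mF mG.
have oW := open_setD_sing Om_open Om_sat sU (mero_disc mF).
have sW := saturated_setD Om_sat sU.
split=> //; first exact: mero_mul.
rewrite /= -planar_setD //; apply: slice_mulP => //; rewrite planar_setD //.
- exact: mero_stem_eq mF.
- exact: mero_stem_eq mG.
- move=> z I [Dz Sz]; apply: rf; split=> // h; apply: Sz.
  by rewrite planar_setU; left.
- move=> z I [Dz Sz]; apply: rg; split=> // h; apply: Sz.
  by rewrite planar_setU; right.
Qed.

Lemma rep_conj f F : rep f F -> rep (sem_conj Om f) (fun w => cdt_conj (F w)).
Proof.
move=> rp; have [sf mf rf] := rp; split=> //; first exact: mero_conjT.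
rewrite /= -planar_setD //; apply: slice_conjP => //.
- exact: saturated_setD.
- exact: rep_open rp.
- by rewrite planar_setD //; exact: mero_stem_eq mf.
- by rewrite planar_setD.
Qed.

Lemma planar_set0 : planar (set0 : set A) = set0.
Proof. by apply/seteqP; split=> z // [I _ []]. Qed.

Lemma rep_zero : rep (sa_zero (sem_ops Om)) (fun=> cdt_zero C n).
Proof.
split=> //=; rewrite planar_set0; first exact: mero_cst (cdt_bar0 _ _).
by move=> z I _ _; rewrite /ev cdc_re0 cdc_im0 cdmul0r addr0.
Qed.

Lemma rep_one : rep (sa_one (sem_ops Om)) (fun=> cdt_one C n).
Proof.
split=> //=; rewrite planar_set0; first exact: mero_cst (cdt_bar1 _).
by move=> z I _ _; rewrite /ev cdc_re1 cdc_im1 cdmul0r addr0.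
Qed.

Lemma rep_eq f g F G : rep f F -> rep g G -> (forall w, F w = G w) -> sem_eq Om f g.
Proof.
move=> rF rG FG; apply/(sem_eqP Om_open Om_sat rF rG) => z Dz.
by apply: near_dnbhs; apply: plane_nearW.
Qed.

Lemma SEM_algebra : @alternative_star_algebra R (sem_ops Om) (SEM Om).
Proof.
have n3 := level_le3 K.
have E f g F G := @sem_eqP R K Om Om_open Om_sat f g F G.
have S f F : rep f F -> SEM Om f by exact: rep_SEM.
have X := @SEM_rep R K Om Om_open Om_sat.
split=> /=.
- by move=> f /X[F rF]; exact: (rep_eq rF rF).
- move=> f g /X[F rF] /X[G rG] /(E _ _ _ _ rF rG) H; apply/(E _ _ _ _ rG rF) => z Dz.
  by apply: filterS (H z Dz) => w ->.
- move=> f g h /X[F rF] /X[G rG] /X[H rH] /(E _ _ _ _ rF rG) h1 /(E _ _ _ _ rG rH) h2.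
  apply/(E _ _ _ _ rF rH) => z Dz.
  by apply: filterS2 (h1 z Dz) (h2 z Dz) => w -> ->.
- exact: S rep_zero.
- exact: S rep_one.
- by move=> f g /X[F rF] /X[G rG]; exact: S (rep_add rF rG).
- by move=> a f /X[F rF]; exact: S (rep_scale a rF).
- by move=> f g /X[F rF] /X[G rG]; exact: S (rep_mul rF rG).
- by move=> f /X[F rF]; exact: S (rep_conj rF).
- move=> f f' g g' /X[F rF] /X[F1 rF1] /X[G rG] /X[G1 rG1].
  move=> /(E _ _ _ _ rF rF1) h1 /(E _ _ _ _ rG rG1) h2.
  apply/(E _ _ _ _ (rep_add rF rG) (rep_add rF1 rG1)) => z Dz.
  by apply: filterS2 (h1 z Dz) (h2 z Dz) => w -> ->.
- move=> a f f' /X[F rF] /X[F1 rF1] /(E _ _ _ _ rF rF1) h1.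
  apply/(E _ _ _ _ (rep_scale a rF) (rep_scale a rF1)) => z Dz.
  by apply: filterS (h1 z Dz) => w ->.
- move=> f f' g g' /X[F rF] /X[F1 rF1] /X[G rG] /X[G1 rG1].
  move=> /(E _ _ _ _ rF rF1) h1 /(E _ _ _ _ rG rG1) h2.
  apply/(E _ _ _ _ (rep_mul rF rG) (rep_mul rF1 rG1)) => z Dz.
  by apply: filterS2 (h1 z Dz) (h2 z Dz) => w -> ->.
- move=> f f' /X[F rF] /X[F1 rF1] /(E _ _ _ _ rF rF1) h1.
  apply/(E _ _ _ _ (rep_conj rF) (rep_conj rF1)) => z Dz.
  by apply: filterS (h1 z Dz) => w ->.
- move=> f g h /X[F rF] /X[G rG] /X[H rH].
  apply: rep_eq (rep_add rF (rep_add rG rH)) (rep_add (rep_add rF rG) rH) _ => w.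
  exact: cdt_addA.
- move=> f g /X[F rF] /X[G rG].
  by apply: rep_eq (rep_add rF rG) (rep_add rG rF) _ => w; exact: cdt_addC.
- move=> f /X[F rF].
  by apply: rep_eq (rep_add rep_zero rF) rF _ => w; exact: cdt_add0.
- move=> f /X[F rF].
  apply: rep_eq (rep_add (rep_scale (-1) rF) rF) rep_zero _ => w.
  by rewrite rmorphN1 cdt_addN.
- move=> a b f /X[F rF].
  apply: rep_eq (rep_scale a (rep_scale b rF)) (rep_scale (a * b) rF) _ => w.
  by rewrite cdt_scaleA rmorphM.
- move=> f /X[F rF].
  by apply: rep_eq (rep_scale 1 rF) rF _ => w; exact: cdt_scale1.
- move=> a f g /X[F rF] /X[G rG].
  apply: rep_eq (rep_scale a (rep_add rF rG)) (rep_add (rep_scale a rF) (rep_scale a rG)) _ => w.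
  exact: cdt_scaleDr.
- move=> a b f /X[F rF].
  apply: rep_eq (rep_scale (a + b) rF) (rep_add (rep_scale a rF) (rep_scale b rF)) _ => w.
  by rewrite rmorphD cdt_scaleDl.
- move=> f g h /X[F rF] /X[G rG] /X[H rH].
  apply: rep_eq (rep_mul (rep_add rF rG) rH) (rep_add (rep_mul rF rH) (rep_mul rG rH)) _ => w.
  exact: cdt_mulDl.
- move=> f g h /X[F rF] /X[G rG] /X[H rH].
  apply: rep_eq (rep_mul rF (rep_add rG rH)) (rep_add (rep_mul rF rG) (rep_mul rF rH)) _ => w.
  exact: cdt_mulDr.
- move=> a f g /X[F rF] /X[G rG].
  apply: rep_eq (rep_mul (rep_scale a rF) rG) (rep_scale a (rep_mul rF rG)) _ => w.
  exact: cdt_mulZl.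
- move=> a f g /X[F rF] /X[G rG].
  apply: rep_eq (rep_mul rF (rep_scale a rG)) (rep_scale a (rep_mul rF rG)) _ => w.
  exact: cdt_mulZr.
- move=> f /X[F rF].
  by apply: rep_eq (rep_mul rep_one rF) rF _ => w; exact: cdt_mul1l.
- move=> f /X[F rF].
  by apply: rep_eq (rep_mul rF rep_one) rF _ => w; exact: cdt_mul1r.
- move=> f g /X[F rF] /X[G rG].
  apply: rep_eq (rep_mul (rep_mul rF rF) rG) (rep_mul rF (rep_mul rF rG)) _ => w.
  exact: cdt_alt_left.
- move=> f g /X[F rF] /X[G rG].
  apply: rep_eq (rep_mul (rep_mul rG rF) rF) (rep_mul rG (rep_mul rF rF)) _ => w.
  exact: cdt_alt_right.
- move=> f g /X[F rF] /X[G rG].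
  apply: rep_eq (rep_mul (rep_mul rF rG) rF) (rep_mul rF (rep_mul rG rF)) _ => w.
  exact: cdt_alt_flex.
- by apply: rep_eq (rep_conj rep_one) rep_one _ => w; exact: cdt_conj1.
- move=> f g /X[F rF] /X[G rG].
  apply: rep_eq (rep_conj (rep_add rF rG)) (rep_add (rep_conj rF) (rep_conj rG)) _ => w.
  exact: cdt_conjD.
- move=> a f /X[F rF].
  apply: rep_eq (rep_conj (rep_scale a rF)) (rep_scale a (rep_conj rF)) _ => w.
  exact: cdt_conjZ.
- move=> f g /X[F rF] /X[G rG].
  apply: rep_eq (rep_conj (rep_mul rF rG)) (rep_mul (rep_conj rG) (rep_conj rF)) _ => w.
  exact: cdt_conjM.
- move=> f /X[F rF].
  by apply: rep_eq (rep_conj (rep_conj rF)) rF _ => w; exact: cdt_conjK.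
Qed.

Lemma nashT_mul z F G : nashT z F -> nashT z G -> nashT z (fun w => cdt_mul (F w) (G w)).
Proof.
apply: coordwiseM; [by move=> c; exact: nashgC|by move=> u v; exact: nashgD|
  by move=> u v; exact: nashgM].
Qed.

Lemma nashT_add z F G : nashT z F -> nashT z G -> nashT z (fun w => cdt_add (F w) (G w)).
Proof. by apply: coordwiseD => u v; exact: nashgD. Qed.

Lemma nashT_conj z F : nashT z F -> nashT z (fun w => cdt_conj (F w)).
Proof.
apply: coordwise_conj; [by move=> c; exact: nashgC|by move=> u v; exact: nashgM].
Qed.

Lemma nashT_scale z (a : plane -> C) F : nashg z a -> nashT z F ->
  nashT z (fun w => cdt_scale (a w) (F w)).
Proof. by move=> ha; apply: coordwiseZ => // u v; exact: nashgM. Qed.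

Lemma nashT_cst z (t : T) : nashT z (fun=> t).
Proof. by apply: coordwiseC => c; exact: nashgC. Qed.

Lemma SEN_rep f : SEN Om f -> exists F, rep f F /\ near_nash F.
Proof.
move=> hf; have [F rF] := SEM_rep Om_open Om_sat hf.1.
by exists F; split=> //; exact: SEN_near_nash hf.
Qed.

Lemma near_nash_cst (t : T) : near_nash (fun=> t).
Proof. by move=> z Dz; apply/near_dnbhs/plane_nearW => w; exact: nashT_cst. Qed.

Lemma SEN_zero : SEN Om (sa_zero (sem_ops Om)).
Proof. exact: rep_SEN rep_zero (near_nash_cst _). Qed.

Lemma SEN_one : SEN Om (sa_one (sem_ops Om)).
Proof. exact: rep_SEN rep_one (near_nash_cst _). Qed.

Lemma SEN_mul f g : SEN Om f -> SEN Om g -> SEN Om (sem_mul Om f g).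
Proof.
move=> /SEN_rep[F [rF nF]] /SEN_rep[G [rG nG]].
apply: rep_SEN (rep_mul rF rG) _ => z Dz.
by apply: filterS2 (nF z Dz) (nG z Dz) => w; exact: nashT_mul.
Qed.

Lemma SEN_conj f : SEN Om f -> SEN Om (sem_conj Om f).
Proof.
move=> /SEN_rep[F [rF nF]]; apply: rep_SEN (rep_conj rF) _ => z Dz.
by apply: filterS (nF z Dz) => w; exact: nashT_conj.
Qed.

Lemma SEN_subalgebra : @star_subalgebra R (sem_ops Om) (SEM Om) (SEN Om).
Proof.
split=> /=.
- by move=> f [].
- move=> f g /SEN_rep[F [rF nF]] /(SEM_rep Om_open Om_sat)[G rG].
  move=> /(sem_eqP Om_open Om_sat rF rG) FG; apply: rep_SEN rG _ => z Dz.
  have : \forall w \near z^', F w = G w /\ nashT w F.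
    exact: filterI (FG z Dz) (nF z Dz).
  (* The stems agree throughout a punctured square, hence as germs at each of its points, which is
     what transfers the Nash property. *)
  move=> /dnbhs_ballP[e e0 H].
  apply/dnbhs_ballP; exists e => // w bw wz; have [_] := H w bw wz.
  apply: nashT_near; apply: filterS (near_punctured bw wz) => u [uz bu].
  by have [] := H u bu uz.
- exact: SEN_zero.
- exact: SEN_one.
- move=> f g /SEN_rep[F [rF nF]] /SEN_rep[G [rG nG]].
  apply: rep_SEN (rep_add rF rG) _ => z Dz.
  by apply: filterS2 (nF z Dz) (nG z Dz) => w; exact: nashT_add.
- move=> a f /SEN_rep[F [rF nF]]; apply: rep_SEN (rep_scale a rF) _ => z Dz.
  by apply: filterS (nF z Dz) => w; apply: nashT_scale; exact: nashgC.
- exact: SEN_mul.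
- exact: SEN_conj.
Qed.

Lemma SEN_assoc : K = quaternions -> @associative_algebra R (sem_ops Om) (SEN Om).
Proof.
move=> KE f g h /SEN_rep[F [rF _]] /SEN_rep[G [rG _]] /SEN_rep[H [rH _]].
apply: rep_eq (rep_mul (rep_mul rF rG) rH) (rep_mul rF (rep_mul rG rH)) _ => w.
by rewrite cdt_mulA // KE.
Qed.

End Operations.

(** * Inverses *)

Section Inverse.
Variables (R : realType) (K : algebra_kind) (Om : set (alg R K)).
Hypotheses (Om_open : open Om) (Om_sat : saturated Om).
Notation C := (R[i]%C).
Notation A := (alg R K).
Notation plane := (plane R).
Notation n := (cdlevel K).
Notation T := (cdt C n).
Notation pr := (@half_plane_proj R K).
Notation D := (planar Om).
Implicit Types (x y : A) (z w : plane) (I J : A) (S : set plane).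
Implicit Types (F G : plane -> T) (f g : pslice R K).
Notation rep := (rep Om).
Notation near_nash := (near_nash Om).

Lemma rep_of_mero S F : mero_stem Om S F -> exists f, rep f F.
Proof.
move=> mF; have pS := planar_preimage_pr K (mero_conj mF).
exists (PSlice (pr @^-1` S) (slice_of (D `\` S) (dec F))); split=> /=.
- exact: preimage_pr_saturated.
- by rewrite pS.
- rewrite pS; apply: slice_ofP; last exact: mero_stem_eq mF.
  move=> z [Dz Sz]; split; first exact: planar_Om_conj.
  by move/(mero_conj mF); rewrite planeconjK.
Qed.

Lemma lower_bounded_mul z (a b : plane -> C) : lower_bounded z a -> lower_bounded z b ->
  lower_bounded z (fun w => a w * b w).
Proof.
move=> [c c0 [m h]] [d d0 [l k]]; exists (c * d); first by rewrite mulr_gt0.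
exists (m + l)%N; apply: filterS2 h k => w h k.
by rewrite nsqM exprD mulrACA; apply: ler_pM => //;
  rewrite mulr_ge0 ?exprn_ge0 ?nsq_ge0 // ltW.
Qed.

(** A polynomial is Nash, so the dichotomy applies, and [delta z] is non-zero near [z^']. *)
Lemma lower_bounded_delta z : lower_bounded z (delta z).
Proof.
have h : \forall w \near z^', nashg w (delta z).
  apply/near_dnbhs/plane_nearW => w.
  by apply: nashgM; apply: nashgB; try exact: nashg_toC; exact: nashgC.
case: (nash_punctured_dichotomy h) => // g0.
by have [w _ [-> ]] := dnbhs_neq0 (filterI g0 (near_delta_neq0 z)); rewrite eqxx.
Qed.

Lemma lower_boundedX z (a : plane -> C) k : lower_bounded z a ->
  lower_bounded z (fun w => a w ^+ k).
Proof.
move=> h; elim: k => [|k IH].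
  exists 1 => //; exists 0%N; apply/near_dnbhs/plane_nearW => w.
  by rewrite !expr0 /nsq /= expr0n /= addr0 expr1n mulr1.
have := lower_bounded_mul h IH => -[c c0 [m H]].
by exists c => //; exists m; apply: filterS H => w; rewrite exprS.
Qed.

Definition mero_inv F : plane -> T := fun w => cdt_scale (cdt_norm (F w))^-1 (cdt_conj (F w)).

Lemma holT_norm z F : holT z F -> holg z (fun w => cdt_norm (F w)).
Proof.
by apply: coordwise_norm => u v; [exact: holgD|exact: holgM].
Qed.

Lemma nashT_norm z F : nashT z F -> nashg z (fun w => cdt_norm (F w)).
Proof.
by apply: coordwise_norm => u v; [exact: nashgD|exact: nashgM].
Qed.

(** Let G be delta^(k+1) F, which is holomorphic. Its norm is delta^(2k+2) N(F), still bounded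
    below, and F^c / N(F) equals delta^(k+1) G^c / N(G) where [delta z] is non-zero; so clearing the
    poles of 1 / N(G) suffices. *)
Lemma polar_inv z F : polar z F -> lower_bounded z (fun w => cdt_norm (F w)) ->
  polar z (mero_inv F).
Proof.
move=> [k hG] lb; set G := fun w => cdt_scale (delta z w ^+ k.+1) (F w) in hG.
have NG w : cdt_norm (G w) = delta z w ^+ k.+1 * delta z w ^+ k.+1 * cdt_norm (F w).
  exact: cdt_norm_scale.
have lG : lower_bounded z (fun w => cdt_norm (G w)).
  have ld := lower_boundedX k.+1 (lower_bounded_delta z).
  have [c c0 [m H]] := lower_bounded_mul (lower_bounded_mul ld ld) lb.
  by exists c => //; exists m; apply: filterS H => w; rewrite NG.
have [B dB] := delta_bound z.
have dz : delta z z = 0 by apply/delta_eq0; left.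
have [m hm] := holg_pole_extension (holg_delta z z) (holT_norm hG) lG dz
  (near_delta_neq0 z) dB.
exists m.
(* Besides the k + 1 factors that turn G^c / N(G) into F^c / N(F), one more is needed to pass from
   delta^m to delta^(m+1). *)
have := holT_scale (holgX k.+2 (holg_delta z z)) (holT_scale hm (holT_conj hG)).
apply: holT_eq => w.
have [d0|d0] := eqVneq (delta z w) 0.
  by rewrite d0 !exprS !mul0r !cdt_scale0.
rewrite NG /G cdt_conjZ /mero_inv !cdt_scaleA; congr (cdt_scale _ _).
move: (cdt_norm (F w)) (delta z w) d0 => N d d0.
rewrite !invfM [d ^+ k.+2]exprS [d ^+ m.+1]exprS.
have dk : d ^+ k.+1 != 0 by rewrite expf_neq0.
move: (d ^+ k.+1) (d ^+ m) dk => e e' e0.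
by move: (N^-1) => v; field.
Qed.

Lemma conjcV (x : C) : conjc x^-1 = (conjc x)^-1.
Proof.
have [->|x0] := eqVneq x 0.
  by rewrite invr0 /= oppr0 invr0.
have c0 : conjc x != 0.
  by case: x x0 => a b; rewrite !eq_complex /= oppr_eq0.
apply: (mulfI c0); rewrite -conjcM !mulfV //.
by rewrite /= oppr0.
Qed.

Lemma mero_inverse f F : rep f F -> near_nash F ->
  (forall z, D z -> lower_bounded z (fun w => cdt_norm (F w))) ->
  exists g, rep g (mero_inv F) /\ near_nash (mero_inv F).
Proof.
move=> [sf mf rf] nF lb.
(* The inverse may be singular at the old singularities and at the zeros of the norm; the lower
   bound makes the latter discrete. *)
pose Q w := ~ (~ planar (sing f) w /\ cdt_norm (F w) != 0).
have HQ z : D z -> \forall w \near z^', ~ Q w.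
  move=> Dz.
  apply: filterS2 (mero_disc mf Dz) (lower_bounded_neq0 (lb z Dz)) => w h1 h2 h.
  by apply: h.
have [W0 [d0 s0 pE]] := discrete_of_near Om_open Om_sat HQ.
set S := [set w | _] in pE.
have hS z : (D `\` S) z -> (D `\` planar (sing f)) z /\ cdt_norm (F z) != 0.
  move=> [Dz Sz]; have : ~ Q z by move=> h; apply: Sz; split=> //; left.
  by move=> /contrapT[].
have [g rg] : exists g, rep g (mero_inv F).
  apply: (@rep_of_mero S); split.
  - by move=> z [].
  - move=> z [Dz h]; split; first exact: planar_Om_conj.
    by case: h => h; [right; rewrite planeconjK|left].
  - by have /(discrete_singularitiesP _ Om_sat Om_open)[_ _] := d0; rewrite pE.
  - move=> z /hS[h N0]; rewrite /mero_inv (mero_stem_eq mf) // cdt_bar_norm.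
    by rewrite cdt_barZ conjcV cdt_bar_conj.
  - move=> z /hS[h N0]; have hF := mero_hol mf h.
    by apply: holT_scale; [apply: holgV => //; exact: holT_norm|exact: holT_conj].
  - by move=> z Dz; apply: polar_inv; [exact: mero_polar mf _ Dz|exact: lb].
exists g; split=> // z Dz.
apply: filterS2 (nF z Dz) (lower_bounded_neq0 (lb z Dz)) => w h N0.
by apply: nashT_scale; [apply: nashgV => //; exact: nashT_norm|exact: nashT_conj].
Qed.

(** In the octonionic case g (f x) = x cannot be had from associativity. The identities x^c (x y) =
    n(x) y and their mirror images still give existence and uniqueness, with solutions g b and b
    g. *)
Lemma SEN_division f F : rep f F -> near_nash F ->
  (forall z, D z -> lower_bounded z (fun w => cdt_norm (F w))) ->
  @has_inverse R (sem_ops Om) (SEN Om) f /\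
  forall b : sem_ops Om, SEN Om b ->
   (exists x : pslice R K, [/\ SEN Om x, sem_eq Om (sem_mul Om f x) b &
      forall x' : pslice R K, SEN Om x' -> sem_eq Om (sem_mul Om f x') b -> sem_eq Om x' x]) /\
   (exists y : pslice R K, [/\ SEN Om y, sem_eq Om (sem_mul Om y f) b &
      forall y' : pslice R K, SEN Om y' -> sem_eq Om (sem_mul Om y' f) b -> sem_eq Om y' y]).
Proof.
move=> rF nF lb; have [g [rG nG]] := mero_inverse rF nF lb.
have n3 := level_le3 K.
have Sg : SEN Om g by exact: rep_SEN rG nG.
have nz z : D z -> \forall w \near z^', cdt_norm (F w) != 0.
  by move=> Dz; exact: lower_bounded_neq0 (lb z Dz).
have E f1 f2 F1 F2 := @sem_eqP R K Om Om_open Om_sat f1 f2 F1 F2.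
have rmul f1 f2 F1 F2 := @rep_mul R K Om Om_open Om_sat f1 f2 F1 F2.
split.
  exists g; split=> //.
  - apply/(E _ _ _ _ (rmul _ _ _ _ rF rG) (rep_one Om)) => z Dz.
    apply: filterS (nz z Dz) => w N0.
    by rewrite /mero_inv cdt_mulZr cdt_mul_conj cdt_scaleA mulVf // cdt_scale1.
  - apply/(E _ _ _ _ (rmul _ _ _ _ rG rF) (rep_one Om)) => z Dz.
    apply: filterS (nz z Dz) => w N0.
    by rewrite /mero_inv cdt_mulZl cdt_conj_mul cdt_scaleA mulVf // cdt_scale1.
move=> b Sb; have [B [rB nB]] := SEN_rep Om_open Om_sat Sb; split.
  exists (sem_mul Om g b); split; first exact: SEN_mul.
  - apply/(E _ _ _ _ (rmul _ _ _ _ rF (rmul _ _ _ _ rG rB)) rB) => z Dz.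
    apply: filterS (nz z Dz) => w N0.
    by rewrite /mero_inv cdt_mulZl cdt_mulZr cdt_mul_conjK // cdt_scaleA mulVf // cdt_scale1.
  - move=> x' /(SEN_rep Om_open Om_sat)[X [rX nX]] /(E _ _ _ _ (rmul _ _ _ _ rF rX) rB) H.
    apply/(E _ _ _ _ rX (rmul _ _ _ _ rG rB)) => z Dz.
    apply: filterS2 (nz z Dz) (H z Dz) => w N0 <-.
    by rewrite /mero_inv cdt_mulZl cdt_conj_mulK // cdt_scaleA mulVf // cdt_scale1.
exists (sem_mul Om b g); split; first exact: SEN_mul.
- apply/(E _ _ _ _ (rmul _ _ _ _ (rmul _ _ _ _ rB rG) rF) rB) => z Dz.
  apply: filterS (nz z Dz) => w N0.
  by rewrite /mero_inv cdt_mulZr cdt_mulZl cdt_mulK // cdt_scaleA mulVf // cdt_scale1.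
- move=> x' /(SEN_rep Om_open Om_sat)[X [rX nX]] /(E _ _ _ _ (rmul _ _ _ _ rX rF) rB) H.
  apply/(E _ _ _ _ rX (rmul _ _ _ _ rB rG)) => z Dz.
  apply: filterS2 (nz z Dz) (H z Dz) => w N0 <-.
  by rewrite /mero_inv cdt_mulZr cdt_mulK_conj // cdt_scaleA mulVf // cdt_scale1.
Qed.

Lemma cdt_one_neq0 : cdt_one C n <> cdt_zero C n.
Proof.
move=> /(congr1 (@cdc_re R n)); rewrite cdc_re1 cdc_re0 => /(congr1 (@cdre R n)).
by rewrite cdre0 -[cdone R n]scale1r cdreZ1 => /eqP; rewrite oner_eq0.
Qed.

Lemma SEN_one_neq0 : Om !=set0 -> ~ sem_eq Om (sa_one (sem_ops Om)) (sa_zero (sem_ops Om)).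
Proof.
move=> On0 /(sem_eqP Om_open Om_sat (rep_one Om) (rep_zero Om)) H.
by have [z _ /cdt_one_neq0] := punctured_nonempty Om_open Om_sat H On0.
Qed.

End Inverse.

(** * Vanishing of a stem, one coordinate at a time *)

Section CoordinatewiseVanishing.
Variable R : realType.
Notation C := (R[i]%C).
Notation plane := (plane R).

Lemma coordwise_filter (Fi : set_system plane) (FF : Filter Fi) (P : plane -> (plane -> C) -> Prop) m
    (F : plane -> cdt C m) :
  (\forall w \near Fi, coordwise (P w) F) -> coordwise (fun g => \forall w \near Fi, P w g) F.
Proof.
elim: m F => [|m IH] F //= H; split; apply: IH; apply: filterS H => w [] //.
Qed.

(** Exchanging the quantifier with [coordwise] hands to each scalar coordinate its hypotheses at all
    points at once, as the global dichotomy requires. *)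
Lemma coordwise_forall (I : Type) (P : I -> (plane -> C) -> Prop) m (F : plane -> cdt C m) :
  (forall i, coordwise (P i) F) <-> coordwise (fun g => forall i, P i g) F.
Proof.
elim: m F => [|m IH] F //=; split.
  by move=> H; split; apply/IH => i; case: (H i).
by move=> [/IH h1 /IH h2] i; split.
Qed.

Lemma coordwise_germ0 z m (F : plane -> cdt C m) :
  coordwise (germ0 z) F <-> \forall w \near z^', F w = cdt_zero C m.
Proof.
elim: m F => [|m IH] F //=; rewrite !IH; split.
  by move=> [h1 h2]; apply: filterS2 h1 h2 => w; case: (F w) => a b /= -> ->.
by move=> H; split; apply: filterS H => w ->.
Qed.

Lemma coordwise_zero_at w m (F : plane -> cdt C m) :
  F w = cdt_zero C m -> coordwise (fun g => g w = 0) F.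
Proof. by elim: m F => [|m IH] F //= H; split; apply: IH; rewrite H. Qed.

End CoordinatewiseVanishing.

(** * Symmetric slice domains and product domains *)

Section Domains.
Variables (R : realType) (K : algebra_kind) (Om : set (alg R K)).
Hypotheses (Om_open : open Om) (Om_sat : saturated Om).
Notation C := (R[i]%C).
Notation A := (alg R K).
Notation plane := (plane R).
Notation n := (cdlevel K).
Notation T := (cdt C n).
Notation pr := (@half_plane_proj R K).
Notation D := (planar Om).
Implicit Types (x y : A) (z w : plane) (I J : A) (S : set plane).
Implicit Types (F G : plane -> T) (f g : pslice R K).
Notation rep := (rep Om).
Notation near_nash := (near_nash Om).

Lemma norm_dichotomy F (E : set plane) : near_nash F -> connected E -> E `<=` D ->
  (forall z, E z -> germ0 z (fun w => cdt_norm (F w))) \/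
  (forall z, E z -> lower_bounded z (fun w => cdt_norm (F w))).
Proof.
move=> nF cE ED; apply: nash_global_dichotomy => // z /ED Dz.
by apply: filterS (nF z Dz) => w; exact: nashT_norm.
Qed.

(* polarization: for [x = a + b I] the second component is [b] *)
Definition slice_coord I x : plane :=
  (cdre (x : CD R n), (cdnorm (x + I : CD R n) - cdnorm (x : CD R n) - 1) / 2).

Lemma slice_coordK I z : imunit I -> slice_coord I (slice_point z.1 z.2 I) = z.
Proof.
move=> /imunitE[r0 n1]; rewrite /slice_coord.
have e1 : cdre (slice_point z.1 z.2 I : CD R n) = z.1.
  by rewrite [LHS]cdre_slice r0 mulr0 addr0.
have e2 : cdnorm (slice_point z.1 z.2 I : CD R n) = z.1 ^+ 2 + z.2 ^+ 2.
  by rewrite [LHS]cdnorm_slice r0 n1 mulr0 mul0rn addr0 mulr1.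
have e3 : cdnorm (slice_point z.1 z.2 I + I : CD R n) = z.1 ^+ 2 + (z.2 + 1) ^+ 2.
  have -> : (slice_point z.1 z.2 I + I : CD R n) = slice_point z.1 (z.2 + 1) I.
    by rewrite /slice_point scalerDl scale1r addrA.
  by rewrite [LHS]cdnorm_slice r0 n1 mulr0 mul0rn addr0 mulr1.
rewrite e1 e2 e3; case: (z) => a b /=; congr pair.
by field.
Qed.

Lemma slice_coord_continuous I : continuous (slice_coord I : A -> plane).
Proof.
move=> x; have c1 := @cdre_continuous R n x; have c2 := @cdnorm_continuous R n x.
have c3 : (fun y : A => cdnorm (y + I : CD R n) : R^o) @ x --> (cdnorm (x + I : CD R n) : R^o).
  apply: (@cvg_comp _ _ _ (fun y : A => y + I) (@cdnorm R n : CD R n -> R^o));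
    last exact: cdnorm_continuous.
  by apply: cvgD; [exact: cvg_id|exact: cvg_cst].
have c4 : (fun y : A => (cdnorm (y + I : CD R n) - cdnorm (y : CD R n) - 1) / 2 : R^o) @ x -->
    ((cdnorm (x + I : CD R n) - cdnorm (x : CD R n) - 1) / 2 : R^o).
  apply: cvgM; last exact: cvg_cst.
  by apply: cvgB; [exact: cvgB|exact: cvg_cst].
exact: cvg_pair c1 c4.
Qed.

Lemma slice_coord_image_connected I (U : set A) : connected U -> connected (slice_coord I @` U).
Proof.
move=> cU; apply: connected_continuous_connected => //.
by apply: continuous_subspaceT; exact: slice_coord_continuous.
Qed.

(** Through this continuous image, connectedness of pieces of a slice passes to the plane. *)
Lemma planar_slice_coord I : imunit I -> D = slice_coord I @` (Om `&` slice_line I).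
Proof.
move=> hI; apply/seteqP; split=> z.
  move=> /(planarP _ Om_sat hI) h; exists (slice_point z.1 z.2 I); last exact: slice_coordK.
  by split=> //; exists z.1, z.2.
move=> [x [Ox [a [b xE]]] <-]; rewrite xE in Ox *.
rewrite (slice_coordK (a, b) hI); exists I => //.
Qed.

Lemma ssd_planar_connected : symmetric_slice_domain Om -> connected D.
Proof.
move=> [_ H]; have [I hI] := @imunit_exists R K.
by rewrite (planar_slice_coord hI); apply: slice_coord_image_connected; exact: H.
Qed.

(** The second coordinates form an interval, and conjugation makes it symmetric, so it contains
    0. *)
Lemma connected_real_point : connected D -> Om !=set0 -> exists a : R, D (a, 0).
Proof.
move=> cD [x Ox].
have Dx : D (pr x) by apply/planar_pr.
have c2 : connected ((snd : plane -> R^o) @` D).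
  apply: connected_continuous_connected => //.
  by apply: continuous_subspaceT; exact: (@snd_continuous R R^o R^o).
have /connected_intervalP iv : connected ((snd : plane -> R) @` D) by exact: c2.
have : ((snd : plane -> R) @` D) 0.
  apply: (iv (- (pr x).2) (pr x).2).
  - by exists (planeconj (pr x)) => //; exact: planar_Om_conj.
  - by exists (pr x).
  - by apply/andP; split; [rewrite oppr_le0|]; exact: pr_ge0.
by move=> [[a b] Dab /= b0]; exists a; rewrite -b0.
Qed.

(** A value fixed by [cdt_bar] has no iota part, and its norm is then a real sum of squares. *)
Lemma real_norm_zero F z : F z = cdt_bar (F z) -> cdt_norm (F z) = 0 -> F z = cdt_zero C n.
Proof.
move=> h N0.
have i0 : cdc_im (F z) = 0.
  apply: addrr_inj; rewrite addr0 {1}h cdc_im_bar addNr //.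
have N1 : cdt_norm (cdc (cdc_re (F z)) 0) = ((cdnorm (cdc_re (F z)))%:C)%C.
  elim: (n) (cdc_re (F z)) => [|m IH] x /=.
    by rewrite /cdnorm /= rmorphM.
  by rewrite !IH -rmorphD.
have : cdnorm (cdc_re (F z)) = 0.
  by move: N0; rewrite -[F z]cdcK i0 N1 cdc_reK => -[].
move=> /cdnorm_eq0 r0; apply: cdc_inj; rewrite ?cdc_re0 ?cdc_im0 //.
Qed.

(* otherwise [N(F)], hence [F], vanishes on a real segment *)
Lemma ssd_lower_bounded f F : symmetric_slice_domain Om -> Om !=set0 ->
  rep f F -> near_nash F -> ~ sem_eq Om f (sa_zero (sem_ops Om)) ->
  forall z, D z -> lower_bounded z (fun w => cdt_norm (F w)).
Proof.
move=> ssd On0 rF nF f0; have cD := ssd_planar_connected ssd.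
have [sf mf rf] := rF.
case: (norm_dichotomy nF cD (fun z h => h)) => // g0; case: f0.
apply/(sem_eqP Om_open Om_sat rF (rep_zero Om)).
have [a Da] := connected_real_point cD On0.
have : \forall w \near ((a, 0) : plane)^', cdt_norm (F w) = 0 /\ (D `\` planar (sing f)) w.
  have h1 := near_dnbhs (planar_Om_near Om_open Om_sat Da); have h2 := mero_disc mf Da.
  by apply: filterS3 (g0 _ Da) h1 h2 => w ? ? ?.
move=> /dnbhs_ballP[e e0 H].
have F0 t : 0 < t < e -> F (a + t, 0) = cdt_zero C n.
  move=> /andP[t0 te].
  have [||N0 Dt] := H (a + t, 0).
  - apply/ball_planeE => /=; rewrite subrr normr0 e0; split=> //.
    by rewrite opprD addrA subrr sub0r normrN gtr0_norm.
  - by apply/eqP => /(congr1 fst) /=; lra.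
  - apply: real_norm_zero N0.
    by rewrite -(mero_stem_eq mf) // /planeconj /= oppr0.
suff : coordwise (fun u : plane -> C => forall z, D z -> germ0 z u) F.
  by move=> h z Dz; apply/coordwise_germ0; apply: coordwise_impl h => u; exact.
(* Each coordinate is Nash near every puncture and zero on a real segment ending at a, so the scalar
   dichotomy on D leaves only the vanishing case. *)
have h1 : coordwise (fun u : plane -> C => forall i : {z | D z}, \forall w \near (sval i)^', nashg w u) F.
  apply/coordwise_forall => -[z Dz] /=.
  by apply: (@coordwise_filter _ (dnbhs z) _ (fun w (u : plane -> C) => nashg w u)); exact: nF.
have h2 : coordwise (fun u : plane -> C => forall i : {t : R | 0 < t < e}, u (a + sval i, 0) = 0) F.
  apply/coordwise_forall => -[t ht] /=.
  exact: (coordwise_zero_at (F0 t ht)).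
apply: coordwise_impl (coordwise_and h1 h2) => u [ng vg].
case: (nash_global_dichotomy cD (fun z Dz => ng (exist _ z Dz))) => // lb.
have /dnbhs_ballP[d d0 Hd] := lower_bounded_neq0 (lb _ Da).
(* A point of the segment where F vanishes that also lies in the square where u would be
   non-zero. *)
pose t := Num.min e d / 2.
have t0 : 0 < t by rewrite divr_gt0 // lt_min e0 d0.
have tm : t < Num.min e d by rewrite /t; move: t0; rewrite /t; lra.
have te : t < e by apply: lt_le_trans tm _; rewrite ge_min lexx.
have td : t < d by apply: lt_le_trans tm _; rewrite ge_min lexx orbT.
have t0e : 0 < t < e by rewrite t0 te.
have h3 : ball ((a, 0) : plane) d (a + t, 0).
  apply/ball_planeE => /=; rewrite subrr normr0 d0; split=> //.
  by rewrite opprD addrA subrr sub0r normrN gtr0_norm.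
have h4 : ((a + t, 0) : plane) != (a, 0) by apply/eqP => /(congr1 fst) /=; lra.
have /eqP h5 := Hd _ h3 h4.
by case: h5; exact: (vg (exist _ t t0e)).
Qed.

Lemma normal_rep f F : rep f F ->
  rep (sem_normal Om f) (fun w => cdt_mul (F w) (cdt_conj (F w))).
Proof. by move=> rF; apply: rep_mul => //; exact: rep_conj. Qed.

Lemma germ0_planeconj f F z : rep f F -> D z ->
  germ0 z (fun w => cdt_norm (F w)) -> germ0 (planeconj z) (fun w => cdt_norm (F w)).
Proof.
move=> [sf mf rf] Dz g0.
have h1 := near_dnbhs (planar_Om_near Om_open Om_sat Dz); have h2 := mero_disc mf Dz.
have h : \forall w \near z^', cdt_norm (F (planeconj w)) = 0.
  apply: filterS3 g0 h1 h2 => w N0 Dw Sw.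
  by rewrite (mero_stem_eq mf) // cdt_bar_norm N0 /= oppr0.
have h3 := dnbhs_planeconj h; apply: filterS h3 => w.
by rewrite planeconjK.
Qed.

Section Product.
Hypothesis pd : product_domain Om.

Lemma cdconj_slice_point (a b : R) I : imunit I ->
  alg_conj (slice_point a b I) = slice_point a (- b) I.
Proof.
move=> hI; have := trace_slice_point a b hI; rewrite /alg_tr => h.
have -> : alg_conj (slice_point a b I) = (a *+ 2) *: alg_one R K - slice_point a b I.
  by rewrite -h addrC addKr.
rewrite /slice_point opprD addrA -scalerBl scaleNr; congr (_ *: _ + _).
by rewrite mulr2n addrK.
Qed.

(** A real point of the slice is fixed by conjugation, hence lies in both components, which would
    then coincide. *)
Lemma product_no_real z : D z -> z.2 != 0.
Proof.
move=> Dz; apply/eqP => z2.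
have [I hI] := @imunit_exists R K; have [_ H] := pd.
have [x [y /=]] := H I hI.
set L := Om `&` slice_line I; set U := connected_component L x; set V := connected_component L y.
move=> [Lx Ly UV LE UVc]; apply: UV.
set p := slice_point z.1 z.2 I.
have Lp : L p by split; [apply/(planarP _ Om_sat hI)|exists z.1, z.2].
have pc : alg_conj p = p by rewrite /p z2 cdconj_slice_point // oppr0.
have [Up Vp] : U p /\ V p.
  have UV' : U p -> V p by move=> Up; rewrite -UVc; exists p.
  move: Lp; rewrite LE => -[Up|Vp]; first by split; auto.
  split=> //; move: Vp; rewrite -UVc => -[u Uu uE].
  suff : u = p by move=> <-.
  have [_ [a [b ub]]] := connected_component_sub Uu.
  have : alg_conj (alg_conj u) = u by rewrite ub !cdconj_slice_point // opprK.
  by rewrite uE pc.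
exact: (etrans (same_connected_component Up) (esym (same_connected_component Vp))).
Qed.

(** The dichotomy holds on the two halves of D separately. Conjugation exchanges them and preserves
    vanishing of the norm, so both halves fall into the same case, and vanishing on both means N(f)
    = 0. *)
Lemma product_lower_bounded f F : rep f F -> near_nash F ->
  ~ sem_eq Om (sem_normal Om f) (sa_zero (sem_ops Om)) ->
  forall z, D z -> lower_bounded z (fun w => cdt_norm (F w)).
Proof.
move=> rF nF Nf0.
have [I hI] := @imunit_exists R K; have [_ H] := pd.
have [x [y /=]] := H I hI.
set L := Om `&` slice_line I; set U := connected_component L x; set V := connected_component L y.
move=> [Lx Ly _ LE UVc].
have DE : D = slice_coord I @` U `|` slice_coord I @` V.
  by rewrite (planar_slice_coord hI) -/L LE image_setU.
have UD : slice_coord I @` U `<=` D by rewrite DE; left.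
have VD : slice_coord I @` V `<=` D by rewrite DE; right.
have cU := slice_coord_image_connected (I := I) (@component_connected _ L x).
have cV := slice_coord_image_connected (I := I) (@component_connected _ L y).
pose p := slice_coord I x.
have Up : (slice_coord I @` U) p by exists x => //; exact: connected_component_refl.
have Vp : (slice_coord I @` V) (planeconj p).
  exists (alg_conj x); first by rewrite -UVc; exists x => //; exact: connected_component_refl.
  have [_ [a [b xE]]] := Lx.
  by rewrite /p xE cdconj_slice_point // (slice_coordK (a, - b) hI) (slice_coordK (a, b) hI).
have Dp := UD _ Up; have Dpc := VD _ Vp.
case: (norm_dichotomy nF cU UD) => hU; case: (norm_dichotomy nF cV VD) => hV.
- case: Nf0; apply/(sem_eqP Om_open Om_sat (normal_rep rF) (rep_zero Om)) => z.
  move=> Dz; have g0 : germ0 z (fun w => cdt_norm (F w)).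
    by move: Dz; rewrite DE => -[/hU|/hV].
  by apply: filterS g0 => w N0; rewrite cdt_mul_conj N0 cdt_scale0.
- case: (germ0_lower_bounded (germ0_planeconj rF Dp (hU _ Up)) (hV _ Vp)).
- have := germ0_planeconj rF Dpc (hV _ Vp); rewrite planeconjK => h.
  case: (germ0_lower_bounded h (hU _ Up)).
- by move=> z; rewrite DE => -[/hU|/hV].
Qed.

Definition zero_divisor J : plane -> T :=
  fun w => cdc (cdone R n) (Num.sg w.2 *: (J : CD R n)).

(** With s the sign, (iota s J)^2 = (-1)(1)(-1) = 1, while conjugation changes the sign of J; hence
    the product is 1 - 1 = 0. *)
Lemma zero_divisor_normal J w : imunit J -> w.2 != 0 ->
  cdt_mul (zero_divisor J w) (cdt_conj (zero_divisor J w)) = cdt_zero C n.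
Proof.
move=> hJ w0; have /imunitE[r0 n1] := hJ.
have cJ : cdconj (J : CD R n) = - (J : CD R n).
  have := @cdconj_slice_point 0 1 J hJ; rewrite /slice_point !scale0r !add0r scale1r scaleN1r.
  by [].
have c1 : cdconj (cdone R n) = cdone R n.
  by apply: cdr_inj; rewrite cdr_conj cdr1 cdt_conj1.
have cZ (a : R) (v : CD R n) : cdconj (a *: v) = a *: cdconj v.
  by apply: cdr_inj; rewrite !cdr_conj !cdrZ cdr_conj cdt_conjZ.
have s2 : Num.sg w.2 * Num.sg w.2 = 1 by rewrite -expr2 sqr_sg w0.
have JJ : cdmul (J : CD R n) (J : CD R n) = - cdone R n := hJ.
apply: cdc_inj; rewrite ?(proj1 (cdc_reM_imM _ _)) ?(proj2 (cdc_reM_imM _ _)).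
  rewrite cdc_re_conj cdc_im_conj !cdc_reK !cdc_imK cdc_re0 c1 cdmul1l cZ cJ.
  by rewrite cdmulZl cdmulZr cdmulNr JJ opprK scalerA s2 scale1r subrr.
rewrite cdc_re_conj cdc_im_conj !cdc_reK !cdc_imK cdc_im0 c1 cdmul1l cZ cJ cdmul1r.
by rewrite scalerN addNr.
Qed.

(** Off the real axis the sign is locally constant, and constants are Nash. *)
Lemma zero_divisor_nash J z : z.2 != 0 -> nashT z (zero_divisor J).
Proof.
move=> z0; apply: (@nashT_near _ z _ (fun=> zero_divisor J z)); last exact: nashT_cst.
have H : \forall w \near z, Num.sg w.2 = Num.sg z.2.
  have [c1 c2] := ccont_toC z.
  have [z2|z2|z2] := ltgtP z.2 0; last by rewrite z2 eqxx in z0.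
  - have := cvgr_lt _ c2 _ z2 => h.
    have {}h : \forall w \near z, w.2 < 0 by exact: h.
    by apply: filterS h => w h; rewrite !ltr0_sg.
  - have := cvgr_gt _ c2 _ z2 => h.
    have {}h : \forall w \near z, 0 < w.2 by exact: h.
    by apply: filterS h => w h; rewrite !gtr0_sg.
by apply: filterS H => w h; rewrite /zero_divisor h.
Qed.

Lemma product_zero_divisor : Om !=set0 -> exists f : pslice R K,
  [/\ SEN Om f, ~ sem_eq Om f (sa_zero (sem_ops Om)) &
      sem_eq Om (sem_normal Om f) (sa_zero (sem_ops Om))].
Proof.
move=> On0; have [J hJ] := @imunit_exists R K.
have mF : mero_stem Om set0 (zero_divisor J).
  split=> //.
  - by move=> z Dz; apply/dnbhs_ballP; exists 1 => // w _ _ [].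
  - move=> z Dz; apply: cdc_inj; rewrite ?cdc_re_bar ?cdc_im_bar !(cdc_reK, cdc_imK) //.
    by rewrite /planeconj /= sgrN scaleNr.
  - by move=> z [Dz _]; apply/nashT_holT/zero_divisor_nash/product_no_real.
  - by move=> z Dz; apply/holT_polar/nashT_holT/zero_divisor_nash/product_no_real.
have [f rF] := rep_of_mero Om_sat mF.
have nz z : D z -> \forall w \near z^', w.2 != 0.
  by move=> Dz; apply: filterS (near_dnbhs (planar_Om_near Om_open Om_sat Dz)) => w; exact: product_no_real.
exists f; split.
- apply: rep_SEN rF _ => // z Dz.
  by apply: filterS (nz z Dz) => w; exact: zero_divisor_nash.
- move=> /(sem_eqP Om_open Om_sat rF (rep_zero Om)) H.
  have [z _ /(congr1 (@cdc_re R n))] := punctured_nonempty Om_open Om_sat H On0.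
  rewrite cdc_reK cdc_re0 => /(congr1 (@cdre R n)).
  by rewrite cdre0 -[cdone R n]scale1r cdreZ1 => /eqP; rewrite oner_eq0.
- apply/(sem_eqP Om_open Om_sat (normal_rep rF) (rep_zero Om)) => z Dz.
  by apply: filterS (nz z Dz) => w; exact: zero_divisor_normal.
Qed.

End Product.

End Domains.

Theorem theorem1p6 (R : realType) (K : algebra_kind) (Om : set (alg R K))
    (Om_open : open Om) (Om_neq0 : Om !=set0) (Om_circ : circular Om) :
  let X := sem_ops Om in
  let SEM_A : X -> Prop := SEM Om in
  let SEN_A : X -> Prop := SEN Om in
  [/\ alternative_star_algebra SEM_A /\ star_subalgebra SEM_A SEN_A,
      K = quaternions -> associative_algebra SEN_A,
      symmetric_slice_domain Om -> division_algebra SEN_A &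
      product_domain Om ->
        (exists f : X, [/\ SEN_A f, ~ sa_eqv f (sa_zero X) &
           sa_eqv (sem_normal Om f : X) (sa_zero X)]) /\
        (forall f : X, SEN_A f -> ~ sa_eqv (sem_normal Om f : X) (sa_zero X) ->
           has_inverse SEN_A f)].
Proof.
have Om_sat := (circularP Om).1 Om_circ.
move=> X SEM_A SEN_A; split.
- by split; [exact: SEM_algebra|exact: SEN_subalgebra].
- exact: SEN_assoc.
- move=> ssd; split; first exact: SEN_one_neq0.
  move=> f Sf f0; have [F [rF nF]] := SEN_rep Om_open Om_sat Sf.
  apply: (SEN_division Om_open Om_sat rF nF).
  exact: (ssd_lower_bounded Om_open Om_sat ssd Om_neq0 rF nF f0).
- move=> pd; split; first exact: product_zero_divisor.
  move=> f Sf f0; have [F [rF nF]] := SEN_rep Om_open Om_sat Sf.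
  have [] := SEN_division Om_open Om_sat rF nF => //.
  exact: (product_lower_bounded Om_open Om_sat pd rF nF f0).
Qed.
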